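(* Let $\mathbb{P}$ be the Euclidean plane, the (unit) sphere, or the hyperbolic plane, let $\lambda\ge 0$, and let $r>0$; in the spherical case assume also $r<\frac{\pi}{3}$. Let $\mathcal{F}$ be a packing of disks of radius $r$ in $\mathbb{P}$, let $\mathbf{B}$ be an element of $\mathcal{F}$ with center $\mathbf{q}$, and let $\mathbf{V}$ be the Voronoi cell of $\mathbf{B}$; in the spherical case assume also that the distance of every vertex of $\mathbf{V}$ from $\mathbf{q}$ is less than $\frac{\pi}{2}$. Let $\mathbf{B}_\lambda$ be the disk of radius $(1+\lambda)r$ concentric with $\mathbf{B}$. Let $\mathbf{T}_r$ be a regular triangle in $\mathbb{P}$ with side length $2r$ and vertices $\mathbf{p}_1,\mathbf{p}_2,\mathbf{p}_3$, and for $i=1,2,3$ let $\mathbf{B}_i$ and $\mathbf{B}_i'$ be the disks centered at $\mathbf{p}_i$ of radius $r$ and $(1+\lambda)r$, respectively. Then $$\frac{\mathrm{area}(\mathbf{B})}{\mathrm{area}(\mathbf{B}_\lambda\cap\mathbf{V})}\le\frac{\mathrm{area}\left(\bigcup_{i=1}^3\mathbf{B}_i\cap\mathbf{T}_r\right)}{\mathrm{area}\left(\bigcup_{i=1}^3\mathbf{B}_i'\cap\mathbf{T}_r\right)}\quad\text{and}\quad\frac{\mathrm{area}(\mathbf{B}_\lambda\cap\mathbf{V})}{\mathrm{area}(\mathbf{V})}\le\frac{\mathrm{area}\left(\bigcup_{i=1}^3\mathbf{B}_i'\cap\mathbf{T}_r\right)}{\mathrm{area}(\mathbf{T}_r)}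.$$
   Context: All disks are closed geodesic disks, and distance and area are those of $\mathbb{P}$. A packing is a family of disks with pairwise disjoint interiors. The Voronoi cell of $\mathbf{B}\in\mathcal{F}$ is the set of points of $\mathbb{P}$ that are at least as close to the center of $\mathbf{B}$ as to the center of any other element of $\mathcal{F}$. A regular triangle is one with equal sides and equal angles. *)

(* Defs.v *)
From HB Require Import structures.
From mathcomp Require Import all_boot all_order all_algebra.
From mathcomp Require Import all_classical all_reals all_analysis.

Set Implicit Arguments.
Unset Strict Implicit.
Unset Printing Implicit Defensive.

Import Order.TTheory GRing.Theory Num.Theory.
Import numFieldNormedType.Exports.
Local Open Scope classical_set_scope.
Local Open Scope ring_scope.

Section Functions.
Variable R : realType.

Definition sinh (x : R) : R := (expR x - expR (- x)) / 2.
Definition cosh (x : R) : R := (expR x + expR (- x)) / 2.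
(* the inverse of cosh with values in [0, +oo[ *)
Definition arcosh (x : R) : R := ln (x + Num.sqrt (x ^+ 2 - 1)).

Definition vec2 (x y : R) : 'rV[R]_2 := \row_i [:: x; y]`_i.
Definition vec3 (x y z : R) : 'rV[R]_3 := \row_i [:: x; y; z]`_i.

Definition dot n (u v : 'rV[R]_n) : R := \sum_i u 0 i * v 0 i.

Definition lorentz (u v : 'rV[R]_3) : R :=
  u 0 0 * v 0 0 + u 0 1 * v 0 1 - u 0 ord_max * v 0 ord_max.

Definition form_angle n (form : 'rV[R]_n -> 'rV[R]_n -> R) (u v : 'rV[R]_n) : R :=
  acos (form u v / (Num.sqrt (form u u) * Num.sqrt (form v v))).

End Functions.

(* [angle p x y] is the angle at [p] between the geodesics from [p] to [x] and
   from [p] to [y]. *)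
Record plane (R : realType) := Plane {
  plane_point :> Type;
  dist : plane_point -> plane_point -> R;
  angle : plane_point -> plane_point -> plane_point -> R;
  area : set plane_point -> \bar R }.

Section Models.
Variable R : realType.

Local Notation mu2 := (@lebesgue_measure R \x @lebesgue_measure R)%E.

Definition euclidean_plane : plane R := {|
  plane_point := 'rV[R]_2;
  dist := fun x y => Num.sqrt (dot (x - y) (x - y));
  angle := fun p x y => form_angle (@dot R 2) (x - p) (y - p);
  area := fun A => mu2 [set u | A (vec2 u.1 u.2)] |}.

Definition sphere_point := {x : 'rV[R]_3 | dot x x = 1}.

(* Component of [x] orthogonal to [p]: a tangent vector at [p] pointing along
   the great circle towards [x]. *)
Definition sphere_direction (p x : sphere_point) : 'rV[R]_3 :=
  sval x - dot (sval x) (sval p) *: sval p.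

(* Colatitude [u.1] and longitude [u.2]; the area element is sin(u.1). *)
Definition sphere_chart (u : R * R) : 'rV[R]_3 :=
  vec3 (sin u.1 * cos u.2) (sin u.1 * sin u.2) (cos u.1).

Definition sphere_domain : set (R * R) := `[0, pi] `*` `[0, 2 * pi[.

Definition unit_sphere : plane R := {|
  plane_point := sphere_point;
  dist := fun x y => acos (dot (sval x) (sval y));
  angle := fun p x y =>
    form_angle (@dot R 3) (sphere_direction p x) (sphere_direction p y);
  area := fun A =>
    (\int[mu2]_(u in sphere_domain `&` sphere_chart @^-1` (sval @` A))
        (sin u.1)%:E)%E |}.

(* The hyperboloid model of the plane of constant curvature -1: the upper sheet
   of x^2 + y^2 - z^2 = -1 with the metric induced by the Lorentz form, which
   is positive definite on tangent spaces. *)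
Definition hyperboloid_point :=
  {x : 'rV[R]_3 | lorentz x x = - 1 /\ 0 < x 0 ord_max}.

(* Component of [x] orthogonal to [p] for the Lorentz form; the sign differs
   from the spherical case because <p, p> = -1. *)
Definition hyperboloid_direction (p x : hyperboloid_point) : 'rV[R]_3 :=
  sval x + lorentz (sval x) (sval p) *: sval p.

(* Geodesic polar coordinates around (0, 0, 1); the area element is
   sinh(u.1). *)
Definition hyperboloid_chart (u : R * R) : 'rV[R]_3 :=
  vec3 (sinh u.1 * cos u.2) (sinh u.1 * sin u.2) (cosh u.1).

Definition hyperboloid_domain : set (R * R) := `[0, +oo[ `*` `[0, 2 * pi[.

Definition hyperbolic_plane : plane R := {|
  plane_point := hyperboloid_point;
  dist := fun x y => arcosh (- lorentz (sval x) (sval y));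
  angle := fun p x y =>
    form_angle (@lorentz R)
      (hyperboloid_direction p x) (hyperboloid_direction p y);
  area := fun A =>
    (\int[mu2]_(u in hyperboloid_domain `&` hyperboloid_chart @^-1` (sval @` A))
        (sinh u.1)%:E)%E |}.

End Models.

Inductive geometry := Euclidean | Spherical | Hyperbolic.

Definition plane_of (R : realType) (g : geometry) : plane R :=
  match g with
  | Euclidean => euclidean_plane R
  | Spherical => unit_sphere R
  | Hyperbolic => hyperbolic_plane R
  end.

Section Geometry.
Variables (R : realType) (P : plane R).

Definition metric_interior (A : set P) : set P :=
  [set x | exists2 e : R, 0 < e & forall y, dist x y < e -> A y].

Record disk := Disk { disk_center : P; disk_radius : R }.

Definition body (D : disk) : set P := [set x | dist (disk_center D) x <= disk_radius D].

Definition packing (F : set disk) :=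
  forall D E, F D -> F E -> D <> E ->
    metric_interior (body D) `&` metric_interior (body E) = set0.

Definition voronoi_cell (F : set disk) (B : disk) : set P :=
  [set x | forall D, F D -> dist x (disk_center B) <= dist x (disk_center D)].

(* The points between [x] and [y]; on the sphere this is the shorter great
   circle arc, unless [x] and [y] are antipodal (then it is everything). *)
Definition segment (x y : P) : set P := [set z | dist x z + dist z y = dist x y].

(* A vertex of a convex polygon, as an extreme point: a point of the polygon not
   strictly between two others. *)
Definition vertex (V : set P) (v : P) :=
  V v /\ forall a b, V a -> V b -> segment a b v -> v = a \/ v = b.

Definition triangle (p1 p2 p3 : P) : set P :=
  \bigcup_(y in segment p2 p3) segment p1 y.

Definition regular_triangle (s : R) (p1 p2 p3 : P) :=
  [/\ dist p1 p2 = s, dist p2 p3 = s & dist p3 p1 = s] /\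
  angle p1 p2 p3 = angle p2 p3 p1 /\ angle p2 p3 p1 = angle p3 p1 p2.

End Geometry.

(* Main.v *)
Require Import Defs.
From HB Require Import structures.
From mathcomp Require Import all_boot all_order all_algebra.
From mathcomp Require Import all_classical all_reals all_analysis.
From mathcomp Require Import measurable_realfun ring lra.

Set Implicit Arguments.
Unset Strict Implicit.
Unset Printing Implicit Defensive.

Import Order.TTheory GRing.Theory Num.Theory.
Import numFieldNormedType.Exports.
Local Open Scope classical_set_scope.
Local Open Scope ring_scope.

(* In all three geometries let S and C be the sine and cosine of the model, and
   work in polar coordinates around q. Let Rc be the circumradius of the regular
   triangle of side 2r and theta half of its angle. A centre at distance 2d from
   q with d < Rc cuts from V, inside the disk of radius Rc, an arc of half-angle
   theta_d on each circle; because centres are at distance >= 2r these arcs are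
   pairwise disjoint, and outside them V fills the whole disk of radius Rc. So
   area (V cap B_rho) is the area of full sectors plus the sum over d of twice
   the truncated sectors with half-angles theta_d - phi_d(x) at radius x, while
   the same quantity for the triangle consists of six truncated sectors with
   d = r. Both inequalities therefore reduce to comparing one truncated sector
   with the one for d = r: the first to the monotonicity of phi_d(x) / theta_d,
   the second to that of the ratio of the parts below and above rho, where the
   difference of the two densities, suitably scaled, changes sign only once. *)

(** * Substitution in one variable *)

Section OneDim.
Variable R : realType.
Local Notation mu := (@lebesgue_measure R).

(** Areas are defined through one fixed chart per model, so polar coordinates around [q] presuppose
    that isometries preserve area. For rotations about the pole this is visible in polar
    coordinates. A translation along an axis becomes a mere shift only in other coordinates, and the
    change of variables has a density that blows up at an end of its interval; the substitution
    rules below are made for it. Distances are compared through [gS (dist / 2) ^ 2], a polynomial in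
    ambient coordinates. Unlike [gC dist], it is still informative when the curvature is 0, so one
    computation serves all three geometries. The radius [Rc] is the natural cut-off: the disks of
    radius [Rc] around the vertices cover the triangle, and the arcs cut at radius [Rc] are exactly
    small enough to be disjoint. Replacing [V] by its part inside the disk of radius [Rc], and the
    radius of the concentric disk by its minimum with [Rc], only strengthens what has to be shown. A
    packing may have infinitely many disks and [V] may have infinite area, hence the series over
    neighbours and the extended reals. *)

Lemma mu_shift (t : R) (A : set R) : measurable A ->
  mu [set x | A (x + t)] = mu A.
Proof.
move=> mA; have mf : measurable_fun setT (fun x : R => x + t : R).
  by apply: measurable_funD.
transitivity (pushforward mu (fun x : measurableTypeR R => x + t : measurableTypeR R) A) => //.
apply/esym/lebesgue_measure_unique => //= _ [[a b]] _ <-.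
rewrite /pushforward/=.
have -> : (fun x : measurableTypeR R => (x + t : measurableTypeR R)) @^-1` `]a, b] = `]a - t, b - t]%classic.
  by apply/seteqP; split => x /=; rewrite !in_itv/= ltrBlDr lerBrDr.
rewrite !lebesgue_measure_itv/= !lte_fin ltrD2r.
by case: ifP => // _; rewrite -!EFinD; congr (_%:E); ring.
Qed.
End OneDim.

Section Density.
Variable R : realType.
Local Notation mu := (@lebesgue_measure R).
Variables (h : R -> R) (mh : measurable_fun setT h) (h0 : forall x, 0 <= h x).

(** The proofs of measurability and positivity are arguments, so that the term itself determines the
    measure structure declared below. *)
Definition dens of measurable_fun setT h & (forall x, 0 <= h x) :=
  fun A : set (measurableTypeR R) => (\int[mu]_(x in A) (h x)%:E)%E.

Local Notation den := (dens mh h0).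

Let dens0 : den set0 = 0%E. Proof. exact: integral_set0. Qed.

Let dens_ge0 A : (0 <= den A)%E.
Proof. by apply: integral_ge0 => x _; rewrite lee_fin. Qed.

Let dens_sa : semi_sigma_additive den.
Proof.
move=> /= F mF tF mUF; rewrite /dens; apply: cvg_toP.
  apply: ereal_nondecreasing_is_cvgn => m n mn.
  apply: lee_sum_nneg_natr => // k _ _.
  by apply: integral_ge0 => /= x Fkx; rewrite lee_fin.
rewrite ge0_integral_bigcup//=.
- by apply: measurable_funTS; apply: measurableT_comp.
- by move=> x _; rewrite lee_fin.
Qed.

HB.instance Definition _ := isMeasure.Build _ _ _ den dens0 dens_ge0 dens_sa.

End Density.

Section Subst.
Variable R : realType.
Local Notation mu := (@lebesgue_measure R).

(** Uniqueness of Lebesgue measure: the image under [G] of the measure with density [g] agrees with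
    length inside []G a, G b]], by the fundamental theorem of calculus. Adding Lebesgue measure
    restricted to the complement gives a measure on the whole line, to which uniqueness applies. *)
Lemma mu_subst_oc (G g : R -> R) (a b : R) (A : set R) : a <= b ->
  (forall x, a <= x <= b -> is_derive x 1 G (g x)) ->
  (forall x, a <= x <= b -> {for x, continuous g}) ->
  (forall x, a <= x <= b -> 0 < g x) -> measurable A ->
  mu (A `&` `]G a, G b]) = (\int[mu]_(x in `]a, b] `&` G @^-1` A) (g x)%:E)%E.
Proof.
move=> ab dG cg g0 mA.
have cG : {within `[a, b], continuous G}.
  apply: derivable_within_continuous => x; rewrite in_itv/= => xab.
  by have [] := dG x xab.
have cgw : {within `[a, b], continuous g}.
  by apply: continuous_in_subspaceT => x /[1!inE]/=; rewrite in_itv/= => /cg.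
have incG x y : a <= x -> x < y -> y <= b -> G x < G y.
  apply: gtr0_derive1_incr => // z; rewrite in_itv/= => /andP[/ltW az /ltW zb].
    by have [] := dG z (introT andP (conj az zb)).
  rewrite derive1E; have /@derive_val -> := dG z (introT andP (conj az zb)).
  by apply: g0; rewrite az.
have leG x y : a <= x -> x <= y -> y <= b -> G x <= G y.
  by move=> ax; rewrite le_eqVlt => /predU1P[->//|xy] yb; exact/ltW/incG.
have ltGE x y : a <= x <= b -> a <= y <= b -> (G x < G y) = (x < y).
  move=> /andP[ax xb] /andP[ay yb]; apply/idP/idP => [|xy]; last exact: incG.
  by apply: contraTT; rewrite -!leNgt => yx; exact: leG.
(* Extension by 0 makes both functions measurable on the whole line; the value 0 of [H] outside the
   interval is harmless, since the density [h] vanishes there. *)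
pose h := g \_ `]a, b]; pose H := G \_ `]a, b].
have sub : `]a, b]%classic `<=` `[a, b]%classic by exact: subset_itv_oc_cc.
have mg : measurable_fun `]a, b] g.
  apply: (measurable_funS _ sub); first exact: measurable_itv.
  by apply: subspace_continuous_measurable_fun; first exact: measurable_itv.
have mG : measurable_fun `]a, b] G.
  apply: (measurable_funS _ sub); first exact: measurable_itv.
  by apply: subspace_continuous_measurable_fun; first exact: measurable_itv.
have mh : measurable_fun setT h.
  by apply/(measurable_restrictT _ _).1 => //; exact: measurable_itv.
have mH : measurable_fun setT H.
  by apply/(measurable_restrictT _ _).1 => //; exact: measurable_itv.
have h0 x : 0 <= h x.
  rewrite /h patchE; case: ifPn => // /[1!inE]/=; rewrite in_itv/= => /andP[/ltW ax xb].
  by apply/ltW/g0; rewrite ax.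
have denE B : measurable B -> dens mh h0 (H @^-1` B) =
    (\int[mu]_(x in `]a, b] `&` G @^-1` B) (g x)%:E)%E.
  move=> mB; rewrite /dens integral_mkcond [RHS]integral_mkcond.
  apply: eq_integral => x _; rewrite !patchE /h patchE.
  have [xab|xab] := pselect (`]a, b]%classic x).
    rewrite (mem_set xab).
    have [Bx|Bx] := pselect (B (G x)).
      by rewrite !mem_set//= /H patchE mem_set.
    by rewrite !memNset//= /H ?patchE ?(mem_set xab)// => -[].
  by rewrite (memNset xab) [in RHS]memNset; [case: ifP|case].
have Gab : G a <= G b by exact: leG.
have mI : measurable (`]G a, G b]%classic : set R) by exact: measurable_itv.
pose nu1 : {measure set (measurableTypeR R) -> \bar R} :=
  pushforward (dens mh h0) (H : measurableTypeR R -> measurableTypeR R).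
have mIc : measurable (~` `]G a, G b]%classic : set (measurableTypeR R)) by exact: measurableC.
pose nu2 : {measure set (measurableTypeR R) -> \bar R} := mrestr mu mIc.
have muE B : measurable B -> mu B = (nu1 mH B + nu2 B)%E.
  move=> mB; rewrite -measure_addE; move: mB.
  apply: lebesgue_measure_unique => _ /ocitvP[->|[[u v] uv ->]]; first by rewrite !measure0.
  rewrite {}/fst {}/snd in uv *.
  transitivity (nu1 mH `]u, v]%classic + nu2 `]u, v]%classic)%E; last by rewrite -measure_addE.
  rewrite /nu1/= /pushforward denE; last exact: measurable_itv.
  rewrite /nu2/= /mrestr/=.
  rewrite [LHS](measureDI mu (B := `]G a, G b]%classic))//.
  rewrite setDE [in LHS]addeC; congr (_ + _)%E.
  (* [cl] clamps a point to [[G a, G b]]. Clamped endpoints have preimages [al] and [be] by the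
     intermediate value theorem, which reduces an arbitrary []u, v]] to the image of []al, be]]. *)
  pose cl w := Num.max (G a) (Num.min w (G b)).
  have clP w : exists2 x, a <= x <= b & G x = cl w.
    have [|x] := @IVT R G a b (cl w) ab cG; last by rewrite in_itv/= => ? <-; exists x.
    by rewrite min_l// max_r// /cl le_max lexx/= ge_max Gab ge_min lexx orbT.
  have [al /andP[aal alb] Gal] := clP u; have [be /andP[abe beb] Gbe] := clP v.
  have uvE : `]u, v]%classic `&` `]G a, G b]%classic = `]cl u, cl v]%classic.
    apply/seteqP; split => x /=; rewrite /cl !in_itv/= gt_max gt_min le_max le_min.
      move=> [/andP[-> ->] /andP[-> ->]] /=; by rewrite orbT.
    move=> /andP[/andP[ax /orP[ux|xx]] /orP[xa|/andP[xv xb]]]; rewrite ?ax ?ux ?xv ?xb//=.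
    - by move: (lt_le_trans ax xa); rewrite ltxx.
    - by move: (lt_le_trans ax xa); rewrite ltxx.
    - by move: (lt_le_trans xx xb); rewrite ltxx.
  have cluv : cl u <= cl v.
    by rewrite /cl ge_max !le_max lexx/= le_min !ge_min lexx orbT (ltW uv)/= orbT.
  have albe : al <= be.
    rewrite leNgt -ltGE ?aal ?abe ?alb ?beb// -leNgt Gal Gbe//.
  have -> : `]a, b]%classic `&` G @^-1` `]u, v]%classic = `]al, be]%classic.
    apply/seteqP; split => x /=.
      rewrite !in_itv/= => -[/andP[ax xb] /andP[ux xv]].
      have GaGx : G a < G x by exact: incG.
      have GxGb : G x <= G b by apply: leG => //; exact: ltW.
      apply/andP; split.
        by rewrite -ltGE ?aal ?alb ?(ltW ax)// Gal /cl gt_max gt_min GaGx ux.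
      rewrite leNgt -ltGE ?abe ?beb ?(ltW ax)// Gbe -leNgt.
      by rewrite /cl le_max le_min xv GxGb orbT.
    rewrite !in_itv/= => /andP[alx xbe].
    have ax : a < x by exact: le_lt_trans alx.
    have xb : x <= b by exact: le_trans beb.
    rewrite ax xb; split=> //.
    have : cl u < G x by rewrite -Gal ltGE ?aal ?alb ?(ltW ax).
    have : G x <= cl v by rewrite -Gbe leG// ltW.
    rewrite /cl gt_max gt_min le_max le_min.
    have GaGx : G a < G x by exact: incG.
    have GxGb : G x <= G b by apply: leG => //; exact: ltW.
    rewrite leNgt GaGx GxGb/= andbT => -> /orP[->//|].
    by rewrite ltNge GxGb.
  have muI : mu `]cl u, cl v]%classic = if cl u < cl v then (cl v - cl u)%:E else 0%E.
    by rewrite lebesgue_measure_itv/= lte_fin.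
  rewrite uvE [LHS]muI.
  have [lt|] := ltP al be; last first.
    move=> beal; have -> : al = be by apply/le_anti; rewrite albe beal.
    have -> : cl u = cl v by rewrite -Gal -Gbe; congr G; apply/le_anti; rewrite albe beal.
    by rewrite ltxx set_itvoc0 integral_set0.
  rewrite -Gal -Gbe ltGE ?aal ?alb ?abe ?beb// lt.
  have subab : `[al, be]%classic `<=` `[a, b]%classic.
    by move=> x /=; rewrite !in_itv/= => /andP[alx xbe]; rewrite (le_trans aal)//= (le_trans xbe).
  rewrite integral_itv_obnd_cbnd; last first.
    apply/measurable_EFinP; apply: (measurable_funS _ _ mg); first exact: measurable_itv.
    move=> x /=; rewrite !in_itv/= => /andP[alx xbe].
    by rewrite (le_lt_trans aal)//= (le_trans xbe).
  rewrite (@continuous_FTC2 _ g G)//.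
  - exact: continuous_subspaceW cgw.
  - have dGx x : al <= x <= be -> derivable G x 1.
      move=> /andP[alx xbe].
      by have [] := dG x (introT andP (conj (le_trans aal alx) (le_trans xbe beb))).
    have cGx x : al <= x <= be -> {for x, continuous G}.
      by move=> /dGx dx; apply/differentiable_continuous/derivable1_diffP.
    split.
    + by move=> x; rewrite in_itv/= => /andP[/ltW alx /ltW xbe]; apply: dGx; rewrite alx.
    + by apply: cvg_at_right_filter; apply: cGx; rewrite lexx.
    + by apply: cvg_at_left_filter; apply: cGx; rewrite lexx albe.
  - move=> x; rewrite in_itv/= => /andP[/ltW alx /ltW xbe].
    rewrite derive1E.
    by have /@derive_val -> := dG x (introT andP (conj (le_trans aal alx) (le_trans xbe beb))).
rewrite muE; last exact: measurableI.
rewrite /nu1 /nu2 /= /mrestr /pushforward.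
rewrite -[X in mu X]setIA setICr setI0 measure0 adde0.
rewrite denE; last exact: measurableI.
congr (integral _ _ _); apply/seteqP; split => x /=; rewrite in_itv/=; first by move=> [? []].
move=> [/andP[ax xb] AGx]; split; first by rewrite ax.
by split=> //; rewrite in_itv/= incG//= leG// ltW.
Qed.

End Subst.

Section Subst2.
Variable R : realType.
Local Notation mu := (@lebesgue_measure R).

(** The pieces []u n, v n]] exhaust [I], and both sides pass to the limit along increasing sets. So
    [g] may be unbounded near the ends of [I], as the inverse square roots below are. *)
Lemma mu_subst (G g : R -> R) (I J : set R) (u v : nat -> R) (A : set R) :
  (forall n m, (n <= m)%N -> u m <= u n) ->
  (forall n m, (n <= m)%N -> v n <= v m) ->
  (forall n, u n <= v n) ->
  (forall n x, u n <= x <= v n -> I x) ->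
  (forall x, I x -> exists n, u n < x <= v n) ->
  (forall x, I x -> is_derive x 1 G (g x)) ->
  (forall x, I x -> {for x, continuous g}) ->
  (forall x, I x -> 0 < g x) ->
  (forall x, I x -> J (G x)) ->
  (forall y, J y -> exists2 x, I x & G x = y) -> measurable A ->
  mu (A `&` J) = (\int[mu]_(x in I `&` G @^-1` A) (g x)%:E)%E.
Proof.
move=> du iv uv sI Iuv dG cg g0 IJ JI mA.
have ltG n x y : u n <= x -> x < y -> y <= v n -> G x < G y.
  move=> ux xy yv.
  apply: (@gtr0_derive1_incr _ G (u n) (v n)) xy yv => //.
  - move=> z; rewrite in_itv/= => /andP[/ltW uz /ltW zv].
    by have [] := dG z (sI n z (introT andP (conj uz zv))).
  - move=> z; rewrite in_itv/= => /andP[/ltW uz /ltW zv].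
    have Iz := sI n z (introT andP (conj uz zv)).
    by rewrite derive1E; have /@derive_val -> := dG z Iz; exact: g0.
  - apply: derivable_within_continuous => z; rewrite in_itv/= => /sI Iz.
    by have [] := dG z Iz.
have leG n x y : u n <= x -> x <= y -> y <= v n -> G x <= G y.
  by move=> ux; rewrite le_eqVlt => /predU1P[->//|xy] yv; exact/ltW/(ltG n).
pose E n := `]u n, v n]%classic `&` G @^-1` A.
pose D n := A `&` `]G (u n), G (v n)]%classic.
have mGn n : measurable_fun `]u n, v n] G.
  have sub : `]u n, v n]%classic `<=` `[u n, v n]%classic by exact: subset_itv_oc_cc.
  apply: (measurable_funS _ sub); first exact: measurable_itv.
  apply: subspace_continuous_measurable_fun; first exact: measurable_itv.
  apply: derivable_within_continuous => z; rewrite in_itv/= => /sI Iz.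
  by have [] := dG z Iz.
have mgn n : measurable_fun `]u n, v n] g.
  have sub : `]u n, v n]%classic `<=` `[u n, v n]%classic by exact: subset_itv_oc_cc.
  apply: (measurable_funS _ sub); first exact: measurable_itv.
  apply: subspace_continuous_measurable_fun; first exact: measurable_itv.
  by apply: continuous_in_subspaceT => x /[1!inE]/=; rewrite in_itv/= => /sI /cg.
have mE n : measurable (E n) by apply: mGn => //; exact: measurable_itv.
have mD n : measurable (D n) by apply: measurableI => //; exact: measurable_itv.
have ndE : nondecreasing_seq E.
  move=> n m nm; apply/subsetPset => x [/=]; rewrite in_itv/= => /andP[ux xv] Ax.
  by split=> //=; rewrite in_itv/= (le_lt_trans (du _ _ nm))//= (le_trans xv)// iv.
have ndD : nondecreasing_seq D.
  move=> n m nm; apply/subsetPset => x [Ax /=]; rewrite in_itv/= => /andP[ux xv].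
  have [uu vv] := (du _ _ nm, iv _ _ nm).
  split=> //=; rewrite in_itv/= (le_lt_trans _ ux)/=; last first.
    by apply: (leG m) => //; apply: le_trans vv; exact: uv.
  by rewrite (le_trans xv)//; apply: (leG m) => //; apply: le_trans uu _; exact: uv.
have -> : A `&` J = \bigcup_n D n.
  apply/seteqP; split=> [y [Ay /JI[x Ix yE]]|y [n _ [Ay]]].
    subst y.
    have [n /andP[ux xv]] := Iuv _ Ix; exists n => //; split=> //=.
    by rewrite in_itv/= (ltG n)//= (leG n)// ltW.
  rewrite /= in_itv/= => /andP[ux xv]; split=> //.
  have [||x] := @IVT R G (u n) (v n) y (uv n).
      apply: derivable_within_continuous => z; rewrite in_itv/= => /sI Iz.
      by have [] := dG z Iz.
    have Guv : G (u n) <= G (v n) by apply: (leG n).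
    by rewrite min_l// max_r// xv andbT ltW.
  by rewrite in_itv/= => /sI Ix <-; exact: IJ.
have -> : I `&` G @^-1` A = \bigcup_n E n.
  apply/seteqP; split=> [x [Ix Ax]|x [n _ [/=]]].
    by have [n uxv] := Iuv _ Ix; exists n => //; split=> //=; rewrite in_itv.
  by rewrite in_itv/= => /andP[/ltW ux xv] Ax; split=> //; apply: (sI n); rewrite ux.
have h1 : mu (D n) @[n --> \oo] --> mu (\bigcup_n D n).
  have := @nondecreasing_cvg_mu _ (measurableTypeR R) R mu D mD _ ndD.
  by apply; apply: (@bigcup_measurable _ (measurableTypeR R)) => n _; exact: mD.
have h2 : (\int[mu]_(x in E n) (g x)%:E)%E @[n --> \oo] -->
    (\int[mu]_(x in \bigcup_n E n) (g x)%:E)%E.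
  apply: ge0_nondecreasing_set_cvg_integral => //.
    move=> n; apply/measurable_EFinP; apply: (measurable_funS _ _ (mgn n)) => //.
    exact: subIsetl.
  move=> n x [/=]; rewrite in_itv/= => /andP[/ltW ux xv] _.
  by rewrite lee_fin; apply/ltW/g0/(sI n); rewrite ux.
have h n : mu (D n) = (\int[mu]_(x in E n) (g x)%:E)%E.
  apply: mu_subst_oc => //.
  - by move=> x /sI; exact: dG.
  - by move=> x /sI; exact: cg.
  - by move=> x /sI; exact: g0.
have h3 : (fun n => mu (D n)) = (fun n => \int[mu]_(x in E n) (g x)%:E)%E by apply/funext.
by rewrite h3 in h1; apply: (cvg_unique _ h1 h2).
Qed.

Lemma mu_subst_oo (G g : R -> R) (a b : R) (J A : set R) :
  (forall x, a < x < b -> is_derive x 1 G (g x)) ->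
  (forall x, a < x < b -> {for x, continuous g}) ->
  (forall x, a < x < b -> 0 < g x) ->
  (forall x, a < x < b -> J (G x)) ->
  (forall y, J y -> exists2 x, a < x < b & G x = y) -> measurable A ->
  mu (A `&` J) = (\int[mu]_(x in `]a, b[%classic `&` G @^-1` A) (g x)%:E)%E.
Proof.
move=> dG cg g0 IJ JI mA.
have [ab|ba] := ltP a b; last first.
  have -> : J = set0.
    by rewrite -subset0 => y /JI[x /andP[ax /(lt_trans ax)]]; rewrite ltNge ba.
  rewrite setI0 measure0 (_ : `]a, b[%classic = set0) ?set0I ?integral_set0//.
  by rewrite -subset0 => y /=; rewrite in_itv/= => /andP[ax /(lt_trans ax)]; rewrite ltNge ba.
(* Starting the denominators at 2 gives [a + w n <= b - w n] already for [n = 0]. *)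
pose w n := (b - a) / n.+2%:R.
have w0 n : 0 < w n by rewrite divr_gt0 ?subr_gt0.
have w2 n : w n <= (b - a) / 2.
  by rewrite ler_pM2l ?subr_gt0// lef_pV2 ?posrE// ler_nat.
have wd n m : (n <= m)%N -> w m <= w n.
  by move=> nm; rewrite ler_pM2l ?subr_gt0// lef_pV2 ?posrE// ler_nat !ltnS.
apply: (@mu_subst G g _ J (fun n => a + w n) (fun n => b - w n)) => //.
- by move=> n m nm; rewrite lerD2l wd.
- by move=> n m nm; rewrite lerB// wd.
- by move=> n; have := w2 n; lra.
- by move=> n x; rewrite /= in_itv/=; have := w0 n; lra.
- move=> x; rewrite /= in_itv/= => /andP[ax xb].
  pose e := Num.min (x - a) (b - x).
  have e0 : 0 < e by rewrite lt_min !subr_gt0 ax.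
  pose n := Num.Def.truncn ((b - a) / e).
  have h : (b - a) / e < n.+1%:R by exact: truncnS_gt.
  exists n.+1; have wne : w n.+1 < e.
    rewrite /w ltr_pdivrMr// mulrC -ltr_pdivrMr//.
    by apply: (lt_trans h); rewrite ltr_nat ltnS ltnW.
  have : w n.+1 < x - a by apply: (lt_le_trans wne); rewrite ge_min lexx.
  have : w n.+1 < b - x by apply: (lt_le_trans wne); rewrite ge_min lexx orbT.
  lra.
Qed.

Lemma mu_subst_oy (G g : R -> R) (a : R) (J A : set R) :
  (forall x, a < x -> is_derive x 1 G (g x)) ->
  (forall x, a < x -> {for x, continuous g}) ->
  (forall x, a < x -> 0 < g x) ->
  (forall x, a < x -> J (G x)) ->
  (forall y, J y -> exists2 x, a < x & G x = y) -> measurable A ->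
  mu (A `&` J) = (\int[mu]_(x in `]a, +oo[%classic `&` G @^-1` A) (g x)%:E)%E.
Proof.
move=> dG cg g0 IJ JI mA.
pose w n : R := n.+1%:R^-1.
have w0 n : 0 < w n by rewrite invr_gt0.
have w1 n : w n <= 1 by rewrite invf_le1// ler1n.
have wd n m : (n <= m)%N -> w m <= w n.
  by move=> nm; rewrite lef_pV2 ?posrE// ler_nat !ltnS.
apply: (@mu_subst G g _ J (fun n => a + w n) (fun n => a + 1 + n%:R)) => //.
- by move=> n m nm; rewrite lerD2l wd.
- by move=> n m nm; rewrite lerD2l ler_nat.
- by move=> n; have := w1 n; have := ler0n R n; lra.
- by move=> n x; rewrite /= in_itv/=; have := w0 n; lra.
- move=> x; rewrite /= in_itv/= andbT => ax.
  have h1 := truncnS_gt (x - a); have h2 := truncnS_gt (x - a)^-1.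
  set n1 := Num.Def.truncn _ in h1; set n2 := Num.Def.truncn _ in h2.
  exists (n1.+1 + n2)%N; apply/andP; split; last first.
    have : (n1.+1)%:R <= (n1.+1 + n2)%:R :> R by rewrite ler_nat leq_addr.
    lra.
  have : w (n1.+1 + n2)%N < x - a; last by lra.
  rewrite /w invf_plt ?posrE ?subr_gt0// (lt_le_trans h2)// ler_nat ltnS.
  by rewrite addSn ltnW// ltnS leq_addl.
- by move=> x; rewrite /= in_itv/= andbT => ax; apply: dG.
- by move=> x; rewrite /= in_itv/= andbT => ax; apply: cg.
- by move=> x; rewrite /= in_itv/= andbT => ax; apply: g0.
- by move=> x; rewrite /= in_itv/= andbT => ax; apply: IJ.
- by move=> y /JI[x ax <-]; exists x => //=; rewrite in_itv/= ax.
Qed.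

Lemma mu_period (p a b : R) (P : set R) : a <= b <= a + p ->
  (forall x, P (x + p) <-> P x) -> measurable P ->
  mu (`[a, a + p[ `&` P) = mu (`[b, b + p[ `&` P).
Proof.
move=> /andP[ab bap] Pp mP.
have mI (c d : R) : measurable (`[c, d[%classic : set R) by exact: measurable_itv.
have h : mu (`[a + p, b + p[ `&` P) = mu (`[a, b[ `&` P).
  rewrite -(mu_shift p); last exact: measurableI.
  congr (mu _); apply/seteqP; split => x /=; rewrite !in_itv/= lerD2r ltrD2r.
    by move=> [? /Pp].
  by move=> [? /Pp].
have split3 (c d e : R) : c <= d -> d <= e ->
    mu (`[c, e[ `&` P) = (mu (`[c, d[ `&` P) + mu (`[d, e[ `&` P))%E.
  move=> cd de; rewrite -measureU; try exact: measurableI.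
    rewrite -setIUl; congr (mu (_ `&` _)).
    by apply/seteqP; split => x /=; rewrite !in_itv/=; have [xd|xd] := ltP x d; lra.
  rewrite -subset0 => x /= [[+ _] [+ _]]; rewrite !in_itv/= => /andP[_ xd] /andP[dx _].
  by move: (lt_le_trans xd dx); rewrite ltxx.
rewrite (split3 a b (a + p))// (split3 b (a + p) (b + p)) ?lerD2r//.
by rewrite h addeC.
Qed.
End Subst2.

(** * The three models *)

Section Model.
Variable R : realType.
Implicit Types (g : geometry) (x y : R).

(* The model of constant curvature [gk] has sine [gS] and cosine [gC], so that
   [gC x ^+ 2 + gk * gS x ^+ 2 = 1]. *)
Definition gk g : R := match g with Euclidean => 0 | Spherical => 1 | Hyperbolic => -1 end.
Definition gS g x : R := match g with Euclidean => x | Spherical => sin x | Hyperbolic => sinh x end.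
Definition gC g x : R := match g with Euclidean => 1 | Spherical => cos x | Hyperbolic => cosh x end.

Lemma cosh2B x : cosh x ^+ 2 - sinh x ^+ 2 = 1.
Proof. by rewrite /cosh /sinh expRN; field; rewrite expR_eq0. Qed.

Lemma gC2S2 g x : gC g x ^+ 2 + gk g * gS g x ^+ 2 = 1.
Proof.
case: g => /=; first by ring.
  by rewrite mul1r cos2Dsin2.
by rewrite mulN1r cosh2B.
Qed.

Lemma gS0 g : gS g 0 = 0.
Proof. by case: g => //=; rewrite ?sin0// /sinh oppr0 subrr mul0r. Qed.

Lemma gC0 g : gC g 0 = 1.
Proof. by case: g => //=; rewrite ?cos0// /cosh oppr0 expR0; field. Qed.

Lemma gSN g x : gS g (- x) = - gS g x.
Proof. by case: g => //=; rewrite ?sinN// /sinh opprK; field. Qed.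

Lemma gCN g x : gC g (- x) = gC g x.
Proof. by case: g => //=; rewrite ?cosN// /cosh opprK addrC. Qed.

Lemma gSD g x y : gS g (x + y) = gS g x * gC g y + gC g x * gS g y.
Proof.
case: g => /=; first by ring.
  by rewrite sinD.
rewrite /sinh /cosh opprD !expRD !expRN.
by field; rewrite !expR_eq0.
Qed.

Lemma gCD g x y : gC g (x + y) = gC g x * gC g y - gk g * gS g x * gS g y.
Proof.
case: g => /=; first by ring.
  by rewrite cosD mul1r.
rewrite /sinh /cosh opprD !expRD !expRN.
by field; rewrite !expR_eq0.
Qed.

Lemma gSB g x y : gS g (x - y) = gS g x * gC g y - gC g x * gS g y.
Proof. by rewrite gSD gSN gCN mulrN. Qed.

Lemma gCB g x y : gC g (x - y) = gC g x * gC g y + gk g * gS g x * gS g y.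
Proof. by rewrite gCD gSN gCN mulrN opprK. Qed.

Lemma is_derive_sinh x : is_derive x 1 (@sinh R) (cosh x).
Proof.
rewrite /sinh; apply: is_derive_eq.
by rewrite /cosh /GRing.scale/=; ring.
Qed.

Lemma is_derive_cosh x : is_derive x 1 (@cosh R) (sinh x).
Proof.
rewrite /cosh; apply: is_derive_eq.
by rewrite /sinh /GRing.scale/=; ring.
Qed.

Lemma is_derive_gS g x : is_derive x 1 (gS g) (gC g x).
Proof. case: g; [exact: is_derive_id|exact: is_derive_sin|exact: is_derive_sinh]. Qed.

Lemma is_derive_gC g x : is_derive x 1 (gC g) (- gk g * gS g x).
Proof.
case: g => /=.
- by rewrite oppr0 mul0r; exact: is_derive_cst.
- by rewrite mulN1r; exact: is_derive_cos.
- by rewrite opprK mul1r; exact: is_derive_cosh.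
Qed.

Lemma is_derive_continuous (f : R -> R) x d : is_derive x 1 f d -> {for x, continuous f}.
Proof. by move=> [df _]; exact/differentiable_continuous/derivable1_diffP. Qed.

Lemma continuous_gS g : continuous (gS g).
Proof. by move=> x; apply: is_derive_continuous (is_derive_gS g x). Qed.

Lemma continuous_gC g : continuous (gC g).
Proof. by move=> x; apply: is_derive_continuous (is_derive_gC g x). Qed.

Lemma measurable_gS g : measurable_fun setT (gS g).
Proof. by apply: continuous_measurable_fun; exact: continuous_gS. Qed.

Lemma measurable_gC g : measurable_fun setT (gC g).
Proof. by apply: continuous_measurable_fun; exact: continuous_gC. Qed.

(* [idom g] is the range of distances: [0, +oo[, or [0, pi] on the sphere. *)
Definition idom g : set R :=
  match g with Spherical => `[0, pi] | _ => `[0, +oo[ end.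

Lemma idomP g x : idom g x <-> 0 <= x /\ (g = Spherical -> x <= pi).
Proof.
case: g => /=; rewrite in_itv/= ?andbT; split=> [x0|[x0 h]] //.
  by case/andP: x0 => -> ->.
by rewrite x0 h.
Qed.

Lemma measurable_idom g : measurable (idom g).
Proof. by case: g; exact: measurable_itv. Qed.

Lemma expR_ltN x : 0 < x -> expR (- x) < expR x.
Proof. by move=> x0; rewrite ltr_expR; lra. Qed.

Lemma gS_gt0 g x : 0 < x -> (g = Spherical -> x < pi) -> 0 < gS g x.
Proof.
case: g => //= x0 h; first by rewrite sin_gt0_pi ?x0 ?h.
by rewrite divr_gt0// subr_gt0 expR_ltN.
Qed.

Lemma gS_ge0 g x : idom g x -> 0 <= gS g x.
Proof.
move=> /idomP[]; rewrite le_eqVlt => /predU1P[<- _|x0 h]; first by rewrite gS0.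
case: g h => [_|/(_ erefl) xpi|_]; try exact/ltW/gS_gt0.
by rewrite /= sin_ge0_pi// (ltW x0).
Qed.

Lemma gC_gt0 g x : 0 <= x -> (g = Spherical -> x < pi / 2) -> 0 < gC g x.
Proof.
case: g => //= x0 h; last by rewrite divr_gt0// addr_gt0 ?expR_gt0.
by rewrite cos_gt0_pihalf// h// andbT (lt_le_trans _ x0)// oppr_lt0 divr_gt0// pi_gt0.
Qed.

End Model.

Section DeriveComp.
Variable R : realType.
Lemma is_derive_comp (f h : R -> R) (x a b : R) :
  is_derive (h x) 1 f a -> is_derive x 1 h b -> is_derive x 1 (fun y => f (h y)) (a * b).
Proof.
move=> fa hb.
have df : derivable f (h x) 1 by case: fa.
have dh : derivable h x 1 by case: hb.
apply: DeriveDef.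
  apply/derivable1_diffP; apply: (@differentiable_comp _ _ _ _ h f); exact/derivable1_diffP.
rewrite -derive1E (derive1_comp dh df) !derive1E.
by rewrite (@derive_val _ _ _ _ _ _ _ fa) (@derive_val _ _ _ _ _ _ _ hb).
Qed.

Lemma is_derive_div (f h : R -> R) (x a b : R) : h x != 0 ->
  is_derive x 1 f a -> is_derive x 1 h b ->
  is_derive x 1 (fun y => f y / h y) ((a * h x - f x * b) / h x ^+ 2).
Proof.
move=> h0 fa hb.
have iv : is_derive x 1 (fun y => (h y)^-1) (- (h x) ^- 2 * b).
  apply: is_deriveV => //.
apply: (@is_derive_eq _ _ _ _ _ _ _ _ (is_deriveM fa iv)).
by rewrite /GRing.scale /=; field.
Qed.
End DeriveComp.

Section Core.
Variable R : realType.
Implicit Types (g : geometry) (x y Y : R).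
Local Notation mu := (@lebesgue_measure R).

Lemma sqrtD1_gt0 x : 1 <= x -> 0 < x + Num.sqrt (x ^+ 2 - 1).
Proof. by move=> x1; rewrite ltr_wpDr ?sqrtr_ge0//; lra. Qed.

Lemma arcosh_exp x : 1 <= x ->
  expR (arcosh x) = x + Num.sqrt (x ^+ 2 - 1) /\
  expR (- arcosh x) = x - Num.sqrt (x ^+ 2 - 1).
Proof.
move=> x1; have p := sqrtD1_gt0 x1.
have e : expR (arcosh x) = x + Num.sqrt (x ^+ 2 - 1) by rewrite /arcosh lnK.
split=> //; rewrite expRN e; apply: (mulIf (lt0r_neq0 p)).
rewrite mulVf ?gt_eqF// -subr_sqr sqr_sqrtr; first by ring.
by nra.
Qed.

Lemma arcoshK x : 1 <= x -> cosh (arcosh x) = x.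
Proof. by move=> /arcosh_exp[e1 e2]; rewrite /cosh e1 e2; field. Qed.

Lemma sinh_arcosh x : 1 <= x -> sinh (arcosh x) = Num.sqrt (x ^+ 2 - 1).
Proof. by move=> /arcosh_exp[e1 e2]; rewrite /sinh e1 e2; field. Qed.

Lemma arcosh_ge0 x : 1 <= x -> 0 <= arcosh x.
Proof. by move=> x1; rewrite ln_ge0// -[1]addr0 lerD ?sqrtr_ge0. Qed.

Lemma cosh_ge1 x : 1 <= cosh x.
Proof.
rewrite /cosh expRN; have p := expR_gt0 x; rewrite ler_pdivlMr//.
have -> : expR x + (expR x)^-1 = 2 + (expR x - 1) ^+ 2 / expR x by field; rewrite gt_eqF.
by rewrite mul1r lerDl divr_ge0 ?sqr_ge0 ?ltW.
Qed.

Lemma sinh_ge0 x : 0 <= x -> 0 <= sinh x.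
Proof. by move=> x0; rewrite divr_ge0// subr_ge0 ler_expR; lra. Qed.

Lemma sinh_sqrt x : 0 <= x -> sinh x = Num.sqrt (cosh x ^+ 2 - 1).
Proof.
move=> x0; have -> : cosh x ^+ 2 - 1 = sinh x ^+ 2 by have := cosh2B x; lra.
by rewrite sqrtr_sqr ger0_norm// sinh_ge0.
Qed.

Lemma coshK x : 0 <= x -> arcosh (cosh x) = x.
Proof.
move=> x0; rewrite /arcosh -sinh_sqrt// /cosh /sinh.
by rewrite (_ : _ + _ = expR x) ?expRK//; field.
Qed.

Lemma sinh_lt x y : x < y -> sinh x < sinh y.
Proof.
move=> xy; rewrite ltr_pM2r// ltrD ?ltrN2 ?ltr_expR//; lra.
Qed.

Lemma sinh_ltE x y : (sinh x < sinh y) = (x < y).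
Proof.
apply/idP/idP; last exact: sinh_lt.
apply: contraTT; rewrite -!leNgt le_eqVlt => /predU1P[->//|/sinh_lt/ltW//].
Qed.

Lemma sinh_surj Y : 0 <= Y -> exists2 a, 0 <= a & sinh a = Y.
Proof.
move=> Y0; pose c := Num.sqrt (1 + Y ^+ 2).
have c2 : c ^+ 2 = 1 + Y ^+ 2 by rewrite sqr_sqrtr//; nra.
have c1 : 1 <= c by rewrite -[1]sqrtr1 ler_wsqrtr// lerDl sqr_ge0.
exists (arcosh c); first exact: arcosh_ge0.
by rewrite sinh_arcosh// c2 addrAC subrr add0r sqrtr_sqr ger0_norm.
Qed.

Lemma is_derive_arcosh x : 1 < x -> is_derive x 1 (@arcosh R) (Num.sqrt (x ^+ 2 - 1))^-1.
Proof.
move=> x1.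
have p : 0 < x ^+ 2 - 1 by nra.
have sp : 0 < Num.sqrt (x ^+ 2 - 1) by rewrite sqrtr_gt0.
have d1 : is_derive x 1 (fun y : R => y ^+ 2 - 1) (2 * x).
  by apply: is_derive_eq; rewrite /GRing.scale/=; ring.
have d2 : is_derive x 1 (fun y => Num.sqrt (y ^+ 2 - 1)) (x / Num.sqrt (x ^+ 2 - 1)).
  have := @is_derive_comp _ (@Num.sqrt R) _ x _ _ (is_derive1_sqrt p) d1.
  by move/is_derive_eq; apply; field; rewrite gt_eqF.
have p2 : 0 < x + Num.sqrt (x ^+ 2 - 1) by apply: sqrtD1_gt0; lra.
have d3 : is_derive x 1 (fun y => y + Num.sqrt (y ^+ 2 - 1))
    (1 + x / Num.sqrt (x ^+ 2 - 1)).
  by apply: is_derive_eq.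
have := @is_derive_comp _ (@ln R) _ x _ _ (is_derive1_ln p2) d3.
by move/is_derive_eq; apply; field; rewrite !gt_eqF.
Qed.

End Core.

(** * Invariance of area *)

Section Halfline.
Variable R : realType.
Implicit Types (g : geometry) (x y Y : R).
Local Notation mu := (@lebesgue_measure R).

Definition halfline g : set R :=
  match g with Spherical => `]0, pi[%classic | _ => `]0, +oo[%classic end.

(* [(gS psi * gc Y, Y, gC psi * gc Y)] parametrizes the slice at height [Y] of
   the surface [gk * (X ^+ 2 + Y ^+ 2) + Z ^+ 2 = 1]. *)
Definition gc g Y : R := Num.sqrt (1 - gk R g * Y ^+ 2).

(** On the slice at height [Y], a point with positive first coordinate is located either by its
    distance [x] from the pole or by [psi = G x]; the density is the derivative of [G]. The map [G]
    is left existential because it is built from [sqrt], [acos] or [arcosh] according to the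
    geometry. *)
Definition halfline_subst_prop g Y := exists G : R -> R,
  (forall x, idom g x -> `|Y| < gS g x ->
     gS g (G x) * gc g Y = Num.sqrt (gS g x ^+ 2 - Y ^+ 2) /\
     gC g (G x) * gc g Y = gC g x) /\
  forall A : set R, measurable A ->
    mu (A `&` halfline g) =
    (\int[mu]_(x in (idom g `&` [set x : R | (`|Y| < gS g x)%R]) `&` G @^-1` A)
       (gS g x / Num.sqrt (gS g x ^+ 2 - Y ^+ 2))%:E)%E.

Lemma abs_lt_sqr x Y : 0 <= x -> (`|Y| < x) = (Y ^+ 2 < x ^+ 2).
Proof. by move=> x0; rewrite -(real_normK (num_real Y)) ltr_pXn2r ?nnegrE. Qed.

Lemma continuous_ratio (f : R -> R) x d Y : is_derive x 1 f d ->
  0 < f x ^+ 2 - Y ^+ 2 ->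
  {for x, continuous (fun x => f x / Num.sqrt (f x ^+ 2 - Y ^+ 2))}.
Proof.
move=> df p.
have d1 : is_derive x 1 (fun y : R => f y ^+ 2 - Y ^+ 2) (2 * f x * d).
  by apply: is_derive_eq; rewrite /GRing.scale/=; ring.
have d2 := @is_derive_comp _ (@Num.sqrt R) _ x _ _ (is_derive1_sqrt p) d1.
apply: is_derive_continuous (is_derive_div _ df d2).
by rewrite gt_eqF// sqrtr_gt0.
Qed.

Lemma euclid_halfline Y : halfline_subst_prop Euclidean Y.
Proof.
have c1 : gc Euclidean Y = 1 by rewrite /gc /= mul0r subr0 sqrtr1.
have pos x : `|Y| < x -> 0 < x ^+ 2 - Y ^+ 2.
  move=> Yx; rewrite subr_gt0 -abs_lt_sqr// ltW//.
  exact: le_lt_trans Yx.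
have dsq x : `|Y| < x -> is_derive x 1 (fun x : R => Num.sqrt (x ^+ 2 - Y ^+ 2))
    (x / Num.sqrt (x ^+ 2 - Y ^+ 2)).
  move=> /pos p; have sp : 0 < Num.sqrt (x ^+ 2 - Y ^+ 2) by rewrite sqrtr_gt0.
  have d1 : is_derive x 1 (fun y : R => y ^+ 2 - Y ^+ 2) (2 * x).
    by apply: is_derive_eq; rewrite /GRing.scale/=; ring.
  have := @is_derive_comp _ (@Num.sqrt R) _ x _ _ (is_derive1_sqrt p) d1.
  by move/is_derive_eq; apply; field; rewrite gt_eqF.
exists (fun x => Num.sqrt (x ^+ 2 - Y ^+ 2)); split=> [x _ _ /=|A mA].
  by rewrite c1 !mulr1.
rewrite (_ : idom Euclidean `&` _ = `]`|Y|, +oo[%classic); last first.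
  apply/seteqP; split => x /=; rewrite !in_itv/= ?andbT; first by case.
  by move=> Yx; split=> //; rewrite ltW// (le_lt_trans _ Yx).
apply: mu_subst_oy => //.
- by move=> x Yx; apply: (continuous_ratio (is_derive_id x 1)); exact: pos.
- move=> x Yx; rewrite divr_gt0 ?sqrtr_gt0 ?pos//; exact: le_lt_trans Yx.
- by move=> x Yx; rewrite /= in_itv/= andbT sqrtr_gt0 pos.
- move=> y /=; rewrite in_itv/= andbT => y0.
  exists (Num.sqrt (y ^+ 2 + Y ^+ 2)).
    by rewrite abs_lt_sqr ?sqrtr_ge0// sqr_sqrtr; nra.
  by rewrite sqr_sqrtr ?addrK ?sqrtr_sqr ?gtr0_norm//; nra.
Qed.

Lemma sphere_halfline Y : Y ^+ 2 < 1 -> halfline_subst_prop Spherical Y.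
Proof.
move=> Y1; have c2 : gc Spherical Y ^+ 2 = 1 - Y ^+ 2.
  by rewrite sqr_sqrtr /= ?mul1r//; lra.
have c0 : 0 < gc Spherical Y by rewrite sqrtr_gt0 /= mul1r; lra.
set c := gc Spherical Y in c0 c2.
have aY1 : `|Y| < 1 by rewrite abs_lt_sqr// expr1n.
have aYm1 : -1 <= `|Y| by have := normr_ge0 Y; lra.
(* On the sphere the condition [|Y| < sin x] cuts out []a, pi - a[]; its second half is reflected
   onto the first. *)
pose a := asin `|Y|.
have a1 : a < pi / 2 by rewrite asin_ltpi2// aYm1.
have sa : sin a = `|Y| by rewrite asinK// in_itv/= aYm1 ltW.
have pi0 := pi_gt0 R.
have a0 : 0 <= a.
  rewrite leNgt; apply/negP => an; have := asin_geNpi2 (introT andP (conj aYm1 (ltW aY1))).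
  rewrite -/a => ag; have : 0 <= sin a by rewrite sa.
  have : 0 < sin (- a) by rewrite sin_gt0_pi//; apply/andP; split; lra.
  by rewrite sinN; lra.
have incr (u v : R) : 0 <= u <= pi / 2 -> 0 <= v <= pi / 2 -> (sin u < sin v) = (u < v).
  move=> /andP[u0 u1] /andP[v0 v1]; rewrite ltr_sin// in_itv/=; apply/andP; split; lra.
have dom x : (0 <= x <= pi) && (`|Y| < sin x) = (a < x < pi - a).
  have [x2|x2] := leP x (pi / 2).
    have [x0|x0] := leP 0 x; last first.
      by rewrite /= (@ltNge _ _ a) (le_trans (ltW x0) a0).
    rewrite -sa incr ?a0 ?x0 ?(ltW a1)//.
    have -> : x <= pi by lra.
    have -> : x < pi - a by lra.
    by rewrite /= andbT.
  have -> : 0 <= x by lra.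
  have -> : a < x by lra.
  rewrite /=; have [xpi|xpi] := leP x pi; last first.
    by rewrite /=; apply/esym/negbTE; rewrite -leNgt; lra.
  have -> : sin x = sin (pi - x) by rewrite sinB sinpi cospi; ring.
  rewrite -sa incr ?a0 ?(ltW a1)//; first by apply/idP/idP; lra.
  by apply/andP; split; lra.
have pos x : 0 <= x <= pi -> `|Y| < sin x -> 0 < sin x ^+ 2 - Y ^+ 2.
  by move=> xpi h; rewrite subr_gt0 -abs_lt_sqr// sin_ge0_pi.
have u1 x : 0 <= x <= pi -> `|Y| < sin x -> -1 < cos x / c < 1.
  move=> xpi h; have := pos x xpi h; have := cos2Dsin2 x => e p.
  rewrite -ltr_norml normrM (gtr0_norm (x := c^-1)) ?invr_gt0//.
  by rewrite ltr_pdivrMr// mul1r abs_lt_sqr ?(ltW c0)// c2; lra.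
have su x : 0 <= x <= pi -> `|Y| < sin x ->
    Num.sqrt (1 - (cos x / c) ^+ 2) * c = Num.sqrt (sin x ^+ 2 - Y ^+ 2).
  move=> xpi h; rewrite -{2}[c]gtr0_norm// -sqrtr_sqr -sqrtrM; last first.
    have := u1 x xpi h; set u := _ / _ => /andP[? ?]; nra.
  congr Num.sqrt; rewrite mulrBl mul1r expr_div_n divfK ?expf_neq0 ?gt_eqF//.
  by rewrite c2; have := cos2Dsin2 x; lra.
exists (fun x => acos (cos x / c)); split=> [x /idomP[x0 /(_ erefl) xpi] h /=|A mA].
  have xx : 0 <= x <= pi by rewrite x0.
  have /andP[ul ur] := u1 x xx h.
  by rewrite sin_acos ?acosK ?in_itv/= ?ltW// su// divfK// gt_eqF.
rewrite (_ : idom Spherical `&` _ = `]a, pi - a[%classic); last first.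
  apply/seteqP; split => x /=; rewrite !in_itv/=; last by rewrite -dom => /andP[].
  by move=> [? ?]; rewrite -dom; apply/andP.
apply: mu_subst_oo => //.
- move=> x; rewrite -dom => /andP[xpi h].
  have uu := u1 x xpi h; have sp := pos x xpi h.
  have d1 : is_derive x 1 (fun y : R => cos y / c) (- sin x / c).
    by apply: is_derive_eq; rewrite /GRing.scale/= ?mulr0 ?add0r mulrC.
  have := @is_derive_comp _ (@acos R) _ x _ _ (is_derive1_acos uu) d1.
  move/is_derive_eq; apply; rewrite /= -su//.
  have w0 : Num.sqrt (1 - (cos x / c) ^+ 2) != 0.
    by rewrite gt_eqF// sqrtr_gt0; move: uu; set u := _ / _ => /andP[? ?]; nra.
  by move: w0; set w := Num.sqrt _ => w0; field; rewrite w0 gt_eqF.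
- move=> x; rewrite -dom => /andP[xpi h].
  by apply: (continuous_ratio (is_derive_sin x)); exact: pos.
- move=> x; rewrite -dom => /andP[xpi h]; have sp := pos x xpi h.
  rewrite divr_gt0 ?sqrtr_gt0//; exact: le_lt_trans h.
- move=> x; rewrite -dom => /andP[xpi h]; have /andP[ul ur] := u1 x xpi h.
  by rewrite /= in_itv/= acos_gt0 ?acos_ltpi ?ul ?ur ?(ltW ul) ?(ltW ur).
- move=> y /=; rewrite in_itv/= => /andP[y0 ypi].
  have c1 : c < 1 \/ c = 1.
    have : c ^+ 2 <= 1 by rewrite c2; nra.
    by have [/= c1|c1|->] := ltgtP c 1; [left|nra|right].
  have cy : -1 < cos y < 1.
    have : 0 < sin y by rewrite sin_gt0_pi ?y0.
    have := cos2Dsin2 y => e s; rewrite -ltr_norml abs_lt_sqr// expr1n; nra.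
  have ccy : -1 <= c * cos y <= 1.
    by move: cy => /andP[cy1 cy2]; case: c1 => [c1|->]; apply/andP; split; nra.
  have sx : sin (acos (c * cos y)) = Num.sqrt (1 - (c * cos y) ^+ 2) by rewrite sin_acos.
  exists (acos (c * cos y)).
    rewrite -dom acos_ge0// acos_lepi//= sx.
    rewrite abs_lt_sqr ?sqrtr_ge0// sqr_sqrtr.
      rewrite exprMn c2; move: cy => /andP[cy1 cy2]; have : cos y ^+ 2 < 1 by nra.
      by have := sqr_ge0 (cos y); nra.
    by move: ccy; set u := _ * _ => /andP[? ?]; nra.
  by rewrite acosK ?in_itv//= mulrAC divff ?gt_eqF// mul1r cosK// in_itv/= !ltW.
Qed.

Lemma hyperbolic_halfline Y : halfline_subst_prop Hyperbolic Y.
Proof.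
have c2 : gc Hyperbolic Y ^+ 2 = 1 + Y ^+ 2.
  by rewrite sqr_sqrtr /= mulN1r opprK//; nra.
have c0 : 0 < gc Hyperbolic Y by rewrite sqrtr_gt0 /= mulN1r opprK; nra.
set c := gc Hyperbolic Y in c0 c2.
have [a a0 sa] := sinh_surj (normr_ge0 Y).
have dom x : (0 <= x) && (`|Y| < sinh x) = (a < x).
  rewrite -sa sinh_ltE; have [ax|] := ltP a x; last by rewrite andbF.
  by rewrite (le_trans a0 (ltW ax)).
have pos x : `|Y| < sinh x -> 0 < sinh x ^+ 2 - Y ^+ 2.
  by move=> h; rewrite subr_gt0 -abs_lt_sqr// ltW// (le_lt_trans _ h).
have u1 x : `|Y| < sinh x -> 1 < cosh x / c.
  move=> h; have := pos x h; have := cosh2B x => e p.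
  rewrite ltr_pdivlMr// mul1r.
  have := cosh_ge1 x => c1; rewrite -(ltr_pXn2r (n := 2))// ?nnegrE ?(ltW c0)//; lra.
have su x : `|Y| < sinh x ->
    Num.sqrt ((cosh x / c) ^+ 2 - 1) * c = Num.sqrt (sinh x ^+ 2 - Y ^+ 2).
  move=> h; rewrite -{2}[c]gtr0_norm// -sqrtr_sqr -sqrtrM; last first.
    have := u1 x h; set u := _ / _ => ?; nra.
  congr Num.sqrt; rewrite mulrBl mul1r expr_div_n divfK ?expf_neq0 ?gt_eqF//.
  by rewrite c2; have := cosh2B x; lra.
exists (fun x => arcosh (cosh x / c)); split=> [x /idomP[x0 _] h /=|A mA].
  have ul := u1 x h.
  by rewrite sinh_arcosh ?arcoshK ?ltW// su// divfK// gt_eqF.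
rewrite (_ : idom Hyperbolic `&` _ = `]a, +oo[%classic); last first.
  apply/seteqP; split => x /=; rewrite !in_itv/= ?andbT; last by rewrite -dom => /andP[].
  by move=> [? ?]; rewrite -dom; apply/andP.
apply: mu_subst_oy => //.
- move=> x; rewrite -dom => /andP[x0 h].
  have uu := u1 x h; have sp := pos x h.
  have d1 : is_derive x 1 (fun y : R => cosh y / c) (sinh x / c).
    have dc := is_derive_cosh x.
    by apply: is_derive_eq; rewrite /GRing.scale/= ?mulr0 ?add0r mulrC.
  have := @is_derive_comp _ (@arcosh R) _ x _ _ (is_derive_arcosh uu) d1.
  move/is_derive_eq; apply; rewrite /= -su//.
  have w0 : Num.sqrt ((cosh x / c) ^+ 2 - 1) != 0.
    by rewrite gt_eqF// sqrtr_gt0; move: uu; set u := _ / _ => ?; nra.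
  by move: w0; set w := Num.sqrt _ => w0; field; rewrite w0 gt_eqF.
- move=> x; rewrite -dom => /andP[x0 h].
  by apply: (continuous_ratio (is_derive_sinh x)); exact: pos.
- move=> x; rewrite -dom => /andP[x0 h]; have sp := pos x h.
  rewrite divr_gt0 ?sqrtr_gt0//; exact: le_lt_trans h.
- move=> x; rewrite -dom => /andP[x0 h]; have ul := u1 x h.
  rewrite /= in_itv/= andbT lt_neqAle arcosh_ge0 ?(ltW ul)// andbT.
  apply/negP => /eqP e; have := arcoshK (ltW ul).
  by have := gC0 R Hyperbolic; rewrite -e /= => -> e1; move: ul; rewrite -e1 ltxx.
- move=> y /=; rewrite in_itv/= andbT => y0.
  have c1 : 1 <= c by rewrite -(ler_pXn2r (n := 2))// ?nnegrE ?(ltW c0)// c2; nra.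
  have s0 : 0 < sinh y by have := sinh_lt y0; rewrite {1}/sinh oppr0 subrr mul0r.
  have cy := cosh_ge1 y.
  have ccy : 1 <= c * cosh y by nra.
  exists (arcosh (c * cosh y)).
    rewrite -dom arcosh_ge0//= sinh_arcosh//.
    rewrite abs_lt_sqr ?sqrtr_ge0// sqr_sqrtr.
      by rewrite exprMn c2; have := cosh2B y; nra.
    by move: ccy; set u := _ * _ => ?; nra.
  by rewrite arcoshK//= mulrAC divff ?gt_eqF// mul1r coshK// ltW.
Qed.

Lemma halfline_subst g Y : gk R g * Y ^+ 2 < 1 -> halfline_subst_prop g Y.
Proof.
case: g => /= h; first exact: euclid_halfline.
  by apply: sphere_halfline; rewrite mul1r in h.
exact: hyperbolic_halfline.
Qed.

End Halfline.

(** * Area in polar coordinates around the pole *)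

Section PolarArea.
Variable R : realType.
Implicit Types (g : geometry) (x y Y : R) (M : set (R * R * R)).
Local Notation mu := (@lebesgue_measure R).

Definition polar g x (phi : R) : R * R * R :=
  (gS g x * cos phi, gS g x * sin phi, gC g x).

Definition circle (P : set R) := mu (`[0, 2 * pi[ `&` P).

(* Area, in polar coordinates around [(0, 0, 1)], of the part of the surface
   [gk * (X ^+ 2 + Y ^+ 2) + Z ^+ 2 = 1] lying in [M]. *)
Definition parea g M :=
  (\int[mu]_(x in idom g) ((gS g x)%:E * circle [set phi | M (polar g x phi)]))%E.

Lemma measurable_preimage3 (d : measure_display) (T : measurableType d) M (f1 f2 f3 : T -> R) :
  measurable M -> measurable_fun setT f1 -> measurable_fun setT f2 ->
  measurable_fun setT f3 -> measurable [set t | M (f1 t, f2 t, f3 t)].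
Proof.
move=> mM m1 m2 m3.
have m : measurable_fun setT (fun t => (f1 t, f2 t, f3 t)).
  by apply: measurable_fun_pair => //; exact: measurable_fun_pair.
by rewrite -[X in measurable X]setTI; apply: m.
Qed.

Lemma measurable_sin : measurable_fun setT (@sin R).
Proof. by apply: continuous_measurable_fun; exact: continuous_sin. Qed.

Lemma measurable_cos : measurable_fun setT (@cos R).
Proof. by apply: continuous_measurable_fun; exact: continuous_cos. Qed.

Lemma measurable_sqrt : measurable_fun setT (@Num.sqrt R).
Proof. by apply: continuous_measurable_fun; exact: sqrt_continuous. Qed.

Lemma measurable_polar g M : measurable M ->
  measurable [set z : R * R | M (polar g z.1 z.2)].
Proof.
move=> mM; apply: measurable_preimage3 => //.
- apply: measurable_funM.
    exact: measurableT_comp (measurable_gS g) measurable_fst.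
  exact: measurableT_comp measurable_cos measurable_snd.
- apply: measurable_funM.
    exact: measurableT_comp (measurable_gS g) measurable_fst.
  exact: measurableT_comp measurable_sin measurable_snd.
- exact: measurableT_comp (measurable_gC g) measurable_fst.
Qed.

Lemma measurable_polar_slice g x M : measurable M ->
  measurable [set phi | M (polar g x phi)].
Proof.
move=> mM; apply: measurable_preimage3 => //.
- by apply: measurable_funM => //; exact: measurable_cos.
- by apply: measurable_funM => //; exact: measurable_sin.
Qed.

Lemma mu_reflect (t : R) (A : set R) : measurable A -> mu [set x | A (t - x)] = mu A.
Proof.
move=> mA; rewrite -(mu_shift t mA).
have mA' : measurable [set x | A (x + t)].
  have mf : measurable_fun setT (fun x : R => x + t : R) by exact: measurable_funD.
  by rewrite -[X in measurable X]setTI; apply: mf.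
rewrite -(lebesgue_measureN mA'); congr (mu _).
by apply/seteqP; split => x /=; rewrite addrC.
Qed.

Lemma mu_itvco (a b : R) (P : set R) : measurable P ->
  mu (`[a, b[ `&` P) = mu (P `&` `]a, b[).
Proof.
move=> mP; have [ab|ba] := ltP a b; last first.
  by rewrite !set_itv_ge ?set0I ?setI0// bnd_simp -leNgt.
have -> : `[a, b[%classic = [set a] `|` `]a, b[%classic.
  apply/seteqP; split => x /=; rewrite !in_itv/=; last by move=> [->|]; lra.
  by rewrite le_eqVlt => /andP[/predU1P[->|ax] xb]; [left|right; rewrite ax].
rewrite setIUl measureU//.
- rewrite [X in (X + _)%E = _](_ : _ = 0%E) ?add0e 1?setIC//.
  apply: (@subset_measure0 _ (measurableTypeR R) R mu _ [set a]) => //.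
  + exact: measurableI.
  + exact: lebesgue_measure_set1.
- exact: measurableI.
- exact: measurableI.
- rewrite -subset0 => x [[/= -> _] [/=]]; by rewrite in_itv/= ltxx.
Qed.

Lemma sin_period x : sin (x + 2 * pi) = sin x :> R.
Proof. by rewrite mulr_natl sinD2pi. Qed.

Lemma cos_period x : cos (x + 2 * pi) = cos x :> R.
Proof. by rewrite mulr_natl cosD2pi. Qed.

Lemma polar_period g x phi : polar g x (phi + 2 * pi) = polar g x phi.
Proof. by rewrite /polar sin_period cos_period. Qed.

Lemma circleE (t : R) (P : set R) : -(2 * pi) <= t <= 2 * pi ->
  (forall x, P (x + 2 * pi) <-> P x) -> measurable P ->
  circle P = mu (`[t, t + 2 * pi[ `&` P).
Proof.
move=> /andP[t1 t2] Pp mP; rewrite /circle -[X in `[_, X[](add0r (2 * pi)).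
have [t0|t0] := leP 0 t; first by rewrite -(mu_period (a := 0) (b := t)) ?t0 ?add0r.
by rewrite -(mu_period (a := t) (b := 0)) ?(ltW t0)//=; lra.
Qed.

Lemma circle_shift (t : R) (P : set R) : -(2 * pi) <= t <= 2 * pi ->
  (forall x, P (x + 2 * pi) <-> P x) -> measurable P ->
  circle [set phi | P (phi + t)] = circle P.
Proof.
move=> t12 Pp mP; rewrite [RHS](circleE t12)//.
rewrite -[RHS](mu_shift t); last by apply: measurableI => //; exact: measurable_itv.
rewrite /circle; congr (mu _).
by apply/seteqP; split => x /=; rewrite !in_itv/= [_ + 2 * pi]addrC lerDr ltrD2r.
Qed.

Lemma parea_rot g (t : R) M : measurable M -> 0 <= t <= 2 * pi ->
  parea g [set w | M (w.1.1 * cos t - w.1.2 * sin t, w.1.1 * sin t + w.1.2 * cos t, w.2)]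
  = parea g M.
Proof.
move=> mM /andP[t0 t2]; apply: eq_integral => x _; congr (_ * _)%E.
rewrite -(circle_shift (t := t) (P := [set phi | M (polar g x phi)])).
- congr circle; apply/seteqP; split=> phi; rewrite /polar /= sinD cosD;
    by congr (M (_, _, _)); ring.
- by apply/andP; split; lra.
- by move=> phi /=; rewrite polar_period.
- exact: measurable_polar_slice.
Qed.

End PolarArea.

(** * Area in coordinates along a geodesic axis, and translations along it *)

Section AxisCoordinates.
Variable R : realType.
Implicit Types (g : geometry) (x y Y : R) (M : set (R * R * R)).
Local Notation mu := (@lebesgue_measure R).

Lemma measurable_set_ltr (d : measure_display) (T : measurableType d) (f h : T -> R) :
  measurable_fun setT f -> measurable_fun setT h -> measurable [set t | f t < h t].
Proof.
move=> mf mh; have := measurable_fun_ltr mf mh => /(_ measurableT [set true]).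
by rewrite setTI; apply.
Qed.

Lemma measurable_set_ler (d : measure_display) (T : measurableType d) (f h : T -> R) :
  measurable_fun setT f -> measurable_fun setT h -> measurable [set t | f t <= h t].
Proof.
move=> mf mh; have := measurable_fun_ler mf mh => /(_ measurableT [set true]).
by rewrite setTI; apply.
Qed.

Definition halfcircle : set R := `]- (pi / 2), pi / 2[%classic.

Definition mirror M : set (R * R * R) := [set w | M (- w.1.1, w.1.2, w.2)].

Lemma mu_setU (A B : set R) : measurable A -> measurable B -> A `&` B = set0 ->
  mu (A `|` B) = (mu A + mu B)%E.
Proof. by move=> *; exact: (measureU mu). Qed.

Lemma measurable_mirror M : measurable M -> measurable (mirror M).
Proof.
move=> mM; apply: measurable_preimage3 => //.
- apply: measurable_funN; exact: measurableT_comp measurable_fst measurable_fst.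
- exact: measurableT_comp measurable_snd measurable_fst.
Qed.

(** The reflection [phi -> pi - phi] exchanges the halves with positive and negative first
    coordinate; on each half the height [Y] is a coordinate. *)
Lemma circle_halves g x M : measurable M ->
  circle [set phi | M (polar g x phi)] =
  (mu ([set phi | M (polar g x phi)] `&` halfcircle) +
   mu ([set phi | mirror M (polar g x phi)] `&` halfcircle))%E.
Proof.
move=> mM; have pi0 := pi_gt0 R.
set P := [set phi | _]; have mP : measurable P by exact: measurable_polar_slice.
rewrite (@circleE _ (- (pi / 2))); [|lra| |by []]; last first.
  by move=> phi; rewrite /P/= polar_period.
have -> : `[(- (pi / 2) : R), - (pi / 2) + 2 * pi[%classic =
    `[- (pi / 2), pi / 2[%classic `|` `[pi / 2, 3 * pi / 2[%classic.
  apply/seteqP; split => x0 /=; rewrite !in_itv/=; last by case; lra.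
  by have [] := ltP x0 (pi / 2); [left|right]; lra.
rewrite setIUl mu_setU; last 3 first.
- by apply: measurableI => //; exact: measurable_itv.
- by apply: measurableI => //; exact: measurable_itv.
- rewrite -subset0 => z [[/= + _] [/= + _]]; rewrite !in_itv/=; lra.
rewrite !mu_itvco// -/halfcircle; congr (_ + _)%E.
rewrite -(mu_reflect pi); last by apply: measurableI => //; exact: measurable_itv.
congr (mu _); apply/seteqP; split => phi /=; rewrite /halfcircle/= !in_itv/= /P /mirror/polar/=;
  rewrite sinB cosB sinpi cospi !mul0r !mulN1r ?addr0 ?add0r ?subr0 ?sub0r ?opprK mulrN;
  by move=> [? ?]; split=> //; lra.
Qed.

Definition axis_point g Y (psi : R) : R * R * R :=
  (gS g psi * gc g Y, Y, gC g psi * gc g Y).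

Let E g M : set (R * R) := [set z | idom g z.1 /\ `|z.2| < gS g z.1 /\
  M (Num.sqrt (gS g z.1 ^+ 2 - z.2 ^+ 2), z.2, gC g z.1)].

(** Integrated over heights [z.2], this gives the half circle of radius [z.1]; integrated over radii
    [z.1], it gives the half slice at height [z.2]. Tonelli's theorem then trades one coordinate
    system for the other. The inverse of the square root is written as a power, which is measurable
    everywhere. *)
Let F g M (z : R * R) : \bar R :=
  (\1_(E g M) z * (gS g z.1 * Num.sqrt (gS g z.1 ^+ 2 - z.2 ^+ 2) `^ (-1)))%:E.

Let mS2 g : measurable_fun setT (fun z : R * R => gS g z.1).
Proof. exact: measurableT_comp (measurable_gS g) measurable_fst. Qed.

Let msq g : measurable_fun setT (fun z : R * R => Num.sqrt (gS g z.1 ^+ 2 - z.2 ^+ 2)).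
Proof.
apply: measurableT_comp (@measurable_sqrt R) _; apply: measurable_funB.
  by apply: measurable_funX; exact: mS2.
by apply: measurable_funX; exact: measurable_snd.
Qed.

Let mE g M : measurable M -> measurable (E g M).
Proof.
move=> mM; apply: measurableI.
  have := @measurable_fst _ _ R R measurableT _ (@measurable_idom R g).
  by rewrite setTI.
apply: measurableI.
  apply: measurable_set_ltr; last exact: mS2.
  exact: measurableT_comp (@normr_measurable R setT) measurable_snd.
apply: measurable_preimage3 => //.
exact: measurableT_comp (measurable_gC g) measurable_fst.
Qed.

Let F0 g M z : (0 <= F g M z)%E.
Proof.
rewrite lee_fin /F indicE; case: (boolP (z \in _)) => [|_]; last by rewrite mul0r.
rewrite inE => -[Iz _]; rewrite mul1r mulr_ge0 ?powR_ge0//; exact: gS_ge0.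
Qed.

Let mF g M : measurable M -> measurable_fun setT (F g M).
Proof.
move=> mM; apply/measurable_EFinP; apply: measurable_funM.
  by apply: measurable_indic; exact: mE.
apply: measurable_funM; first exact: mS2.
exact: measurableT_comp (measurable_powR (-1)) (msq g).
Qed.

Let F_slice1 g M x : measurable M -> idom g x ->
  ((gS g x)%:E * mu ([set phi | M (polar g x phi)] `&` halfcircle) =
   \int[mu]_Y F g M (x, Y))%E.
Proof.
move=> mM Ix; have := gS_ge0 Ix; rewrite le_eqVlt => /predU1P[s0|s0].
  rewrite -s0 mul0e integral0_eq// => Y _; rewrite /F indicE memNset ?mul0r//.
  by rewrite /E/= -s0 => -[_ [+ _]]; rewrite ltNge normr_ge0.
set s := gS g x in s0 *.
have sn0 : s != 0 by rewrite gt_eqF.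
have u1 Y : - s < Y < s -> -1 < Y / s < 1.
  by rewrite ltr_pdivlMr// ltr_pdivrMr// mulN1r mul1r.
have p Y : - s < Y < s -> 0 < s ^+ 2 - Y ^+ 2.
  by rewrite -ltr_norml => h; rewrite subr_gt0 -abs_lt_sqr// ltW.
have sq Y : - s < Y < s -> Num.sqrt (1 - (Y / s) ^+ 2) * s = Num.sqrt (s ^+ 2 - Y ^+ 2).
  move=> h; rewrite -{2}(gtr0_norm s0) -sqrtr_sqr -sqrtrM; last first.
    by move: (u1 _ h); set u := _ / _ => /andP[? ?]; nra.
  by congr Num.sqrt; field.
(* The substitution [Y = s * sin phi], which is a bijection from the open half circle to []- s,
   s[]. *)
pose D := `]- s, s[%classic `&` (fun Y => asin (Y / s)) @^-1` [set phi | M (polar g x phi)].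
have -> : mu ([set phi | M (polar g x phi)] `&` halfcircle) =
    (\int[mu]_(Y in D) ((Num.sqrt (s ^+ 2 - Y ^+ 2)%R)^-1)%:E)%E.
  apply: mu_subst_oo.
  - move=> Y h; have := is_derive1_asin (u1 _ h) => d.
    have d1 : is_derive Y 1 (fun y : R => y / s) (s^-1).
      by apply: is_derive_eq; rewrite /GRing.scale/= ?mulr0 ?add0r ?mulr1.
    move/is_derive_eq: (@is_derive_comp _ (@asin R) _ Y _ _ d d1); apply.
    have w0 : Num.sqrt (1 - (Y / s) ^+ 2) != 0.
      by rewrite gt_eqF// sqrtr_gt0; move: (u1 _ h); set u := _ / _ => /andP[? ?]; nra.
    by rewrite -sq// invfM.
  - move=> Y h; have p0 := p _ h.
    have d1 : is_derive Y 1 (fun y : R => s ^+ 2 - y ^+ 2) (- (2 * Y)).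
      by apply: is_derive_eq; rewrite /GRing.scale/=; ring.
    have d2 := @is_derive_comp _ (@Num.sqrt R) _ Y _ _ (is_derive1_sqrt p0) d1.
    apply: (@is_derive_continuous _ _ Y); apply: is_deriveV => //.
    by rewrite gt_eqF// sqrtr_gt0.
  - by move=> Y h; rewrite invr_gt0 sqrtr_gt0 p.
  - by move=> Y /u1 /andP[ul ur]; rewrite /halfcircle/= in_itv/= asin_gtNpi2 ?asin_ltpi2 ?ul ?ur ?ltW.
  - move=> phi; rewrite /halfcircle/= in_itv/= => phipi; exists (s * sin phi).
      have : -1 < sin phi < 1.
        have c0 : 0 < cos phi by exact: cos_gt0_pihalf.
        by rewrite -ltr_norml abs_lt_sqr// expr1n; have := cos2Dsin2 phi; nra.
      by move=> /andP[? ?]; apply/andP; split; nra.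
    rewrite mulrAC divff// mul1r sinK// in_itv/=.
    by case/andP: phipi => /ltW -> /ltW ->.
  - exact: measurable_polar_slice.
pose w Y := Num.sqrt (s ^+ 2 - Y ^+ 2) `^ (-1).
have mw : measurable_fun setT w.
  apply: measurableT_comp (measurable_powR (-1)) _.
  apply: measurableT_comp (@measurable_sqrt R) _; apply: measurable_funB; [exact: measurable_cst|exact: exprn_measurable].
have wE Y : w Y = (Num.sqrt (s ^+ 2 - Y ^+ 2))^-1 by rewrite /w powR_inv1// sqrtr_ge0.
have DE Y : (Y \in D) = ((x, Y) \in E g M).
  have key : - s < Y < s -> polar g x (asin (Y / s)) = (Num.sqrt (s ^+ 2 - Y ^+ 2), Y, gC g x).
    move=> h; have /andP[ul ur] := u1 _ h.
    rewrite /polar -/s cos_asin ?(ltW ul) ?(ltW ur)//.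
    rewrite asinK ?in_itv/= ?(ltW ul) ?(ltW ur)// mulrC sq//.
    by rewrite mulrCA divff// mulr1.
  apply/idP/idP => /set_mem h; apply/mem_set; move: h.
    move=> [/=]; rewrite in_itv/= => h; rewrite key// => Mh.
    by split=> //=; rewrite -/s ltr_norml.
  move=> [/= _ [+ Mh]]; rewrite -/s ltr_norml => h.
  by split; rewrite /= ?in_itv/= ?key.
have mD : measurable D.
  have -> : D = xsection (E g M) x.
    apply/seteqP; split => Y; rewrite /xsection/=; [|].
      by move=> /mem_set; rewrite DE.
    by rewrite -DE => /set_mem.
  exact: measurable_xsection (mE g mM).
transitivity (s%:E * \int[mu]_(Y in D) (w Y)%:E)%E.
  by congr (_ * _)%E; apply: eq_integral => Y _; rewrite wE.
rewrite -ge0_integralZl_EFin//; last 3 first.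
- by move=> Y _; rewrite lee_fin powR_ge0.
- by apply/measurable_EFinP; exact: measurable_funTS.
- exact: ltW.
rewrite integral_mkcond; apply: eq_integral => Y _; rewrite patchE /F indicE DE.
by case: ifPn => _ /=; rewrite ?mul1r ?mul0r.
Qed.

Let F_slice2 g M Y : measurable M -> gk R g * Y ^+ 2 < 1 ->
  mu ([set psi | M (axis_point g Y psi)] `&` @halfline R g) = (\int[mu]_x F g M (x, Y))%E.
Proof.
move=> mM hY; have [G [GE ->]] := halfline_subst hY; last first.
  apply: measurable_preimage3 => //.
  - by apply: measurable_funM => //; exact: measurable_gS.
  - by apply: measurable_funM => //; exact: measurable_gC.
rewrite integral_mkcond; apply: eq_integral => x _; rewrite patchE /F indicE.
set D := (X in x \in X).
have -> : (x \in D) = ((x, Y) \in E g M).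
  apply/idP/idP => /set_mem h; apply/mem_set; move: h.
    move=> [[Ix Yx]]; rewrite /axis_point/=; have [-> ->] := GE _ Ix Yx.
    by split.
  move=> [/= Ix [Yx Mx]]; split=> //=; rewrite /axis_point.
  by have [-> ->] := GE _ Ix Yx.
by case: ifPn => _ /=; rewrite ?mul1r ?mul0r// powR_inv1// sqrtr_ge0.
Qed.

Let F_slice2_0 g M Y : ~~ (gk R g * Y ^+ 2 < 1) -> (\int[mu]_x F g M (x, Y))%E = 0%E.
Proof.
rewrite -leNgt => hY; rewrite integral0_eq// => x _; rewrite /F indicE memNset ?mul0r//.
move=> [/= /gS_ge0 s0 [+ _]]; rewrite abs_lt_sqr// => h.
have := gC2S2 g x; have := sqr_ge0 (gC g x); have := sqr_ge0 Y.
by case: g hY s0 h => /=; nra.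
Qed.

Let pareaE g M : measurable M ->
  parea g M = (\int[mu]_Y (\int[mu]_x F g M (x, Y) + \int[mu]_x F g (mirror M) (x, Y)))%E.
Proof.
move=> mM; have mM' := measurable_mirror mM.
have F_out M' x Y : ~ idom g x -> F g M' (x, Y) = 0%E.
  by move=> h; rewrite /F indicE memNset ?mul0r// => -[].
have mG M' : measurable M' -> measurable_fun setT (fun x => \int[mu]_Y F g M' (x, Y))%E.
  by move=> m'; apply: measurable_fun_fubini_tonelli_F => //; exact: mF.
have mH M' : measurable M' -> measurable_fun setT (fun Y => \int[mu]_x F g M' (x, Y))%E.
  by move=> m'; apply: measurable_fun_fubini_tonelli_G => //; exact: mF.
have hT M' : measurable M' ->
    (\int[mu]_Y \int[mu]_x F g M' (x, Y) = \int[mu]_x \int[mu]_Y F g M' (x, Y))%E.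
  by move=> m'; apply/esym; apply: (@fubini_tonelli _ _ _ _ R mu mu (F g M')) => //; exact: mF.
transitivity (\int[mu]_Y \int[mu]_x F g M (x, Y) +
              \int[mu]_Y \int[mu]_x F g (mirror M) (x, Y))%E; last first.
  apply/esym; apply: ge0_integralD => //.
  - by move=> *; exact: integral_ge0.
  - exact: mH.
  - by move=> *; exact: integral_ge0.
  - exact: mH.
transitivity (\int[mu]_x \int[mu]_Y F g M (x, Y) +
              \int[mu]_x \int[mu]_Y F g (mirror M) (x, Y))%E; last first.
  by have h1 := hT _ mM; have h2 := hT _ mM'; exact: (f_equal2 _ (esym h1) (esym h2)).
transitivity (\int[mu]_x (\int[mu]_Y F g M (x, Y) +
              \int[mu]_Y F g (mirror M) (x, Y)))%E; last first.
  apply: ge0_integralD => //.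
  - by move=> *; exact: integral_ge0.
  - exact: mG.
  - by move=> *; exact: integral_ge0.
  - exact: mG.
rewrite /parea integral_mkcond; apply: eq_integral => x _; rewrite patchE.
case: ifPn => [/set_mem Ix|/negP Ix].
  rewrite circle_halves// ge0_muleDr ?measure_ge0//.
  by rewrite !F_slice1.
rewrite !integral0_eq ?adde0// => Y _; apply: F_out => Ix'; apply: Ix; exact: mem_set.
Qed.

Definition full_line g : set R :=
  match g with Spherical => `[- pi, pi[%classic | _ => setT end.

Lemma measurable_full_line g : measurable (full_line g).
Proof. by case: g => /=; [exact: measurableT|exact: measurable_itv|exact: measurableT]. Qed.

Let full_lineP g x : full_line g x <->
  [\/ @halfline R g x, @halfline R g (- x) | full_line g x /\ (x = 0 \/ x = - pi)].
Proof.
have pi0 := pi_gt0 R; split; last first.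
  by case: g => /=; rewrite !in_itv/= ?andbT // => -[||[]//]; lra.
move=> Lx; have [x0|x0|x0] := ltgtP x 0.
- have [->|xpi] := eqVneq x (- pi).
    by apply: Or33; split; [case: g Lx => //= _; rewrite in_itv/=; lra|right].
  apply: Or32; case: g Lx => /=; rewrite ?in_itv/= ?andbT; lra.
- by apply: Or31; case: g Lx => /=; rewrite ?in_itv/= ?andbT; lra.
- by apply: Or33; split=> //; left.
Qed.

(** The two half lines miss only the points [0] and [- pi] of the full line, a null set. *)
Let halflines g (Q : set R) : measurable Q ->
  (mu (Q `&` @halfline R g) + mu ([set psi : R | Q (- psi)%R] `&` @halfline R g))%E =
  mu (full_line g `&` Q).
Proof.
move=> mQ; have pi0 := pi_gt0 R.
have mh : measurable (@halfline R g) by case: g; exact: measurable_itv.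
have mhN : measurable [set x | @halfline R g (- x)].
  by rewrite -[X in measurable X]setTI; apply: (@oppr_measurable R setT).
have mQN : measurable [set x : R | Q (- x)].
  by rewrite -[X in measurable X]setTI; apply: (@oppr_measurable R setT).
rewrite -[X in (_ + X)%E](mu_reflect 0); last exact: measurableI.
set A := Q `&` _; set B := [set _ | _].
have BE : B = Q `&` [set x | @halfline R g (- x)].
  by apply/seteqP; split => x; rewrite /B /= sub0r opprK.
have mA : measurable A by exact: measurableI.
have mB : measurable B by rewrite BE; exact: measurableI.
have AB : A `&` B = set0.
  rewrite BE -subset0 => x [[_ h1] [_ /= h2]].
  by case: g {mh mhN A B BE mA mB} h1 h2 => /=; rewrite !in_itv/= ?andbT; lra.
rewrite -mu_setU//.
pose N := full_line g `&` Q `&` [set x | x = 0 \/ x = - pi].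
have mN : measurable N.
  apply: measurableI; first by apply: measurableI => //; exact: measurable_full_line.
  by apply: measurableU; exact: measurable_set1.
have N0 : mu N = 0%E.
  apply: (@subset_measure0 _ (measurableTypeR R) R mu _ [set x | x = 0 \/ x = - pi]) => //.
    by apply: measurableU; exact: measurable_set1.
    exact: subIsetr.
  by apply: countable_lebesgue_measure0; exact: (@finite_set_countable _ [set 0; - pi]).
have -> : full_line g `&` Q = (A `|` B) `|` N.
  rewrite BE /A /N; apply/seteqP; split => x /=.
    by move=> [/[dup] Lx /full_lineP[hx|hx|[_ hx]] Qx]; [left; left|left; right|right].
  move=> [[[Qx hx]|[Qx hx]]|[[Lx Qx] _]] //; split=> //; apply/full_lineP.
    by apply: Or31.
  by apply: Or32.
by rewrite [RHS]measureU0//; exact: measurableU.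
Qed.

(* In the coordinates [(Y, psi)] the area element is [dY dpsi], and the boost
   along the axis [Y = 0] is a translation in [psi]. *)
Lemma parea_axis g M : measurable M ->
  parea g M = (\int[mu]_Y (if (gk R g * Y ^+ 2 < 1)%R then
    mu (full_line g `&` [set psi | M (axis_point g Y psi)]) else 0))%E.
Proof.
move=> mM; rewrite pareaE//; apply: eq_integral => Y _; case: ifPn => hY; last first.
  by rewrite !F_slice2_0// adde0.
rewrite -!F_slice2//; last exact: measurable_mirror.
rewrite -halflines; last first.
  apply: measurable_preimage3 => //.
  - by apply: measurable_funM => //; exact: measurable_gS.
  - by apply: measurable_funM => //; exact: measurable_gC.
congr (_ + mu (_ `&` _))%E; apply/seteqP; split => psi;
  by rewrite /mirror /axis_point /= gSN gCN mulNr.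
Qed.

Lemma parea_boost g s M : measurable M -> idom g s ->
  parea g [set w | M (gC g s * w.1.1 + gS g s * w.2, w.1.2,
                      - gk R g * gS g s * w.1.1 + gC g s * w.2)] = parea g M.
Proof.
move=> mM Is; rewrite !parea_axis//; last first.
  apply: measurable_preimage3 => //.
  - apply: measurable_funD; apply: measurable_funM => //.
    exact: measurableT_comp measurable_fst measurable_fst.
  - exact: measurableT_comp measurable_snd measurable_fst.
  - apply: measurable_funD; apply: measurable_funM => //.
    exact: measurableT_comp measurable_fst measurable_fst.
apply: eq_integral => Y _; case: ifPn => // _.
pose Q := [set psi | M (axis_point g Y psi)]; rewrite -/Q; have mQ : measurable Q.
  apply: measurable_preimage3 => //.
  - by apply: measurable_funM => //; exact: measurable_gS.
  - by apply: measurable_funM => //; exact: measurable_gC.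
have -> : [set psi | [set w | M (gC g s * w.1.1 + gS g s * w.2, w.1.2,
    - gk R g * gS g s * w.1.1 + gC g s * w.2)] (axis_point g Y psi)] =
    [set psi | Q (psi + s)].
  apply/seteqP; split => psi; rewrite /Q /axis_point /= gSD gCD;
    by congr (M (_, _, _)); ring.
case: g Is @Q mQ => Is Q mQ /=; try by rewrite !setTI mu_shift.
(* On the sphere [psi] is an angle, so the shifted interval must be brought back to [[- pi, pi[]; as
   [s <= pi], the shift stays within one period. *)
have pi0 := pi_gt0 R; move/idomP: Is => [s0 /(_ erefl) spi].
have Qp psi : Q (psi + 2 * pi) <-> Q psi.
  by rewrite /Q /axis_point /= sin_period cos_period.
have -> : `[- pi, pi[%classic = `[- pi, - pi + 2 * pi[%classic :> set R.
  by apply/seteqP; split => x /=; rewrite !in_itv/=; lra.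
rewrite [RHS](@mu_period R (2 * pi) _ (- pi + s))//; last lra.
rewrite -[RHS](mu_shift s); last by apply: measurableI => //; exact: measurable_itv.
by congr (mu _); apply/seteqP; split => x /=; rewrite !in_itv/= => -[? ?]; split=> //; lra.
Qed.

End AxisCoordinates.

(** * Sectors truncated by a line *)

Section Asec.
Variable R : realType.
Implicit Types (u v x : R).

(* The inverse of [1 / cos] on [1, +oo[, extended by 0 on [0, 1]. *)
Definition asec u : R := atan (Num.sqrt (u ^+ 2 - 1)).

Lemma atan_ge0 x : 0 <= x -> 0 <= atan x.
Proof. by move=> x0; rewrite -atan0 le_atan. Qed.

Lemma asec_ge0 u : 0 <= asec u.
Proof. by rewrite atan_ge0 ?sqrtr_ge0. Qed.

Lemma asec_lt u : asec u < pi / 2.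
Proof. exact: atan_ltpi2. Qed.

Lemma asec_le1 u : 0 <= u <= 1 -> asec u = 0.
Proof.
move=> /andP[u0 u1]; rewrite /asec ler0_sqrtr ?atan0//; nra.
Qed.

Lemma cos_asec u : 1 <= u -> cos (asec u) = u^-1.
Proof.
move=> u1; rewrite cos_atan sqr_sqrtr; last nra.
by rewrite addrC subrK sqrtr_sqr ger0_norm//; lra.
Qed.

Lemma asec_homo u v : 0 <= u -> u <= v -> asec u <= asec v.
Proof.
move=> u0 uv; apply: le_atan; apply: ler_wsqrtr; nra.
Qed.

Lemma asec_gt0 u : 1 < u -> 0 < asec u.
Proof. by move=> u1; rewrite -atan0 lt_atan// sqrtr_gt0; nra. Qed.

Lemma continuous_asec : continuous asec.
Proof.
move=> u; apply: (@continuous_comp _ _ _ (fun u : R => Num.sqrt (u ^+ 2 - 1)) (@atan R)); last exact: continuous_atan.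
apply: (@continuous_comp _ _ _ (fun u : R => u ^+ 2 - 1) (@Num.sqrt R)); last exact: sqrt_continuous.
by apply: cvgB; [exact: exprn_continuous|exact: cvg_cst].
Qed.

Lemma is_derive_asec u : 1 < u -> is_derive u 1 asec (u * Num.sqrt (u ^+ 2 - 1))^-1.
Proof.
move=> u1; have p : 0 < u ^+ 2 - 1 by nra.
have d1 : is_derive u 1 (fun y : R => y ^+ 2 - 1) (2 * u).
  by apply: is_derive_eq; rewrite /GRing.scale/=; ring.
have d2 := @is_derive_comp _ (@Num.sqrt R) _ u _ _ (is_derive1_sqrt p) d1.
have d3 := @is_derive_comp _ (@atan R) _ u _ _ (is_derive1_atan _) d2.
move/is_derive_eq: d3; apply; rewrite sqr_sqrtr ?(ltW p)//.
have s0 : Num.sqrt (u ^+ 2 - 1) != 0 by rewrite gt_eqF// sqrtr_gt0.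
have u0 : u != 0 by rewrite gt_eqF//; lra.
rewrite addrC subrK; field; rewrite u0 s0//=.
Qed.

(** The quotient [cos (s * t) / cos t] increases with [t]. Turning products into sums, the cosines
    compare one by one, because [s * a + b <= s * b + a] and [|s * a - b| <= a - s * b]. *)
Lemma cos_ratio (s a b : R) : 0 <= s <= 1 -> 0 <= b -> b <= a -> a <= pi / 2 ->
  cos (s * b) * cos a <= cos (s * a) * cos b.
Proof.
move=> /andP[s0 s1] b0 ba a1.
have prod x y : cos x * cos y = (cos (x + y) + cos (x - y)) / 2.
  by rewrite cosD cosB; field.
rewrite !prod ler_pM2r//; apply: lerD.
  rewrite leNgt; apply/negP; rewrite ltr_cos ?in_itv/=; nra.
have [h|h] := leP 0 (s * a - b).
  by rewrite -(cosN (s * b - a)) leNgt; apply/negP; rewrite ltr_cos ?in_itv/=; nra.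
rewrite -(cosN (s * b - a)) -(cosN (s * a - b)).
by rewrite leNgt; apply/negP; rewrite ltr_cos ?in_itv/=; nra.
Qed.

End Asec.

Section Sector.
Variables (R : realType) (g : geometry) (Rc : R).
Hypotheses (Rc0 : 0 < Rc) (Rc1 : g = Spherical -> Rc < pi / 2).
Implicit Types (x tau : R).
Local Notation mu := (@lebesgue_measure R).

Definition gT x := gS g x / gC g x.
Local Notation T := (gT Rc).

Lemma gC_gt0_Rc x : 0 <= x <= Rc -> 0 < gC g x.
Proof.
by move=> /andP[x0 xR]; apply: gC_gt0 => // /Rc1; apply: le_lt_trans.
Qed.

Lemma gS_gt0_Rc x : 0 < x <= Rc -> 0 < gS g x.
Proof.
move=> /andP[x0 xR]; apply: gS_gt0 => // /Rc1 h; have := pi_gt0 R; lra.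
Qed.

Lemma is_derive_gT x : 0 <= x <= Rc -> is_derive x 1 gT (gC g x ^- 2).
Proof.
move=> hx; have c0 := gC_gt0_Rc hx.
have d := is_derive_div (lt0r_neq0 c0) (is_derive_gS g x) (is_derive_gC g x).
move/is_derive_eq: d; apply.
have -> : gC g x * gC g x - gS g x * (- gk R g * gS g x) = 1.
  by rewrite -(gC2S2 g x); ring.
by rewrite mul1r.
Qed.

Lemma gT_incr x y : 0 <= x -> x < y -> y <= Rc -> gT x < gT y.
Proof.
apply: gtr0_derive1_incr => [z|z|].
- by rewrite in_itv/= => /andP[/ltW z0 /ltW z1]; have [] := is_derive_gT (introT andP (conj z0 z1)).
- rewrite in_itv/= => /andP[/ltW z0 /ltW z1].
  have zR := introT andP (conj z0 z1).
  by rewrite derive1E; have /@derive_val -> := is_derive_gT zR; rewrite invr_gt0 exprn_gt0// gC_gt0_Rc.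
- apply: derivable_within_continuous => z; rewrite in_itv/= => zR.
  by have [] := is_derive_gT zR.
Qed.

Lemma gT_le x y : 0 <= x -> x <= y -> y <= Rc -> gT x <= gT y.
Proof. by move=> x0; rewrite le_eqVlt => /predU1P[->//|xy] yR; exact/ltW/gT_incr. Qed.

Lemma gT0 : gT 0 = 0. Proof. by rewrite /gT gS0 mul0r. Qed.

Lemma gT_ge0 x : 0 <= x <= Rc -> 0 <= gT x.
Proof. by move=> /andP[x0 xR]; rewrite -gT0 gT_le. Qed.

Lemma gT_gt0 x : 0 < x <= Rc -> 0 < gT x.
Proof. by move=> /andP[x0 xR]; rewrite -gT0 gT_incr. Qed.

(* A line whose distance [d] from the pole satisfies [gT d = tau] cuts off, on the
   circle of radius [x], an arc of half-angle [phi tau x] (0 if they do not meet).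
   [width] is half of what is left of the sector of half-angle [phi tau Rc]. *)
Definition phi tau x := asec (gT x / tau).
Definition width tau x := phi tau Rc - phi tau x.
Definition sector tau rho := (\int[mu]_(x in `[0%R, rho]) (gS g x * width tau x))%R.

Lemma phi_ge0 tau x : 0 <= phi tau x. Proof. exact: asec_ge0. Qed.

Lemma phi_homo tau x y : 0 < tau -> 0 <= x -> x <= y -> y <= Rc -> phi tau x <= phi tau y.
Proof.
move=> t0 x0 xy yR; apply: asec_homo; last by rewrite ler_pM2r ?invr_gt0// gT_le.
by rewrite divr_ge0 ?(ltW t0)// gT_ge0// x0 (le_trans xy).
Qed.

Lemma width_ge0 tau x : 0 < tau -> 0 <= x <= Rc -> 0 <= width tau x.
Proof. by move=> t0 /andP[x0 xR]; rewrite subr_ge0 phi_homo. Qed.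

Lemma width_homo tau x y : 0 < tau -> 0 <= x -> x <= y -> y <= Rc -> width tau y <= width tau x.
Proof. by move=> *; rewrite lerB// phi_homo. Qed.

Lemma phi0 tau x : 0 < tau -> 0 <= x <= Rc -> gT x <= tau -> phi tau x = 0.
Proof.
by move=> t0 hx h; rewrite /phi asec_le1// divr_ge0 ?gT_ge0 ?(ltW t0)//= ler_pdivrMr// mul1r.
Qed.

Lemma cos_phi tau x : 0 < tau -> tau <= gT x -> cos (phi tau x) = tau / gT x.
Proof.
by move=> t0 h; rewrite /phi cos_asec ?invf_div// ler_pdivlMr// mul1r.
Qed.

(** When the circle meets both lines, [cos (phi tau x) / cos (phi tau Rc) = gT Rc / gT x] does not
    depend on [tau]. With [s] the ratio [phi tr x / phi tr Rc], the bound
    [phi tau x <= s * phi tau Rc] is therefore [cos_ratio] read through the decreasing cosine. *)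
Lemma phi_ratio (tr tau x : R) : 0 < tr -> tr <= tau -> tau <= T -> 0 <= x <= Rc ->
  phi tau x * phi tr Rc <= phi tr x * phi tau Rc.
Proof.
move=> tr0 trt tT hx; have t0 : 0 < tau by lra.
have [h|h] := leP (gT x) tau.
  by rewrite phi0// mul0r mulr_ge0// phi_ge0.
have x0 : 0 < gT x by lra.
have /andP[_ xR] := hx.
have xT : gT x <= T by rewrite gT_le//; case/andP: hx.
have T0 : 0 < T by lra.
have [thr|thr] := leP (phi tr Rc) 0.
  have : phi tr x <= phi tr Rc by rewrite phi_homo//; case/andP: hx.
  have := phi_ge0 tr x; have := phi_ge0 tr Rc; have := phi_ge0 tau x; have := phi_ge0 tau Rc.
  by nra.
pose s := phi tr x / phi tr Rc.
have s0 : 0 <= s by rewrite divr_ge0 ?phi_ge0.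
have s1 : s <= 1 by rewrite ler_pdivrMr// mul1r phi_homo//; case/andP: hx.
have sE : phi tr x = s * phi tr Rc by rewrite /s divfK ?gt_eqF.
suff : phi tau x <= s * phi tau Rc by rewrite sE => ?; nra.
have pT : phi tau Rc < pi / 2 by exact: asec_lt.
have pi0 := pi_gt0 R.
rewrite leNgt -ltr_cos ?in_itv/=; last 2 first.
- by have := phi_ge0 tau Rc; nra.
- rewrite phi_ge0/=; have := asec_lt (gT x / tau); rewrite -/(phi tau x); lra.
rewrite -leNgt cos_phi ?(ltW h)//.
have := @cos_ratio R s (phi tr Rc) (phi tau Rc); rewrite s0 s1 => /(_ isT).
have ab : phi tau Rc <= phi tr Rc.
  by apply: asec_homo; [rewrite divr_ge0; lra|rewrite ler_pM2l// lef_pV2 ?posrE].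
move=> /(_ (phi_ge0 _ _) ab (ltW (asec_lt _))).
rewrite -sE !cos_phi//; try lra.
move=> hh; have -> : cos (s * phi tau Rc) = (cos (s * phi tau Rc) * (tr / T)) * (T / tr).
  by field; rewrite !gt_eqF.
apply: (le_trans (y := tr / gT x * (tau / T) * (T / tr))).
  by rewrite ler_wpM2r// divr_ge0; lra.
by rewrite le_eqVlt; apply/orP; left; apply/eqP; field; rewrite !gt_eqF.
Qed.

(** The tangent of [phi tau x]. *)
Definition slope tau x := Num.sqrt ((gT x / tau) ^+ 2 - 1).

Lemma slope_gt0 tau x : 0 < tau -> tau < gT x -> 0 < slope tau x.
Proof.
move=> t0 h; rewrite sqrtr_gt0; have : 1 < gT x / tau by rewrite ltr_pdivlMr// mul1r.
nra.
Qed.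

Lemma sqr_slope tau x : 0 < tau -> tau <= gT x -> slope tau x ^+ 2 = (gT x / tau) ^+ 2 - 1.
Proof.
move=> t0 h; rewrite sqr_sqrtr//; have : 1 <= gT x / tau by rewrite ler_pdivlMr// mul1r.
nra.
Qed.

Lemma phiE tau x : phi tau x = atan (slope tau x). Proof. by []. Qed.

Lemma continuous_gT x : 0 <= x <= Rc -> {for x, continuous gT}.
Proof. by move=> hx; apply: is_derive_continuous (is_derive_gT hx). Qed.

Lemma continuous_phi tau x : 0 <= x <= Rc -> {for x, continuous (phi tau)}.
Proof.
move=> hx; apply: (@continuous_comp _ _ _ (fun x => gT x / tau) (@asec R)).
  by apply: cvgMr_tmp; exact: continuous_gT.
exact: continuous_asec.
Qed.

Lemma is_derive_phi tau x : 0 < tau -> tau < gT x -> 0 <= x <= Rc ->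
  is_derive x 1 (phi tau) (gS g x * gC g x * slope tau x)^-1.
Proof.
move=> t0 h hx; have u1 : 1 < gT x / tau by rewrite ltr_pdivlMr// mul1r.
have d1 : is_derive x 1 (fun y => gT y / tau) (gC g x ^- 2 / tau).
  have dg := is_derive_gT hx.
  by apply: is_derive_eq; rewrite /GRing.scale/= ?mulr0 ?add0r mulrC.
move/is_derive_eq: (@is_derive_comp _ (@asec R) _ x _ _ (is_derive_asec u1) d1); apply.
have c0 := gC_gt0_Rc hx.
have s0 : 0 < gS g x.
  have : 0 < gT x by lra.
  by rewrite /gT pmulr_lgt0// invr_gt0.
have m0 := slope_gt0 t0 h.
rewrite -/(slope tau x); move: m0; set m := slope _ _ => m0; rewrite /gT.
by field; rewrite !gt_eqF.
Qed.

(** At [Rc] all widths vanish, and their derivatives there are inversely proportional to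
    [slope tau Rc]: the factors make the two derivatives equal at [Rc]. Before [Rc], the scaled
    width for [d] is the steeper one, so their difference decreases to 0. *)
Lemma width_slope (r d x : R) : 0 < r -> r <= d -> d <= x -> x <= Rc ->
  slope (gT r) Rc * width (gT r) x <= slope (gT d) Rc * width (gT d) x.
Proof.
move=> r0 rd dx xR.
have d0 : 0 < d by lra.
have tr0 : 0 < gT r by apply: gT_gt0; lra.
have trd : gT r <= gT d by apply: gT_le; lra.
set Xr := slope (gT r) Rc; set Xd := slope (gT d) Rc.
pose D x := Xd * width (gT d) x - Xr * width (gT r) x.
suff : D Rc <= D x.
  have -> : D Rc = 0 by rewrite /D /width; ring.
  by rewrite /D subr_ge0.
have dD z : d < z < Rc -> is_derive z 1 D
    (- (Xd * (gS g z * gC g z * slope (gT d) z)^-1)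
     + Xr * (gS g z * gC g z * slope (gT r) z)^-1).
  move=> /andP[dz zR].
  have hz : 0 <= z <= Rc by lra.
  have h1 := @is_derive_phi (gT d) z (lt_le_trans tr0 trd) (gT_incr (ltW d0) dz (ltW zR)) hz.
  have h2 := @is_derive_phi (gT r) z tr0 (gT_incr (ltW r0) (le_lt_trans rd dz) (ltW zR)) hz.
  rewrite /D /width; apply: is_derive_eq; rewrite /GRing.scale/=; ring.
have dsc x0 y0 : d <= x0 -> x0 <= y0 -> y0 <= Rc -> D y0 <= D x0; last exact: dsc (lexx Rc).
apply: ler0_derive1_nincr.
- by move=> z; rewrite in_itv/= => /dD[].
- move=> z; rewrite in_itv/= => hz; rewrite derive1E; have /@derive_val -> := dD z hz.
  move: hz => /andP[dz zR].
  have hz : 0 <= z <= Rc by lra.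
  have tdz : gT d < gT z by apply: gT_incr => //; lra.
  have tzR : gT z < T by apply: gT_incr => //; lra.
  have s0 : 0 < gS g z * gC g z.
    by rewrite mulr_gt0 ?gC_gt0_Rc// gS_gt0_Rc//; lra.
  have md0 : 0 < slope (gT d) z by apply: slope_gt0; lra.
  have mr0 : 0 < slope (gT r) z by apply: slope_gt0; lra.
  have key : Xr * slope (gT d) z <= Xd * slope (gT r) z.
    rewrite -(ler_pXn2r (n := 2))// ?nnegrE; last 2 first.
    - by rewrite mulr_ge0 ?sqrtr_ge0.
    - by rewrite mulr_ge0 ?sqrtr_ge0.
    rewrite !exprMn !sqr_slope; try lra.
    (* After squaring, the difference of the two sides is [(T ^ 2 - gT z ^ 2) * (A ^ 2 - B ^ 2)]. *)
    have AB : (gT d)^-1 <= (gT r)^-1 by rewrite lef_pV2 ?posrE; lra.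
    have B0 : 0 < (gT d)^-1 by rewrite invr_gt0; lra.
    move: AB B0; set A := (gT r)^-1; set B := (gT d)^-1 => AB B0.
    have c0 : 0 <= gT z by lra.
    have h1 : 0 <= T ^+ 2 - gT z ^+ 2 by nra.
    have h2 : 0 <= A ^+ 2 - B ^+ 2 by nra.
    have := mulr_ge0 h1 h2; nra.
  set w := gS g z * gC g z in s0 *; set md := slope (gT d) z in md0 key *.
  set mr := slope (gT r) z in mr0 key *.
  have -> : - (Xd * (w * md)^-1) + Xr * (w * mr)^-1 = - (Xd * mr - Xr * md) / (w * md * mr).
    by field; rewrite !gt_eqF.
  have den : 0 < w * md * mr by apply: mulr_gt0 => //; apply: mulr_gt0.
  by rewrite mulNr oppr_le0 divr_ge0 ?subr_ge0// ltW.
apply: continuous_in_subspaceT => z; rewrite inE/= in_itv/= => hz.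
have hz' : 0 <= z <= Rc by lra.
by apply: cvgB; apply: cvgMl_tmp; apply: cvgB;
  solve [exact: cvg_cst | exact: continuous_phi].
Qed.

(* The primitive of [gS] vanishing at 0. *)
Definition gf x : R := match g with Euclidean => x ^+ 2 / 2 | _ => gk R g * (1 - gC g x) end.

Lemma is_derive_gf x : is_derive x 1 gf (gS g x).
Proof.
rewrite /gf; have := is_derive_gC g x; case: g => /= dC.
- by apply: is_derive_eq; rewrite /GRing.scale/=; field.
- by apply: is_derive_eq; rewrite /GRing.scale/=; ring.
- by apply: is_derive_eq; rewrite /GRing.scale/=; ring.
Qed.

Lemma gf0 : gf 0 = 0.
Proof. by have := gC0 R g; rewrite /gf; case: (g) => /= [_|->|->]; ring. Qed.

(** The area of the right triangle with hypotenuse [x] and angle [phi tau x] at the pole. In the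
    curved cases it is the angular excess or defect, the third angle being
    [pi / 2 - atan (gC g x * slope tau x)]. *)
Definition cap tau x : R := match g with
  | Euclidean => tau ^+ 2 / 2 * slope tau x
  | _ => gk R g * (phi tau x - atan (gC g x * slope tau x)) end.

Lemma is_derive_cap tau x : 0 < tau -> tau < gT x -> 0 <= x <= Rc ->
  is_derive x 1 (cap tau) (gf x * (gS g x * gC g x * slope tau x)^-1).
Proof.
move=> t0 h hx.
have c0 := gC_gt0_Rc hx.
have tx0 : 0 < gT x by lra.
have s0 : 0 < gS g x by move: tx0; rewrite /gT pmulr_lgt0// invr_gt0.
have m0 := slope_gt0 t0 h.
have u1 : 1 < gT x / tau by rewrite ltr_pdivlMr// mul1r.
have dphi := is_derive_phi t0 h hx.
have dm : is_derive x 1 (slope tau) (gS g x / (gC g x ^+ 3 * tau ^+ 2 * slope tau x)).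
  have d1 : is_derive x 1 (fun y => gT y / tau) (gC g x ^- 2 / tau).
    have dg := is_derive_gT hx.
    by apply: is_derive_eq; rewrite /GRing.scale/= ?mulr0 ?add0r mulrC.
  have d2 : is_derive x 1 (fun y => (gT y / tau) ^+ 2 - 1) (2 * (gT x / tau) * (gC g x ^- 2 / tau)).
    by apply: is_derive_eq; rewrite /GRing.scale/=; ring.
  have p : 0 < (gT x / tau) ^+ 2 - 1 by nra.
  move/is_derive_eq: (@is_derive_comp _ (@Num.sqrt R) _ x _ _ (is_derive1_sqrt p) d2); apply.
  rewrite -/(slope tau x); move: m0; set m := slope _ _ => m0; rewrite /gT.
  by field; rewrite !gt_eqF.
have m2 := sqr_slope t0 (ltW h).
have := is_derive_gC g x; have := gC2S2 g x.
rewrite /cap /gf; move: dphi dm m2 c0 s0 m0; rewrite {1}/gT.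
set m := slope tau x; set S := gS g x; set C := gC g x => dphi dm m2 c0 s0 m0 cs dC.
have trig : gk R g ^+ 2 = 1 -> is_derive x 1 (fun y => gk R g * (phi tau y - atan (gC g y * slope tau y)))
    (gk R g * (1 - C) * (S * C * m)^-1).
  move=> k2.
  have d3 : is_derive x 1 (fun y => gC g y * slope tau y)
      (C * (S / (C ^+ 3 * tau ^+ 2 * m)) + m * (- gk R g * S)).
    exact: is_deriveM.
  have d4 := @is_derive_comp _ (@atan R) _ x _ _ (is_derive1_atan _) d3.
  have d5 : is_derive x 1 (fun y => gk R g * (phi tau y - atan (gC g y * slope tau y)))
     (gk R g * ((S * C * m)^-1 - (1 + (C * m) ^+ 2)^-1 *
      (C * (S / (C ^+ 3 * tau ^+ 2 * m)) + m * (- gk R g * S)))).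
    have d6 := is_deriveB dphi d4.
    by apply: is_derive_eq; rewrite /GRing.scale/= -/m -/C -/S ?mul0r ?addr0.
  move/is_derive_eq: d5; apply.
  (* [tau] is eliminated through [m ^ 2 + 1 = (gT x / tau) ^ 2]. *)
  have e1 : C * (S / (C ^+ 3 * tau ^+ 2 * m)) = (m ^+ 2 + 1) / (S * m).
    by rewrite m2 subrK /gT -/S -/C; field; rewrite !gt_eqF.
  have e2 : C * (S / (C ^+ 3 * tau ^+ 2 * m)) + m * (- gk R g * S) = (1 + (C * m) ^+ 2) / (S * m).
    have -> : (C * m) ^+ 2 = (1 - gk R g * S ^+ 2) * m ^+ 2 by rewrite -cs; ring.
    by rewrite e1; field; rewrite !gt_eqF.
  rewrite e2; have q : 1 + (C * m) ^+ 2 != 0 by rewrite gt_eqF//; nra.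
  by move: q; set qq := 1 + _ => q; field; rewrite q !gt_eqF.
have gcase : g = Euclidean \/ g <> Euclidean by case: (g); [left|right|right].
case: gcase => [gE|gN].
  have [SE CE] : S = x /\ C = 1 by rewrite /S /C gE.
  rewrite gE SE CE; rewrite SE CE in dm s0; apply: is_derive_eq.
  by rewrite /GRing.scale/=; field; rewrite !gt_eqF.
have k2 : gk R g ^+ 2 = 1 by case: (g) gN => //= _; rewrite ?sqrrN expr1n.
by case: (g) gN (trig k2).
Qed.

(** Integration by parts. Up to [d] the width is constant; beyond [d], where [phi] becomes
    differentiable, [gf * width + cap] is a primitive. The two boundary terms at [d] cancel, since
    [phi] and [cap] vanish there. *)
Lemma sectorE d : 0 < d -> d < Rc -> sector (gT d) Rc = cap (gT d) Rc.
Proof.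
move=> d0 dR.
have td0 : 0 < gT d by apply: gT_gt0; lra.
pose h x := gS g x * width (gT d) x.
have ch x : 0 <= x <= Rc -> {for x, continuous h}.
  move=> hx; apply: cvgM; first exact: continuous_gS.
  by apply: cvgB; [exact: cvg_cst|exact: continuous_phi].
have chw a b : 0 <= a -> b <= Rc -> {within `[a, b], continuous h}.
  move=> a0 bR; apply: continuous_in_subspaceT => z; rewrite inE/= in_itv/= => hz.
  by apply: ch; lra.
have ih : mu.-integrable `[0, Rc] (EFin \o h).
  by apply: continuous_compact_integrable; [exact: segment_compact|exact: chw].
have ih2 : mu.-integrable `]d, Rc] (EFin \o h).
  apply: integrableS ih => // x /=; rewrite !in_itv/=; lra.
have split := @Rintegral_itvB R h (BLeft 0) (BRight Rc) d ih.
have I1 : \int[mu]_(x in `[0, d]) h x = gf d * phi (gT d) Rc.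
  transitivity (\int[mu]_(x in `[0, d]) (gS g x * phi (gT d) Rc)).
    apply: eq_Rintegral => x; rewrite inE/= in_itv/= => /andP[x0 xd].
    by rewrite /h /width [phi _ x]phi0 ?subr0//; [lra|apply: gT_le; lra].
  rewrite /Rintegral (@continuous_FTC2 _ _ (fun x => gf x * phi (gT d) Rc))//=.
  - by rewrite gf0 mul0r subr0.
  - by apply: continuous_subspaceT => z; apply: cvgMr_tmp; exact: continuous_gS.
  - have cf z : {for z, continuous (fun x => gf x * phi (gT d) Rc)}.
      by apply: cvgMr_tmp; apply: is_derive_continuous (is_derive_gf z).
    split; [|exact/cvg_at_right_filter/cf|exact/cvg_at_left_filter/cf].
    by move=> z _; apply: derivableM => //; have [] := is_derive_gf z.
  - move=> z _; rewrite derive1E.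
    have dz := is_derive_gf z.
    have /@derive_val -> : is_derive z 1 (fun x => gf x * phi (gT d) Rc) (gS g z * phi (gT d) Rc).
      by apply: is_derive_eq; rewrite /GRing.scale/=; ring.
    by [].
pose K x := gf x * width (gT d) x + cap (gT d) x.
have cslope z : 0 <= z <= Rc -> {for z, continuous (slope (gT d))}.
  move=> hz; apply: (@continuous_comp _ _ _ (fun x => (gT x / gT d) ^+ 2 - 1) (@Num.sqrt R)).
    apply: cvgB; last exact: cvg_cst.
    apply: (@continuous_comp _ _ _ (fun x => gT x / gT d) (fun u : R => u ^+ 2)).
      by apply: cvgMr_tmp; exact: continuous_gT.
    exact: exprn_continuous.
  exact: sqrt_continuous.
have ccap z : 0 <= z <= Rc -> {for z, continuous (cap (gT d))}.
  move=> hz; have cg := @continuous_gC R g z; have cs := cslope _ hz.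
  have cp := @continuous_phi (gT d) z hz.
  have ct : {for z, continuous (fun x => gk R g * (phi (gT d) x - atan (gC g x * slope (gT d) x)))}.
    apply: cvgMl_tmp; apply: cvgB => //.
    apply: (@continuous_comp _ _ _ (fun x => gC g x * slope (gT d) x) (@atan R)).
      exact: cvgM.
    exact: continuous_atan.
  rewrite /cap; move: cs ct; case: (g) => // cs _.
  exact: cvgMl_tmp.
have cK z : 0 <= z <= Rc -> {for z, continuous K}.
  move=> hz; apply: cvgD; last exact: ccap.
  apply: cvgM; first by apply: is_derive_continuous (is_derive_gf z).
  by apply: cvgB; [exact: cvg_cst|exact: continuous_phi].
have dK z : d < z < Rc -> is_derive z 1 K (h z).
  move=> /andP[dz zR].
  have hz : 0 <= z <= Rc by rewrite (ltW zR) (ltW (lt_trans d0 dz)).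
  have tz : gT d < gT z := gT_incr (ltW d0) dz (ltW zR).
  have d1 := is_derive_cap td0 tz hz; have d2 := is_derive_gf z.
  have d3 := is_derive_phi td0 tz hz.
  rewrite /K /width; apply: is_derive_eq; rewrite /GRing.scale/= /h /width; ring.
have slope0 : slope (gT d) d = 0 by rewrite /slope divff ?expr1n ?subrr ?sqrtr0// gt_eqF.
have phid : phi (gT d) d = 0 by rewrite phiE slope0 atan0.
have capd : cap (gT d) d = 0.
  by rewrite /cap phid slope0; case: (g); rewrite ?mulr0 ?atan0 ?subr0 ?mulr0.
have I2 : \int[mu]_(x in `]d, Rc]) h x = cap (gT d) Rc - gf d * phi (gT d) Rc.
  rewrite Rintegral_itv_obnd_cbnd// /Rintegral (@continuous_FTC2 _ _ K)//=.
  - rewrite /K /width subrr mulr0 add0r phid subr0.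
    by rewrite capd addr0.
  - exact: chw (ltW d0) (lexx _).
  - split; [|apply/cvg_at_right_filter/cK|apply/cvg_at_left_filter/cK];
      rewrite ?(ltW d0) ?(ltW dR) ?(ltW Rc0) ?lexx//.
    by move=> z; rewrite in_itv/= => /dK[].
  - by move=> z; rewrite in_itv/= => /dK ?; rewrite derive1E derive_val.
rewrite /sector -/(h _) -[LHS](subrK (\int[mu]_(x in `[0, d]) h x)).
by rewrite split ?bnd_simp ?ltW// I1 I2 subrK.
Qed.

(** The difference of the two expressions decreases in [c] and vanishes at [c = 1]. It is applied to
    [c = gC g Rc], which is at most 1 on the sphere and at least 1 in the hyperbolic plane; the sign
    of the curvature then compensates. *)
Lemma atan_gap_homo (X Y c : R) : 0 <= X -> X <= Y ->
  (0 <= c -> c <= 1 -> X * (atan X - atan (c * X)) <= Y * (atan Y - atan (c * Y))) /\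
  (1 <= c -> Y * (atan Y - atan (c * Y)) <= X * (atan X - atan (c * X))).
Proof.
move=> X0 XY.
pose D c := Y * (atan Y - atan (c * Y)) - X * (atan X - atan (c * X)).
have dlin Z (e : R) : is_derive e 1 (fun c : R => atan (c * Z)) ((1 + (e * Z) ^+ 2)^-1 * Z).
  apply: (@is_derive_comp _ (@atan R) (fun c => c * Z) e).
  by apply: is_derive_eq; rewrite /GRing.scale/= ?mulr0 ?add0r ?mulr1.
have dD (e : R) : is_derive e 1 D
    (- (Y * ((1 + (e * Y) ^+ 2)^-1 * Y)) + X * ((1 + (e * X) ^+ 2)^-1 * X)).
  have := dlin X e; have := dlin Y e => h1 h2.
  by rewrite /D; apply: is_derive_eq; rewrite /GRing.scale/=; ring.
have D1 : D 1 = 0 by rewrite /D !mul1r; ring.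
have mono (x y : R) : x <= y -> D y <= D x.
  move=> xy; have h x0 y0 : x <= x0 -> x0 <= y0 -> y0 <= y -> D y0 <= D x0; last exact: h.
  apply: ler0_derive1_nincr.
  - by move=> z _; have [] := dD z.
  - move=> z _; rewrite derive1E; have /@derive_val -> := dD z.
    rewrite addrC subr_le0.
    have a : 0 < 1 + (z * X) ^+ 2 by nra.
    have b : 0 < 1 + (z * Y) ^+ 2 by nra.
    have e Z (u : R) : Z * (u^-1 * Z) = Z ^+ 2 / u by rewrite mulrCA mulrC.
    rewrite !e ler_pdivrMr// mulrAC ler_pdivlMr//.
    move: XY X0 => XY X0; nra.
  - apply: derivable_within_continuous => z _; by have [] := dD z.
split=> [c0 c1|c1]; have := mono _ _ c1; rewrite D1 /D; lra.
Qed.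

Lemma gcase : g = Euclidean \/ g <> Euclidean.
Proof. by case: (g); [left|right|right]. Qed.

Lemma slope_homo (r d : R) : 0 < r -> r <= d -> d <= Rc ->
  slope (gT d) Rc <= slope (gT r) Rc.
Proof.
move=> r0 rd dR.
have r1 : 0 < gT r by apply: gT_gt0; rewrite r0 (le_trans rd).
have d1 : gT r <= gT d by exact: gT_le (ltW r0) rd dR.
have dT : gT d <= T by apply: gT_le => //; exact: le_trans (ltW r0) rd.
apply: ler_wsqrtr; apply: lerB => //.
have h : T / gT d <= T / gT r.
  by rewrite ler_pM2l ?(lt_le_trans r1)// ?(le_trans d1)// lef_pV2 ?posrE// (lt_le_trans r1).
have h0 : 0 <= T / gT d by rewrite divr_ge0// ?(le_trans (ltW r1))// (le_trans d1).
by rewrite ler_pXn2r ?nnegrE// (le_trans h0).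
Qed.

(** Opposite in direction to [width_slope]: after the same scaling, the whole sector for [d] is the
    smaller one although its outer widths are larger. Hence the ratio of the sectors is at most the
    inverse ratio of the slopes, which places the crossing of the two densities before [d]. *)
Lemma sector_slope (r d : R) : 0 < r -> r <= d -> d < Rc ->
  slope (gT d) Rc * sector (gT d) Rc <= slope (gT r) Rc * sector (gT r) Rc.
Proof.
move=> r0 rd dR; have d0 : 0 < d by exact: lt_le_trans rd.
rewrite !sectorE//; last exact: le_lt_trans dR.
have r1 : 0 < gT r by apply: gT_gt0; rewrite r0 (le_trans rd)// ltW.
have d1 : gT r <= gT d by exact: gT_le (ltW r0) rd (ltW dR).
have dT : gT d <= T by exact: gT_le (ltW d0) (ltW dR) (lexx _).
have XX := slope_homo r0 rd (ltW dR).
have X0 : 0 <= slope (gT d) Rc by exact: sqrtr_ge0.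
have [h1 h2] := atan_gap_homo (gC g Rc) X0 XX.
have [gE|gN] := gcase.
  have capE u : cap u Rc = u ^+ 2 / 2 * slope u Rc by rewrite /cap gE.
  rewrite !capE.
  have e u : 0 < u -> u <= T -> slope u Rc * (u ^+ 2 / 2 * slope u Rc) = (T ^+ 2 - u ^+ 2) / 2.
    move=> u0 uT; have -> : slope u Rc * (u ^+ 2 / 2 * slope u Rc) = u ^+ 2 / 2 * slope u Rc ^+ 2 by ring.
    by rewrite sqr_slope//; field; rewrite gt_eqF.
  have d2 := lt_le_trans r1 d1; rewrite !e//; last exact: le_trans dT.
  by rewrite ler_pM2r// lerB// ler_pXn2r// nnegrE ltW.
have capE u : cap u Rc = gk R g * (atan (slope u Rc) - atan (gC g Rc * slope u Rc)).
  by rewrite /cap phiE; case: (g) gN.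
rewrite !capE.
have e u : slope u Rc * (gk R g * (atan (slope u Rc) - atan (gC g Rc * slope u Rc))) =
   gk R g * (slope u Rc * (atan (slope u Rc) - atan (gC g Rc * slope u Rc))) by ring.
rewrite !e; have c0 : 0 < gC g Rc by apply: gC_gt0_Rc; rewrite lexx ltW.
move: h1 h2 c0 gN; set A := slope _ _ * _; set B := slope _ _ * _.
have := @cosh_ge1 R Rc; have := @cos_le1 R Rc.
case: (g) => //= c1 c2 h1 h2 c0 _; first by rewrite !mul1r; apply: h1 => //; exact: ltW.
by rewrite !mulN1r lerN2; apply: h2.
Qed.

Lemma integrable_sector tau rho : 0 <= rho -> rho <= Rc ->
  mu.-integrable `[0, rho] (EFin \o (fun x => gS g x * width tau x)).
Proof.
move=> r0 rR; apply: continuous_compact_integrable; first exact: segment_compact.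
apply: continuous_in_subspaceT => z; rewrite inE/= in_itv/= => /andP[z0 zr].
apply: cvgM; first exact: continuous_gS.
by apply: cvgB; [exact: cvg_cst|apply: continuous_phi; rewrite z0 (le_trans zr)].
Qed.

Lemma gS_ge0_Rc x : 0 <= x -> x <= Rc -> 0 <= gS g x.
Proof.
by rewrite le_eqVlt => /predU1P[<- _|x0 xR]; [rewrite gS0|apply/ltW/gS_gt0_Rc; rewrite x0].
Qed.

Lemma sector_ge0 tau rho : 0 < tau -> 0 <= rho -> rho <= Rc -> 0 <= sector tau rho.
Proof.
move=> t0 r0 rR; apply: Rintegral_ge0 => x /=; rewrite in_itv/= => /andP[x0 xr].
have xR := le_trans xr rR.
by rewrite mulr_ge0 ?gS_ge0_Rc// width_ge0// x0.
Qed.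

Definition annulus tau rho := (\int[mu]_(x in `]rho, Rc]) (gS g x * width tau x))%R.

Lemma sector_split tau rho : 0 <= rho -> rho <= Rc ->
  sector tau Rc = sector tau rho + annulus tau rho.
Proof.
move=> r0 rR; have := @Rintegral_itvB R _ (BLeft 0) (BRight Rc) rho
  (integrable_sector tau (ltW Rc0) (lexx _)).
by rewrite !bnd_simp => /(_ r0 rR); rewrite /sector /annulus => <-; rewrite addrC subrK.
Qed.

Lemma Rintegral_leZl (D : set R) (f h : R -> R) (l : R) : measurable D ->
  mu.-integrable D (EFin \o f) -> mu.-integrable D (EFin \o h) ->
  (forall x, D x -> l * f x <= h x) ->
  l * (\int[mu]_(x in D) f x)%R <= (\int[mu]_(x in D) h x)%R.
Proof.
move=> mD intf inth fh; rewrite -RintegralZl//; apply: le_Rintegral => //.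
by have := @integrableZl _ _ R mu D _ l _ intf; apply.
Qed.

Lemma Rintegral_leZr (D : set R) (f h : R -> R) (l : R) : measurable D ->
  mu.-integrable D (EFin \o f) -> mu.-integrable D (EFin \o h) ->
  (forall x, D x -> h x <= l * f x) ->
  (\int[mu]_(x in D) h x)%R <= l * (\int[mu]_(x in D) f x)%R.
Proof.
move=> mD intf inth fh; rewrite -RintegralZl//; apply: le_Rintegral => //.
by have := @integrableZl _ _ R mu D _ l _ intf; apply.
Qed.

Lemma split_le (l v a b a' b' : R) :
  l * v = a + b -> v = a' + b' -> l * b' <= b -> a <= l * a'.
Proof. by move=> /[swap] ->; rewrite mulrDr; lra. Qed.

(** Here [a] and [b] stand for the integrals of a decreasing density over an inner and an outer
    region of masses [P] and [Q], and [w] for its value at the common boundary. *)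
Lemma split_cross (w P Q a b : R) : 0 <= P -> 0 <= Q -> w * P <= a -> b <= w * Q ->
  P * (a + b) <= a * (Q + P).
Proof. by move=> P0 Q0 h1 h2; have := ler_wpM2l P0 h2; have := ler_wpM2r Q0 h1; nra. Qed.

(** Normalizes by the ratio [l = u / v], so that the two densities may be compared at equal total
    mass. *)
Lemma cross_le (a b u v : R) : 0 <= u -> 0 <= v -> 0 <= b ->
  (forall l, 0 <= l -> 0 < v -> u = l * v -> a <= l * b) -> a * v <= b * u.
Proof.
move=> u0; rewrite le_eqVlt => /predU1P[<- b0 _|v0 b0 h]; first by rewrite mulr0 mulr_ge0.
have uE : u = u / v * v by rewrite divfK// lt0r_neq0.
by rewrite uE mulrCA mulrA ler_wpM2r ?(ltW v0)// h// divr_ge0// ltW.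
Qed.

(* After scaling by the ratio [l] of the sectors up to [Rc], the densities cross
   only once: beyond [d] the one for [d] dominates, and below [d] it is constant
   while the other one decreases. *)
Lemma sector_ratio (r d rho : R) : 0 < r -> r <= d -> d <= Rc -> 0 <= rho -> rho <= Rc ->
  sector (gT d) rho * sector (gT r) Rc <= sector (gT r) rho * sector (gT d) Rc.
Proof.
move=> r0 rd dR p0 pR; have d0 : 0 < d by exact: lt_le_trans rd.
have r1 : 0 < gT r by apply: gT_gt0; rewrite r0 (le_trans rd).
have d1 : 0 < gT d by apply: gT_gt0; rewrite d0.
move: dR; rewrite le_eqVlt => /predU1P[dE|dR].
  (* For [d = Rc] the arc degenerates to a point and the left side vanishes. *)
  have w0 x : 0 <= x <= Rc -> width (gT d) x = 0.
    move=> /andP[x0 xR]; rewrite /width !phi0 ?subrr// ?x0 ?(ltW Rc0)//= dE//.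
    exact: gT_le.
  have -> : sector (gT d) rho = 0.
    transitivity (\int[mu]_(x in `[0, rho]) (0 * gS g x)).
      apply: eq_Rintegral => x; rewrite inE/= in_itv/= => /andP[x0 xr].
      by rewrite w0 ?mulr0 ?mul0r// x0 (le_trans xr).
    rewrite RintegralZl ?mul0r//.
    apply: continuous_compact_integrable; first exact: segment_compact.
    by apply: continuous_subspaceT; exact: continuous_gS.
  by rewrite mul0r mulr_ge0// sector_ge0// ltW.
have [U UE0] : exists U, U = sector (gT d) Rc := ex_intro _ _ erefl.
have [V VE0] : exists V, V = sector (gT r) Rc := ex_intro _ _ erefl.
have U0 : 0 <= U by rewrite UE0; exact: sector_ge0 d1 (ltW Rc0) (lexx _).
have V1 : 0 <= V by rewrite VE0; exact: sector_ge0 r1 (ltW Rc0) (lexx _).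
have Pr0 : 0 <= sector (gT r) rho by exact: sector_ge0 r1 p0 pR.
rewrite -UE0 -VE0; apply: (cross_le U0 V1 Pr0) => l l0 V0 UE.
have lX : slope (gT d) Rc * l <= slope (gT r) Rc.
  by rewrite -(ler_pM2r V0) -mulrA -UE UE0 VE0; exact: sector_slope.
have Xd0 : 0 < slope (gT d) Rc by apply: slope_gt0 => //; exact: gT_incr (ltW d0) dR (lexx _).
have far x : d <= x -> x <= Rc -> l * width (gT r) x <= width (gT d) x.
  move=> dx xR; rewrite -(ler_pM2l Xd0); apply: le_trans (width_slope r0 rd dx xR).
  rewrite mulrA ler_wpM2r// width_ge0// xR andbT; exact: le_trans (ltW d0) dx.
have near_ x : 0 <= x -> x <= d -> width (gT d) x = phi (gT d) Rc.
  move=> x0 xd; have xR := le_trans xd (ltW dR).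
  by rewrite /width [phi _ x]phi0 ?subr0// ?x0//; exact: gT_le (ltW dR).
have int1 tau := @integrable_sector tau rho p0 pR.
have int2 tau : mu.-integrable `]rho, Rc] (EFin \o (fun x => gS g x * width tau x)).
  apply: integrableS (integrable_sector tau (ltW Rc0) (lexx _)) => // x /=.
  by rewrite !in_itv/= => /andP[h ->]; rewrite (le_trans p0 (ltW h)).
(* The totals up to [Rc] agree after scaling by [l], so a comparison of the outer parts gives the
   reverse comparison of the inner ones. *)
have caseA : (forall x, rho < x -> x <= Rc -> l * width (gT r) x <= width (gT d) x) ->
    sector (gT d) rho <= l * sector (gT r) rho.
  move=> h; have : l * annulus (gT r) rho <= annulus (gT d) rho.
    apply: (Rintegral_leZl _ (int2 (gT r)) (int2 (gT d))); first exact: measurable_itv.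
    move=> x; rewrite /= in_itv/= => /andP[px xR]; rewrite mulrCA ler_wpM2l ?h//.
    by rewrite gS_ge0_Rc// (le_trans p0 (ltW px)).
  have := sector_split (gT r) p0 pR; have := sector_split (gT d) p0 pR.
  rewrite -UE0 -VE0 UE; exact: split_le.
have [dp|pd] := leP d rho.
  by apply: caseA => x px xR; apply: far => //; exact: le_trans (ltW px).
have [th|th] := leP (l * width (gT r) rho) (phi (gT d) Rc).
  apply: caseA => x px xR; have [dx|xd] := leP d x; first exact: far.
  have x0 := le_trans p0 (ltW px).
  rewrite near_// ?(ltW xd)//; apply: le_trans th; rewrite ler_wpM2l// width_homo// ltW//.
(* Here [rho] lies before the crossing, so the scaled density for [r] dominates on all of [[0, rho]]
   and the inner parts compare directly. *)
apply: (Rintegral_leZr _ (int1 (gT r)) (int1 (gT d))); first exact: measurable_itv.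
move=> x; rewrite /= in_itv/= => /andP[x0 xp]; rewrite [leRHS]mulrCA ler_wpM2l//.
  by rewrite gS_ge0_Rc// (le_trans xp).
rewrite near_// ?(le_trans xp (ltW pd))// (le_trans (ltW th))// ler_wpM2l//.
by rewrite width_homo.
Qed.

(** The analogue of [sector_ratio] for uncut directions: their angular density is constant, while
    the width for [r] decreases, so that its value at [rho] separates the inner part from the outer
    one. *)
Lemma disk_ratio (r rho : R) : 0 < r -> r <= Rc -> 0 <= rho -> rho <= Rc ->
  (\int[mu]_(x in `[0%R, rho]) gS g x)%R * sector (gT r) Rc <=
  sector (gT r) rho * (\int[mu]_(x in `[0%R, Rc]) gS g x)%R.
Proof.
move=> r0 rR p0 pR.
have r1 : 0 < gT r by apply: gT_gt0; rewrite r0.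
set w := width (gT r) rho.
have w0 : 0 <= w by rewrite width_ge0// p0.
have iS a b : mu.-integrable `[a, b] (EFin \o gS g).
  apply: continuous_compact_integrable; first exact: segment_compact.
  by apply: continuous_subspaceT; exact: continuous_gS.
have iS2 : mu.-integrable `]rho, Rc] (EFin \o gS g).
  apply: integrableS (iS rho Rc) => // x /=.
  by rewrite !in_itv/= => /andP[/ltW -> ->].
have int2 : mu.-integrable `]rho, Rc] (EFin \o (fun x => gS g x * width (gT r) x)).
  apply: integrableS (integrable_sector (gT r) (ltW Rc0) (lexx _)) => // x /=.
  by rewrite !in_itv/= => /andP[h ->]; rewrite (le_trans p0 (ltW h)).
set P := (\int[mu]_(x in `[0, rho]) gS g x).
have := @Rintegral_itvB R _ (BLeft 0) (BRight Rc) rho (iS 0 Rc).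
rewrite !bnd_simp => /(_ p0 pR) /esym/eqP; rewrite eq_sym subr_eq => /eqP ->.
rewrite -/P; set Q := (\int[mu]_(x in `]rho, Rc]) gS g x).
rewrite (sector_split (gT r) p0 pR).
have h1 : w * P <= sector (gT r) rho.
  apply: (Rintegral_leZl _ (iS 0 rho) (integrable_sector (gT r) p0 pR)).
    exact: measurable_itv.
  - move=> x; rewrite /= in_itv/= => /andP[x0 xp]; rewrite mulrC ler_wpM2l//.
      by rewrite gS_ge0_Rc// (le_trans xp).
    by rewrite width_homo.
have h2 : annulus (gT r) rho <= w * Q.
  apply: (Rintegral_leZr _ iS2 int2); first exact: measurable_itv.
  - move=> x; rewrite /= in_itv/= => /andP[/ltW px xR]; rewrite [leRHS]mulrC ler_wpM2l//.
      by rewrite gS_ge0_Rc// (le_trans p0).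
    by rewrite width_homo.
have P0 : 0 <= P.
  apply: Rintegral_ge0 => x /=; rewrite in_itv/= => /andP[x0 xr].
  by rewrite gS_ge0_Rc// (le_trans xr).
have Q0 : 0 <= Q.
  apply: Rintegral_ge0 => x /=; rewrite in_itv/= => /andP[/ltW px xr].
  by rewrite gS_ge0_Rc// (le_trans p0).
exact: split_cross P0 Q0 h1 h2.
Qed.

End Sector.

(** * Points, distances and polar coordinates *)

Section Coordinates.
Variable R : realType.
Implicit Types (g : geometry) (w : R * R * R) (M : set (R * R * R)).
Local Notation mu := (@lebesgue_measure R).
Local Notation mu2 := (@lebesgue_measure R \x @lebesgue_measure R)%E.

Definition entries (v : 'rV[R]_3) : R * R * R := (v 0 0, v 0 1, v 0 ord_max).

(** The Euclidean plane is placed at height 1, so that all three models satisfy the one equation of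
    [on_surface] and their isometries act linearly. *)
Definition coords g : plane_of R g -> R * R * R :=
  match g with
  | Euclidean => fun p : 'rV[R]_2 => (p 0 0, p 0 1, 1)
  | Spherical => fun p : sphere_point R => entries (sval p)
  | Hyperbolic => fun p : hyperboloid_point R => entries (sval p)
  end.

(** The second condition selects the upper sheet; in the Euclidean case it forces the height to be
    1. *)
Definition on_surface g w :=
  gk R g * (w.1.1 ^+ 2 + w.1.2 ^+ 2) + w.2 ^+ 2 = 1 /\ (g = Spherical \/ 0 < w.2).

(* Four times [gS (dist / 2) ^+ 2], in each of the three models. *)
Definition chord g w w' : R :=
  (w.1.1 - w'.1.1) ^+ 2 + (w.1.2 - w'.1.2) ^+ 2 + gk R g * (w.2 - w'.2) ^+ 2.

Lemma sum3 (f : 'I_3 -> R) : \sum_i f i = f 0 + f 1 + f ord_max.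
Proof.
rewrite !big_ord_recr big_ord0 /= add0r; congr (f _ + f _ + f _); exact: val_inj.
Qed.

Lemma sum2 (f : 'I_2 -> R) : \sum_i f i = f 0 + f 1.
Proof. by rewrite !big_ord_recr big_ord0 /= add0r; congr (f _ + f _); exact: val_inj. Qed.

Lemma entries_inj : injective entries.
Proof.
move=> u v [h0 h1 h2]; apply/rowP => i.
case: i => [[|[|[|//]]]] hi.
- by rewrite (_ : Ordinal hi = 0) ?h0//; exact: val_inj.
- by rewrite (_ : Ordinal hi = 1) ?h1//; exact: val_inj.
- by rewrite (_ : Ordinal hi = ord_max) ?h2//; exact: val_inj.
Qed.

Lemma entries_vec3 x y z : entries (vec3 x y z) = (x, y, z).
Proof. by rewrite /entries !mxE. Qed.

Lemma coords_inj g : injective (@coords g).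
Proof.
case: g => p q /=; last 2 first.
- move=> h; have := entries_inj h; case: p q {h} => [p hp] [q hq] /= e.
  by subst q; rewrite (Prop_irrelevance hp hq).
- move=> h; have := entries_inj h; case: p q {h} => [p hp] [q hq] /= e.
  by subst q; rewrite (Prop_irrelevance hp hq).
move=> [h0 h1]; apply/rowP => -[[|[|//]] hi].
- by rewrite (_ : Ordinal hi = 0) ?h0//; exact: val_inj.
- by rewrite (_ : Ordinal hi = 1) ?h1//; exact: val_inj.
Qed.

Lemma coords_surface g (p : plane_of R g) : on_surface g (coords p).
Proof.
case: g p => [p|[p hp]|[p [hp hz]]]; rewrite /on_surface /=.
- by split; [rewrite mul0r add0r expr1n|right].
- split; last by left.
  by move: hp; rewrite /dot sum3 mul1r !expr2.
- split; last by right.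
  by move: hp; rewrite /lorentz mulN1r !expr2; lra.
Qed.

Lemma coords_surj g w : on_surface g w -> exists p : plane_of R g, coords p = w.
Proof.
case: w => [[x y] z]; case: g; rewrite /on_surface /= => -[h1 h2].
- exists (vec2 x y); rewrite !mxE /=; congr (_, _, _).
  by case: h2 => // h2; nra.
- have h : dot (vec3 x y z) (vec3 x y z) = 1.
    by rewrite /dot sum3 !mxE /= -h1; ring.
  by exists (exist _ (vec3 x y z) h); exact: entries_vec3.
- have h : lorentz (vec3 x y z) (vec3 x y z) = -1 /\ 0 < vec3 x y z 0 ord_max.
    rewrite /lorentz !mxE /=; split; last by case: h2.
    by rewrite -h1; ring.
  by exists (exist _ (vec3 x y z) h); exact: entries_vec3.
Qed.

Lemma chordE g w w' : on_surface g w -> on_surface g w' -> g <> Euclidean ->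
  chord g w w' = 2 * gk R g * (1 - (gk R g * (w.1.1 * w'.1.1 + w.1.2 * w'.1.2) + w.2 * w'.2)).
Proof.
case: w w' => [[x y] z] [[x' y'] z']; rewrite /on_surface /chord /=.
by case: g => //= -[h1 _] [h2 _] _; nra.
Qed.

(** The half-angle formula for [gC] puts the three definitions of distance on one footing. *)
Lemma dist_ge0_chord g (p q : plane_of R g) :
  idom g (dist p q) /\ 4 * gS g (dist p q / 2) ^+ 2 = chord g (coords p) (coords q).
Proof.
have hp := coords_surface p; have hq := coords_surface q.
case: g p q hp hq => [p q hp hq|p q hp hq|p q hp hq].
- rewrite /= in_itv/= sqrtr_ge0; split=> //.
  rewrite expr_div_n sqr_sqrtr; last by rewrite /dot sum2 -!expr2 addr_ge0 ?sqr_ge0.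
  by rewrite /dot /chord sum2 /= !mxE; field.
- rewrite chordE//; move: hp hq => /=.
  case: p q => [p hp0] [q hq0] /= [hp _] [hq _].
  have dE : dot p q = p 0 0 * q 0 0 + p 0 1 * q 0 1 + p 0 ord_max * q 0 ord_max by rewrite /dot sum3.
  have d1 : -1 <= dot p q <= 1.
    rewrite dE; move: hp hq; rewrite /entries /=.
    move: (p 0 0) (p 0 1) (p 0 ord_max) (q 0 0) (q 0 1) (q 0 ord_max) => a b c a' b' c' h h'.
    apply/andP; split.
      have := sqr_ge0 (a + a'); have := sqr_ge0 (b + b'); have := sqr_ge0 (c + c'); nra.
    have := sqr_ge0 (a - a'); have := sqr_ge0 (b - b'); have := sqr_ge0 (c - c'); nra.
  split; first by rewrite in_itv/= acos_ge0 ?acos_lepi.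
  have e := acosK (x := dot p q); rewrite in_itv/= in e; have {}e := e d1.
  have := gCD Spherical (acos (dot p q) / 2) (acos (dot p q) / 2).
  have := gC2S2 Spherical (acos (dot p q) / 2).
  rewrite /= -splitr e dE /entries /=; nra.
- rewrite chordE//; move: hp hq => /=.
  case: p q => [p hp0] [q hq0] /= [hp hp'] [hq hq'].
  set L := - lorentz p q.
  have LE : L = p 0 ord_max * q 0 ord_max - (p 0 0 * q 0 0 + p 0 1 * q 0 1).
    by rewrite /L /lorentz; ring.
  (* The reversed Cauchy-Schwarz inequality on the upper sheet. *)
  have L1 : 1 <= L.
    rewrite LE; move: hp hq hp' hq'; rewrite /entries /=.
    move: (p 0 0) (p 0 1) (p 0 ord_max) (q 0 0) (q 0 1) (q 0 ord_max) => a b c a' b' c'.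
    move=> h h' [//|c0] [//|c0'].
    have : (c * c') ^+ 2 = (1 + a ^+ 2 + b ^+ 2) * (1 + a' ^+ 2 + b' ^+ 2).
      by rewrite exprMn; congr (_ * _); lra.
    have cc : 0 < c * c' by rewrite mulr_gt0.
    move: cc; set s := c * c' => cc hs.
    rewrite lerBrDl leNgt; apply/negP => hh.
    have := sqr_ge0 (a - a'); have := sqr_ge0 (b - b'); have := sqr_ge0 (a * b' - a' * b).
    nra.
  split; first by rewrite in_itv/= andbT; exact: arcosh_ge0.
  have e : cosh (arcosh L) = L by exact: arcoshK.
  have := gCD Hyperbolic (arcosh L / 2) (arcosh L / 2).
  have := gC2S2 Hyperbolic (arcosh L / 2).
  rewrite /= -splitr e LE /entries /=; nra.
Qed.

Lemma dist_idom g (p q : plane_of R g) : idom g (dist p q).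
Proof. by have [] := dist_ge0_chord p q. Qed.

Lemma dist_chord g (p q : plane_of R g) :
  4 * gS g (dist p q / 2) ^+ 2 = chord g (coords p) (coords q).
Proof. by have [] := dist_ge0_chord p q. Qed.

Definition turn : set R := `[0, 2 * pi[%classic.

Lemma polar_integral g (P : set (R * R)) : measurable P ->
  (\int[mu2]_(u in (idom g `*` turn) `&` P) (gS g u.1)%:E =
   \int[mu]_(x in idom g) ((gS g x)%:E * circle [set phi | P (x, phi)]))%E.
Proof.
move=> mP; set D := _ `&` P.
have mD : measurable D.
  by apply: measurableI => //; apply: measurableX; [exact: measurable_idom|exact: measurable_itv].
have mS : measurable_fun setT (fun u : R * R => gS g u.1).
  exact: measurableT_comp (measurable_gS g) measurable_fst.
pose h u : \bar R := (\1_D u * gS g u.1)%:E.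
have h0 u : (0 <= h u)%E.
  rewrite /h indicE; case: (boolP (u \in D)) => [/set_mem[[/= /gS_ge0 u1 _] _]|_].
    by rewrite mul1r lee_fin.
  by rewrite mul0r.
have mh : measurable_fun setT h.
  by apply/measurable_EFinP; apply: measurable_funM => //; exact: measurable_indic.
transitivity (\int[mu2]_u h u)%E.
  rewrite integral_mkcond; apply: eq_integral => u _; rewrite patchE /h indicE.
  by case: ifPn => _ /=; rewrite ?mul1r ?mul0r.
transitivity (\int[mu]_x \int[mu]_y h (x, y))%E; first exact: fubini_tonelli1.
rewrite [RHS]integral_mkcond; apply: eq_integral => x _; rewrite patchE.
case: ifPn => [/set_mem Ix|/negP Ix]; last first.
  apply: integral0_eq => y _; rewrite /h indicE memNset ?mul0r// => -[[/= Ix' _] _].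
  by apply: Ix; exact: mem_set.
have -> : circle [set phi | P (x, phi)] = mu (xsection D x).
  rewrite /circle; congr (mu _); apply/seteqP; split => y; rewrite /xsection /=.
    by move=> [hy Py]; apply/mem_set.
  by move=> /set_mem[[/= _ hy] Py].
have mx : measurable (xsection D x) by exact: measurable_xsection.
transitivity ((gS g x)%:E * \int[mu]_y (\1_(xsection D x) y)%:E)%E; last first.
  by rewrite integral_indic// setIT.
rewrite -ge0_integralZl_EFin//.
- by apply: eq_integral => y _; rewrite /h !indicE mem_xsection EFinM muleC.
- by apply/measurable_EFinP; apply: measurable_indic.
- exact: gS_ge0.
Qed.

Lemma polar_surface g x phi : on_surface g (polar g x phi).
Proof.
split=> /=; last first.
  case: g => /=; [by right|by left|right].
  by rewrite divr_gt0// addr_gt0 ?expR_gt0.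
rewrite -(gC2S2 g x) !exprMn -mulrDr addrC.
by congr (_ + _ * _); rewrite cos2Dsin2 mulr1.
Qed.

Lemma area_parea g (A : set (plane_of R g)) M : measurable M ->
  (forall p, A p <-> M (coords p)) -> area A = parea g M.
Proof.
move=> mM AM.
have image (T : Type) (B : set T) (v : T -> 'rV[R]_3) h (u : R * R) :
    (forall p, B p <-> M (entries (v p))) ->
    (exists p, entries (v p) = polar h u.1 u.2) ->
    (v @` B) (vec3 (gS h u.1 * cos u.2) (gS h u.1 * sin u.2) (gC h u.1)) <-> M (polar h u.1 u.2).
  move=> BM [p pw]; split=> [[t Bt tE]|Mw].
    by rewrite /polar -entries_vec3 -tE; exact/BM.
  by exists p; [apply/BM; rewrite pw|apply: entries_inj; rewrite pw entries_vec3].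
case: g A AM => A AM.
(* Euclidean area is given in Cartesian coordinates, which are the axis coordinates of curvature
   0. *)
- rewrite parea_axis//=.
  have mM2 : measurable [set u : R * R | M (u.1, u.2, 1)].
    by apply: measurable_preimage3.
  have -> : [set u | A (vec2 u.1 u.2)] = [set u : R * R | M (u.1, u.2, 1)].
    apply/seteqP; split => u /= ; [move/AM|move=> h; apply/AM]; by rewrite /= !mxE.
  transitivity (\int[mu2]_u (\1_[set u : R * R | M (u.1, u.2, 1%R)] u)%:E)%E.
    by rewrite integral_indic// setIT.
  rewrite fubini_tonelli2//; last first.
    by apply/measurable_EFinP; exact: measurable_indic.
  apply: eq_integral => y _; rewrite mul0r ltr01 setTI /fubini_G.
  have -> : [set psi | M (axis_point Euclidean y psi)] = ysection [set u : R * R | M (u.1, u.2, 1)] y.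
    apply/seteqP; split => x; rewrite /ysection /axis_point /gc /= mul0r subr0 sqrtr1 !mulr1.
      by move=> h; apply/mem_set.
    by move/set_mem.
  transitivity (\int[mu]_x (\1_(ysection [set u : R * R | M (u.1, u.2, 1%R)] y) x)%:E)%E; last first.
    by rewrite integral_indic// ?setIT//; exact: measurable_ysection.
  by apply: eq_integral => x _; rewrite !indicE mem_ysection.
- transitivity (\int[mu2]_(u in (idom Spherical `*` turn) `&`
    [set z : R * R | M (polar Spherical z.1 z.2)]) (gS Spherical u.1)%:E)%E; last first.
    by apply: polar_integral; exact: measurable_polar.
  congr integral; congr (_ `&` _); apply/seteqP; split => u;
    have h := image _ _ _ Spherical u AM (coords_surj (polar_surface Spherical u.1 u.2)).
    by move=> /h.
  by move=> Mu; apply/h.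
- transitivity (\int[mu2]_(u in (idom Hyperbolic `*` turn) `&`
    [set z : R * R | M (polar Hyperbolic z.1 z.2)]) (gS Hyperbolic u.1)%:E)%E; last first.
    by apply: polar_integral; exact: measurable_polar.
  congr integral; congr (_ `&` _); apply/seteqP; split => u;
    have h := image _ _ _ Hyperbolic u AM (coords_surj (polar_surface Hyperbolic u.1 u.2)).
    by move=> /h.
  by move=> Mu; apply/h.
Qed.

Definition rot (t : R) w : R * R * R :=
  (w.1.1 * cos t - w.1.2 * sin t, w.1.1 * sin t + w.1.2 * cos t, w.2).

Definition boost g s w : R * R * R :=
  (gC g s * w.1.1 + gS g s * w.2, w.1.2, - gk R g * gS g s * w.1.1 + gC g s * w.2).

Definition comb3 (a b c : R) u v w : R * R * R :=
  (a * u.1.1 + b * v.1.1 + c * w.1.1, a * u.1.2 + b * v.1.2 + c * w.1.2,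
   a * u.2 + b * v.2 + c * w.2).

Lemma gk3 g : gk R g ^+ 3 = gk R g.
Proof. by case: g => /=; ring. Qed.

Lemma rot_comb3 t a b c u v w :
  rot t (comb3 a b c u v w) = comb3 a b c (rot t u) (rot t v) (rot t w).
Proof. by rewrite /rot /comb3 /=; congr (_, _, _); ring. Qed.

Lemma boost_comb3 g s a b c u v w :
  boost g s (comb3 a b c u v w) = comb3 a b c (boost g s u) (boost g s v) (boost g s w).
Proof. by rewrite /boost /comb3 /=; congr (_, _, _); ring. Qed.

Lemma rotN t w : rot (- t) (rot t w) = w.
Proof.
case: w => [[x y] z]; rewrite /rot /= cosN sinN; have := cos2Dsin2 t => e.
congr (_, _, _).
  transitivity (x * (cos t ^+ 2 + sin t ^+ 2)); [ring|by rewrite e mulr1].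
transitivity (y * (cos t ^+ 2 + sin t ^+ 2)); [ring|by rewrite e mulr1].
Qed.

Lemma boostN g s w : boost g (- s) (boost g s w) = w.
Proof.
case: w => [[x y] z]; rewrite /boost /= gCN gSN; have := gC2S2 g s => e.
congr (_, _, _).
  transitivity (x * (gC g s ^+ 2 + gk R g * gS g s ^+ 2)); [ring|by rewrite e mulr1].
transitivity (z * (gC g s ^+ 2 + gk R g * gS g s ^+ 2)); [ring|by rewrite e mulr1].
Qed.

Lemma rot_surface g t w : on_surface g w -> on_surface g (rot t w).
Proof.
case: w => [[x y] z]; rewrite /on_surface /= => -[h1 h2]; split=> //.
rewrite -h1; congr (_ * _ + _).
transitivity ((x ^+ 2 + y ^+ 2) * (cos t ^+ 2 + sin t ^+ 2)); first by ring.
by rewrite cos2Dsin2 mulr1.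
Qed.

Lemma cosh_gt0 x : 0 < cosh x :> R.
Proof. by rewrite divr_gt0// addr_gt0 ?expR_gt0. Qed.

Lemma boost_surface g s w : on_surface g w -> on_surface g (boost g s w).
Proof.
case: w => [[x y] z]; rewrite /on_surface /= => -[h1 h2].
split.
  rewrite -h1; have := gC2S2 g s; have := gk3 g; set C := gC g s; set S := gS g s; set k := gk R g.
  move=> k3 CS; transitivity (k * y ^+ 2 + k * x ^+ 2 * (C ^+ 2 + k * S ^+ 2) + z ^+ 2 * (C ^+ 2 + k * S ^+ 2)).
    by ring.
  by rewrite CS; ring.
case: h2 => [->|z0]; [by left|case: g h1 => /=; [|by left|]]; move=> h1; right.
  by rewrite oppr0 !mul0r add0r mul1r.
have c0 := cosh_gt0 s; have := cosh2B s => cs.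
rewrite opprK mul1r.
have a : (cosh s * z) ^+ 2 = (1 + sinh s ^+ 2) * (1 + x ^+ 2 + y ^+ 2).
  by rewrite exprMn; congr (_ * _); lra.
have b : 0 < cosh s * z by rewrite mulr_gt0.
have : (sinh s * x) ^+ 2 < (cosh s * z) ^+ 2.
  rewrite a exprMn; have := sqr_ge0 (sinh s); have := sqr_ge0 x; have := sqr_ge0 y.
  move: (sinh s ^+ 2) (x ^+ 2) (y ^+ 2) => A B D; nra.
move=> h; have : `|sinh s * x| < cosh s * z.
  by rewrite -[X in _ < X]ger0_norm ?(ltW b)// -ltr_sqr ?nnegrE// !real_normK ?num_real.
by rewrite ltr_norml => /andP[h' _]; lra.
Qed.

Lemma rot_chord g t w w' : chord g (rot t w) (rot t w') = chord g w w'.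
Proof.
case: w w' => [[x y] z] [[x' y'] z']; rewrite /chord /=; congr (_ + _).
transitivity (((x - x') ^+ 2 + (y - y') ^+ 2) * (cos t ^+ 2 + sin t ^+ 2)); first by ring.
by rewrite cos2Dsin2 mulr1.
Qed.

Lemma boost_chord g s w w' : on_surface g w -> on_surface g w' ->
  chord g (boost g s w) (boost g s w') = chord g w w'.
Proof.
case: w w' => [[x y] z] [[x' y'] z']; rewrite /on_surface /chord /=.
move=> [h1 p1] [h2 p2]; have := gC2S2 g s.
case: g h1 h2 p1 p2 => /= h1 h2 p1 p2 cs.
- have -> : z = 1 by case: p1 => // p1; nra.
  have -> : z' = 1 by case: p2 => // p2; nra.
  by ring.
- transitivity ((y - y') ^+ 2 + ((x - x') ^+ 2 + (z - z') ^+ 2) * (cos s ^+ 2 + 1 * sin s ^+ 2)).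
    by ring.
  by rewrite cs; ring.
- transitivity ((y - y') ^+ 2 + ((x - x') ^+ 2 - (z - z') ^+ 2) * (cosh s ^+ 2 + -1 * sinh s ^+ 2)).
    by ring.
  by rewrite cs; ring.
Qed.

(** The law of cosines in half-distance form, which has the same shape in the three geometries. *)
Lemma polar_chord g x y phi psi : chord g (polar g x phi) (polar g y psi) =
  4 * gS g ((x - y) / 2) ^+ 2 + 2 * gS g x * gS g y * (1 - cos (phi - psi)).
Proof.
pose a := (x + y) / 2; pose b := (x - y) / 2.
have xE : x = a + b by rewrite /a /b; field.
have yE : y = a - b by rewrite /a /b; field.
have e : (gS g x - gS g y) ^+ 2 + gk R g * (gC g x - gC g y) ^+ 2 = 4 * gS g b ^+ 2.
  rewrite xE yE gSD gSB gCD gCB.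
  transitivity (4 * gS g b ^+ 2 * (gC g a ^+ 2 + gk R g ^+ 3 * gS g a ^+ 2)); first by ring.
  by rewrite gk3 gC2S2 mulr1.
rewrite -/b -e cosB /chord /polar /=.
transitivity (gS g x ^+ 2 * (cos phi ^+ 2 + sin phi ^+ 2) +
  gS g y ^+ 2 * (cos psi ^+ 2 + sin psi ^+ 2) -
  2 * gS g x * gS g y * (cos phi * cos psi + sin phi * sin psi) +
  gk R g * (gC g x - gC g y) ^+ 2); first by ring.
by rewrite !cos2Dsin2; ring.
Qed.

Lemma unit_circle (a b : R) : a ^+ 2 + b ^+ 2 = 1 ->
  exists phi : R, 0 <= phi < 2 * pi /\ cos phi = a /\ sin phi = b.
Proof.
move=> h; have pi0 := pi_gt0 R.
have a1 : -1 <= a <= 1 by apply/andP; split; nra.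
have [p0 p1] := andP (proj1 (acos_def a1)); have cE := proj2 (acos_def a1).
have sE : sin (acos a) = `|b|.
  by rewrite sin_acos// -sqrtr_sqr; congr Num.sqrt; lra.
have [b0|b0] := leP 0 b.
  exists (acos a); split; first by apply/andP; split=> //; lra.
  by rewrite sE ger0_norm.
have p2 : 0 < acos a.
  rewrite lt0r p0 andbT; apply: contraTneq b0 => a0.
  by move: sE; rewrite a0 sin0 => /esym/normr0_eq0 ->; rewrite ltxx.
exists (2 * pi - acos a); split; first by apply/andP; split; lra.
have -> : 2 * pi - acos a = - acos a + 2 * pi by ring.
by rewrite cos_period sin_period cosN sinN sE cE ltr0_norm// opprK.
Qed.

Lemma polar_surj g w : on_surface g w ->
  exists x phi, [/\ idom g x, 0 <= phi < 2 * pi & polar g x phi = w].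
Proof.
case: w => [[a b] z] hw.
have [x [Ix [xS xC]]] : exists x, idom g x /\ gS g x ^+ 2 = a ^+ 2 + b ^+ 2 /\ gC g x = z.
  have r0 : 0 <= a ^+ 2 + b ^+ 2 by rewrite addr_ge0 ?sqr_ge0.
  move: hw; rewrite /on_surface /=; case: (g) => /= -[h1 h2].
  - exists (Num.sqrt (a ^+ 2 + b ^+ 2)); rewrite in_itv/= sqrtr_ge0 sqr_sqrtr//.
    by split=> //; split=> //; case: h2 => // h2; nra.
  - have z1 : -1 <= z <= 1 by apply/andP; split; nra.
    exists (acos z); have [p cE] := acos_def z1; rewrite in_itv/= p; split=> //; split=> //.
    by have := cos2Dsin2 (acos z); rewrite cE; lra.
  - have z1 : 1 <= z by case: h2 => // h2; nra.
    exists (arcosh z); rewrite in_itv/= andbT; have cE := arcoshK z1.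
    split; first exact: arcosh_ge0.
    by split=> //; have := cosh2B (arcosh z); rewrite cE; lra.
have s0 := gS_ge0 Ix; set s := gS g x in xS s0.
have [e|sN] := eqVneq s 0.
  exists x, 0; split=> //; first by rewrite lexx/= mulr_gt0// pi_gt0.
  have [-> ->] : a = 0 /\ b = 0 by rewrite e in xS; split; nra.
  by rewrite /polar -/s e !mul0r xC.
have [phi [hphi [cE sE]]] : exists phi, 0 <= phi < 2 * pi /\ cos phi = a / s /\ sin phi = b / s.
  by apply: unit_circle; rewrite !expr_div_n -mulrDl -xS divff// expf_neq0.
exists x, phi; split=> //.
by rewrite /polar -/s cE sE xC ![s * _]mulrC !divfK.
Qed.

(** On the sphere, halving brings distances into [[0, pi / 2]], where the sine increases. Distances
    can therefore be compared through chords. *)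
Lemma half_lt g (x y : R) : idom g x -> idom g y -> x < y -> gS g (x / 2) < gS g (y / 2).
Proof.
move=> /idomP[x0 hx] /idomP[y0 hy] xy; rewrite -subr_gt0.
have -> : x / 2 = (x + y) / 4 - (y - x) / 4 by field.
have -> : y / 2 = (x + y) / 4 + (y - x) / 4 by field.
rewrite gSB gSD; have -> : forall a b c d : R, a * b + c * d - (a * b - c * d) = 2 * (c * d).
  by move=> *; ring.
have pi0 := pi_gt0 R.
rewrite mulr_gt0// mulr_gt0//.
  by apply: gC_gt0; [lra|move=> gE; have := hx gE; have := hy gE; lra].
by apply: gS_gt0; [lra|move=> gE; have := hx gE; have := hy gE; lra].
Qed.

Lemma half_ge0 g (x : R) : idom g x -> 0 <= gS g (x / 2).
Proof.
move=> /idomP[x0 hx]; apply: gS_ge0; apply/idomP; split; first lra.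
by move=> /hx; lra.
Qed.

Lemma half_sqr_le g (x y : R) : idom g x -> idom g y ->
  (x <= y) = (gS g (x / 2) ^+ 2 <= gS g (y / 2) ^+ 2).
Proof.
move=> Ix Iy; rewrite ler_pXn2r ?nnegrE ?half_ge0//.
case: (ltgtP x y) => [xy|yx|->]; last by rewrite lexx.
  by rewrite ltW// half_lt.
by apply/esym/negbTE; rewrite -ltNge half_lt.
Qed.

Lemma half_sqr_inj g (x y : R) : idom g x -> idom g y ->
  gS g (x / 2) ^+ 2 = gS g (y / 2) ^+ 2 -> x = y.
Proof. by move=> Ix Iy e; apply/le_anti; rewrite (half_sqr_le Ix Iy) (half_sqr_le Iy Ix) e lexx. Qed.

Lemma dist_le_chord g (a b c d : plane_of R g) :
  (dist a b <= dist c d) = (chord g (coords a) (coords b) <= chord g (coords c) (coords d)).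
Proof. by rewrite (half_sqr_le (dist_idom a b) (dist_idom c d)) -(dist_chord a b) -(dist_chord c d) ler_pM2l. Qed.

Lemma chord_sym g w w' : chord g w w' = chord g w' w.
Proof. by rewrite /chord; ring. Qed.

Lemma dist_sym g (a b : plane_of R g) : dist a b = dist b a.
Proof. by apply/le_anti; rewrite !dist_le_chord chord_sym lexx. Qed.

Lemma dist_ge0 g (a b : plane_of R g) : 0 <= dist a b.
Proof. by have /idomP[] := dist_idom a b. Qed.

(* Measurability in the ambient coordinates, on which isometries act linearly. *)
Definition borel g (A : set (plane_of R g)) :=
  exists2 M, measurable M & forall p, A p <-> M (coords p).

Lemma measurable_chord g w : measurable_fun setT (fun v => chord g v w).
Proof.
have m1 : measurable_fun setT (fun v : R * R * R => v.1.1).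
  exact: measurableT_comp measurable_fst measurable_fst.
have m2 : measurable_fun setT (fun v : R * R * R => v.1.2).
  exact: measurableT_comp measurable_snd measurable_fst.
have m3 : measurable_fun setT (fun v : R * R * R => v.2) by exact: measurable_snd.
apply: measurable_funD; first apply: measurable_funD.
- by apply: measurable_funX; apply: measurable_funB.
- by apply: measurable_funX; apply: measurable_funB.
- by apply: measurable_funM => //; apply: measurable_funX; apply: measurable_funB.
Qed.

Lemma borel_le g (a b : plane_of R g) : borel [set p | dist p a <= dist p b].
Proof.
exists [set v | chord g v (coords a) <= chord g v (coords b)].
  by apply: measurable_set_ler; exact: measurable_chord.
by move=> p /=; rewrite dist_le_chord.
Qed.

Lemma borel_lt g (a b : plane_of R g) : borel [set p | dist p a < dist p b].
Proof.
exists [set v | chord g v (coords a) < chord g v (coords b)].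
  by apply: measurable_set_ltr; exact: measurable_chord.
by move=> p /=; rewrite !ltNge dist_le_chord.
Qed.

Lemma borelT g : borel (@setT (plane_of R g)).
Proof. by exists setT. Qed.

Lemma borel_ball g (a : plane_of R g) rho : borel [set p | dist a p <= rho].
Proof.
have [rho0|rho0] := ltP rho 0.
  exists set0 => // p; split=> //= h; have := dist_ge0 a p; lra.
have [I|I] := pselect (idom g rho).
  exists [set v | chord g v (coords a) <= 4 * gS g (rho / 2) ^+ 2].
    by apply: measurable_set_ler => //; exact: measurable_chord.
  by move=> p /=; rewrite (half_sqr_le (dist_idom a p) I) chord_sym -dist_chord ler_pM2l.
(* The remaining case is a spherical radius above [pi], for which the disk is the whole sphere. *)
exists setT => // p; split=> // _ /=.
have /idomP[_ h] := dist_idom a p; rewrite leNgt; apply/negP => pr.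
by apply: I; apply/idomP; split=> // /h; lra.
Qed.

Lemma borelI g (A B : set (plane_of R g)) : borel A -> borel B -> borel (A `&` B).
Proof.
move=> [M mM AM] [N mN BN]; exists (M `&` N); first exact: measurableI.
by move=> p /=; rewrite AM BN.
Qed.

Lemma borelU g (A B : set (plane_of R g)) : borel A -> borel B -> borel (A `|` B).
Proof.
move=> [M mM AM] [N mN BN]; exists (M `|` N); first exact: measurableU.
by move=> p /=; rewrite AM BN.
Qed.

Lemma borel_bigcap g (A : nat -> set (plane_of R g)) :
  (forall n, borel (A n)) -> borel (\bigcap_n A n).
Proof.
move=> hA; have {}hA n : exists M, measurable M /\ forall p, A n p <-> M (coords p).
  by have [M ? ?] := hA n; exists M.
have [M hM] := choice hA; exists (\bigcap_n M n).
  by apply: bigcap_measurableType => n _; have [] := hM n.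
by move=> p; split=> h n _; apply/(proj2 (hM n)); exact: h.
Qed.

Lemma measurable_rot t M : measurable M -> measurable [set w | M (rot t w)].
Proof.
have m1 : measurable_fun setT (fun v : R * R * R => v.1.1).
  exact: measurableT_comp measurable_fst measurable_fst.
have m2 : measurable_fun setT (fun v : R * R * R => v.1.2).
  exact: measurableT_comp measurable_snd measurable_fst.
by move=> mM; apply: measurable_preimage3 => //;
  [apply: measurable_funB|apply: measurable_funD]; exact: measurable_funM.
Qed.

Lemma measurable_boost g s M : measurable M -> measurable [set w | M (boost g s w)].
Proof.
have m1 : measurable_fun setT (fun v : R * R * R => v.1.1).
  exact: measurableT_comp measurable_fst measurable_fst.
have m2 : measurable_fun setT (fun v : R * R * R => v.1.2).
  exact: measurableT_comp measurable_snd measurable_fst.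
by move=> mM; apply: measurable_preimage3 => //;
  apply: measurable_funD; apply: measurable_funM.
Qed.

(* [E x phi] is the point with geodesic polar coordinates [x] and [phi] around [q]. *)
Definition is_chart g (q : plane_of R g) (E : R -> R -> plane_of R g) :=
  exists t s, [/\ idom g s, 0 <= t <= 2 * pi, coords q = rot t (boost g s (0, 0, 1)) &
    forall x phi, coords (E x phi) = rot t (boost g s (polar g x phi))].

Lemma chart_exists g (q : plane_of R g) : exists E, is_chart q E.
Proof.
have [s [t [Is /andP[t0 t2] tE]]] := polar_surj (coords_surface q).
have hE x phi := coords_surj (rot_surface t (boost_surface s (polar_surface g x phi))).
have [E EE] : exists E : R -> R -> plane_of R g,
    forall x phi, coords (E x phi) = rot t (boost g s (polar g x phi)).
  by exists (fun x phi => sval (cid (hE x phi))) => x phi; exact: svalP (cid (hE x phi)).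
exists E, t, s; split=> //; first by rewrite t0 ltW.
by rewrite -tE /polar /rot /boost /=; congr (_, _, _); ring.
Qed.

(** * Geodesic polar coordinates around an arbitrary point *)

Section Chart.
Variables (g : geometry) (q : plane_of R g) (E : R -> R -> plane_of R g).
Hypothesis chartE : is_chart q E.

Lemma chart_surj p : exists x phi, [/\ idom g x, 0 <= phi < 2 * pi & p = E x phi].
Proof.
have [t [s [Is ht qE EE]]] := chartE.
have h := boost_surface (- s) (rot_surface (- t) (coords_surface p)).
have [x [phi [Ix hp e]]] := polar_surj h.
exists x, phi; split=> //; apply: coords_inj; rewrite EE e.
have := boostN g (- s) (rot (- t) (coords p)); rewrite opprK => ->.
by have := rotN (- t) (coords p); rewrite opprK => ->.
Qed.

Lemma chart0 phi : E 0 phi = q.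
Proof.
have [t [s [Is ht qE EE]]] := chartE.
by apply: coords_inj; rewrite EE qE /polar gS0 gC0 !mul0r.
Qed.

Lemma chart_chord x y phi psi : 4 * gS g (dist (E x phi) (E y psi) / 2) ^+ 2 =
  4 * gS g ((x - y) / 2) ^+ 2 + 2 * gS g x * gS g y * (1 - cos (phi - psi)).
Proof.
have [t [s [Is ht qE EE]]] := chartE.
rewrite dist_chord !EE rot_chord boost_chord; try exact: polar_surface.
exact: polar_chord.
Qed.

Lemma chart_dist0 x phi : idom g x -> dist q (E x phi) = x.
Proof.
move=> Ix; apply: (half_sqr_inj (dist_idom _ _) Ix).
have := chart_chord 0 x phi phi; rewrite chart0 gS0 mulr0 !mul0r addr0 sub0r mulNr gSN sqrrN.
exact: mulfI.
Qed.

(** The chart around [q] is the fixed polar chart moved by a boost and a rotation, and both preserve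
    area. *)
Lemma chart_area A : borel A ->
  area A = (\int[mu]_(x in idom g) ((gS g x)%:E * circle [set phi | A (E x phi)]))%E.
Proof.
move=> [M mM AM]; have [t [s [Is ht qE EE]]] := chartE.
rewrite (area_parea mM AM) -(parea_rot g mM ht).
transitivity (parea g [set w | [set w | M (rot t w)] (boost g s w)]); last first.
  apply: eq_integral => x _; congr (_ * circle _)%E.
  by apply/seteqP; split => phi /=; rewrite AM EE.
exact/esym/(parea_boost (measurable_rot t mM) Is).
Qed.

Lemma measurable_chart A : borel A -> measurable [set u : R * R | A (E u.1 u.2)].
Proof.
move=> [M mM AM]; have [t [s [Is ht qE EE]]] := chartE.
have -> : [set u : R * R | A (E u.1 u.2)] =
  [set u | [set w | M (rot t (boost g s w))] (polar g u.1 u.2)].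
  by apply/seteqP; split => u /=; rewrite AM EE.
exact: (measurable_polar g (measurable_boost g s (measurable_rot t mM))).
Qed.

Lemma measurable_slice A x : borel A -> measurable [set phi | A (E x phi)].
Proof.
move=> /measurable_chart mA; rewrite (_ : [set _ | _] = xsection [set u | A (E u.1 u.2)] x).
  exact: measurable_xsection.
by apply/seteqP; split => phi; rewrite /xsection /=; [move=> h; apply/mem_set|move/set_mem].
Qed.

Lemma measurable_circle A : borel A ->
  measurable_fun setT (fun x => circle [set phi | A (E x phi)]).
Proof.
move=> /measurable_chart mA.
have mD : measurable ([set u | A (E u.1 u.2)] `&` (setT `*` turn)).
  by apply: measurableI => //; apply: measurableX => //; exact: measurable_itv.
have := measurable_fun_xsection mu mD; apply: eq_measurable_fun => x _ /=.
congr (mu _); apply/seteqP; split => phi; rewrite /xsection /=.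
  by move/set_mem => [? [_ ?]].
by move=> [? ?]; apply/mem_set.
Qed.

Lemma chart_period x phi : E x (phi + 2 * pi) = E x phi.
Proof.
have [t [s [Is ht qE EE]]] := chartE.
by apply: coords_inj; rewrite !EE polar_period.
Qed.

End Chart.

Lemma gS_double g (d : R) : gS g (2 * d) = 2 * gS g d * gC g d.
Proof. by rewrite mulr_natl mulr2n gSD; ring. Qed.

Lemma gC_double g (d : R) : gC g (2 * d) = gC g d ^+ 2 - gk R g * gS g d ^+ 2.
Proof. by rewrite mulr_natl mulr2n gCD; ring. Qed.

(** The law of cosines for opposite directions. Since [-1] is the least cosine, it yields the
    triangle inequality. *)
Lemma half_sum g (x y : R) :
  4 * gS g ((x + y) / 2) ^+ 2 = 4 * gS g ((x - y) / 2) ^+ 2 + 4 * (gS g x * gS g y).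
Proof.
have xE : x = 2 * (x / 2) by field.
have yE : y = 2 * (y / 2) by field.
have -> : (x + y) / 2 = x / 2 + y / 2 by field.
have -> : (x - y) / 2 = x / 2 - y / 2 by field.
have -> : gS g x * gS g y = gS g (2 * (x / 2)) * gS g (2 * (y / 2)) by rewrite -xE -yE.
rewrite !gS_double (gSB g (x / 2) (y / 2)) (gSD g (x / 2) (y / 2)); ring.
Qed.

Lemma dist_triangle g (a b c : plane_of R g) : dist a c <= dist a b + dist b c.
Proof.
have [E chE] := chart_exists b.
have [x [phi [Ix _ ->]]] := chart_surj chE a.
have [y [psi [Iy _ ->]]] := chart_surj chE c.
rewrite dist_sym [dist _ b]dist_sym dist_sym !(chart_dist0 chE)//.
have x0 : 0 <= x by case/idomP: Ix.
have y0 : 0 <= y by case/idomP: Iy.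
have [I|I] := pselect (idom g (x + y)); last first.
  (* If [x + y] exceeds the diameter of the sphere, there is nothing to prove. *)
  rewrite leNgt; apply/negP => h; apply: I; apply/idomP; split; first lra.
  by move=> gE; have /idomP[_ /(_ gE)] := dist_idom (E x phi) (E y psi); lra.
rewrite (half_sqr_le (dist_idom _ _) I) -(@ler_pM2l _ 4)// (chart_chord chE).
have s0 : 0 <= gS g x * gS g y by rewrite mulr_ge0 ?gS_ge0.
have c1 := cos_geN1 (phi - psi).
by rewrite (half_sum g x y) lerD2l; nra.
Qed.

(** The difference of two laws of cosines. Where [gC] is positive, its sign is that of
    [gT d - gT x * cos (phi - psi)], the equation of the line at distance [d] from [q]; without the
    division it also covers [d = pi / 2]. *)
Lemma chart_bisector g (q : plane_of R g) E x d phi psi : is_chart q E ->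
  gS g (dist (E x phi) (E (2 * d) psi) / 2) ^+ 2 - gS g (dist (E x phi) q / 2) ^+ 2 =
  gS g d * (gC g x * gS g d - gS g x * gC g d * cos (phi - psi)).
Proof.
move=> chE.
have e1 := chart_chord chE x 0 phi 0; rewrite (chart0 chE 0) gS0 mulr0 mul0r addr0 subr0 in e1.
have e2 := chart_chord chE x (2 * d) phi psi.
move: e1 e2; move: (gS g (dist (E x phi) q / 2) ^+ 2) => a.
move: (gS g (dist (E x phi) (E (2 * d) psi) / 2) ^+ 2) => b e1 e2.
apply: (@mulfI _ 4) => //; rewrite mulrBr e1 e2 => {e1 e2}.
have -> : (x - 2 * d) / 2 = x / 2 - d by field.
have xE : 2 * (x / 2) = x by field.
have sx := gS_double g (x / 2); have cx := gC_double g (x / 2).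
rewrite xE in sx cx; rewrite sx cx gS_double (gSB g (x / 2) d) => {sx cx}; have := gC2S2 g d.
move: (gS g (x / 2)) (gC g (x / 2)) (gS g d) (gC g d) (cos _) (gk R g) => S C s c z k h.
have h0 : 4 * S ^+ 2 * (c ^+ 2 + k * s ^+ 2 - 1) = 0 by rewrite h subrr mulr0.
apply: subr0_eq; rewrite -[RHS]h0; ring.
Qed.

Lemma chart_half_plane g (q : plane_of R g) E x d phi psi : is_chart q E ->
  0 < d -> (g = Spherical -> d < pi) ->
  (dist (E x phi) q <= dist (E x phi) (E (2 * d) psi)) =
  (gS g x * gC g d * cos (phi - psi) <= gC g x * gS g d).
Proof.
move=> chE d0 dpi; have s0 : 0 < gS g d by exact: gS_gt0.
rewrite (half_sqr_le (dist_idom _ _) (dist_idom _ _)) -subr_ge0 (chart_bisector _ _ _ _ chE).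
by rewrite pmulr_rge0// subr_ge0.
Qed.

Lemma chart_half_plane_lt g (q : plane_of R g) E x d phi psi : is_chart q E ->
  0 < d -> (g = Spherical -> d < pi) ->
  (dist (E x phi) q < dist (E x phi) (E (2 * d) psi)) =
  (gS g x * gC g d * cos (phi - psi) < gC g x * gS g d).
Proof.
move=> chE d0 dpi; have s0 : 0 < gS g d by exact: gS_gt0.
rewrite ltNge (half_sqr_le (dist_idom _ _) (dist_idom _ _)) -ltNge -subr_gt0.
by rewrite (chart_bisector _ _ _ _ chE) pmulr_rgt0// subr_gt0.
Qed.

(* Otherwise the midpoint is interior to both disks. *)
Lemma interior_disjoint_dist g (a b : plane_of R g) r : 0 < r ->
  metric_interior (body (Disk a r)) `&` metric_interior (body (Disk b r)) = set0 ->
  2 * r <= dist a b.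
Proof.
move=> r0 h; rewrite leNgt; apply/negP => ab.
have [E chE] := chart_exists a.
have [x [psi [Ix _ bE]]] := chart_surj chE b.
have xE : dist a b = x by rewrite bE (chart_dist0 chE).
have x0 : 0 <= x by case/idomP: Ix.
have Ix2 : idom g (x / 2).
  by apply/idomP; split; [lra|case/idomP: Ix => _ h' /h'; lra].
pose m := E (x / 2) psi.
have am : dist a m = x / 2 by exact: (chart_dist0 chE).
have bm : dist b m = x / 2.
  apply: (half_sqr_inj (dist_idom _ _) Ix2); apply: (@mulfI _ 4) => //.
  rewrite bE (chart_chord chE) subrr cos0 subrr mulr0 addr0.
  by congr (_ * gS g _ ^+ 2); field.
have : set0 m.
  rewrite -h; split; exists (r - x / 2); rewrite ?subr_gt0; try lra.
    by move=> y my; rewrite /body /=; have := dist_triangle a m y; lra.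
  by move=> y my; rewrite /body /=; have := dist_triangle b m y; lra.
by [].
Qed.

(* Each cube of a grid of side [e] contains at most one point. *)
Lemma separated_countable g (A : set (plane_of R g)) e : 0 < e ->
  (forall a b, A a -> A b -> a <> b -> 3 * e ^+ 2 < chord g (coords a) (coords b)) ->
  countable A.
Proof.
move=> e0 sep; apply/countable_injP.
pose f (w : R * R * R) := (Num.floor (w.1.1 / e), Num.floor (w.1.2 / e), Num.floor (w.2 / e)).
exists (fun p => pickle (f (coords p))) => a b /set_mem Aa /set_mem Ab /(pcan_inj pickleK).
case=> h1 h2 h3; apply: contrapT => /(sep _ _ Aa Ab); apply/negP; rewrite -leNgt.
have close x y : Num.floor (x / e) = Num.floor (y / e) -> (x - y) ^+ 2 <= e ^+ 2.
  move=> xy; have /andP[x1 x2] := floor_itv (x / e); have /andP[y1 y2] := floor_itv (y / e).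
  have h : -1 <= x / e - y / e <= 1.
    by rewrite xy in x1 x2; rewrite intrD in x2 y2; apply/andP; split; lra.
  have -> : x - y = (x / e - y / e) * e by rewrite mulrBl !divfK ?gt_eqF.
  by rewrite exprMn ler_piMl ?sqr_ge0//; case/andP: h => ? ?; nra.
have := close _ _ h1; have := close _ _ h2; have := close _ _ h3; rewrite /chord.
set X := (_ - _) ^+ 2; set Y := (_ - _) ^+ 2; set Z := (_ - _) ^+ 2 => hZ hY hX.
have : 0 <= X by exact: sqr_ge0.
by case: (g) => /=; lra.
Qed.

Lemma double_le_dist g d (a b : plane_of R g) : idom g (2 * d) ->
  (2 * d <= dist a b) = (4 * gS g d ^+ 2 <= chord g (coords a) (coords b)).
Proof.
move=> Id; rewrite -(dist_chord a b) (half_sqr_le Id (dist_idom a b)).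
have -> : 2 * d / 2 = d by field.
by move: (gS g (dist a b / 2) ^+ 2) => u; rewrite ler_pM2l.
Qed.

(** Centres are separated, hence countable. Indexing the neighbours by a set of naturals allows the
    arcs that they cut to be summed as a series. *)
Lemma packing_centers g r (F : set (disk (plane_of R g))) B :
  0 < r -> (g = Spherical -> r < pi / 2) -> (forall D, F D -> disk_radius D = r) ->
  packing F -> F B ->
  exists (J : set nat) (c : nat -> plane_of R g),
  [/\ forall n, J n -> 2 * r <= dist (disk_center B) (c n),
      forall n m, J n -> J m -> n <> m -> 2 * r <= dist (c n) (c m) &
      forall x, voronoi_cell F B x <->
        forall n, J n -> dist x (disk_center B) <= dist x (c n)].
Proof.
move=> r0 rpi Fr packF FB; set q := disk_center B.
have sep D D' : F D -> F D' -> D <> D' -> 2 * r <= dist (disk_center D) (disk_center D').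
  move=> FD FD' /(packF _ _ FD FD'); have := Fr _ FD; have := Fr _ FD'.
  by case: D D' {FD FD'} => a ra [b rb] /= -> ->; exact: interior_disjoint_dist.
pose A := [set p | exists D, [/\ F D, D <> B & disk_center D = p]].
have Asep a b : A a -> A b -> a <> b -> 2 * r <= dist a b.
  move=> [D [FD _ <-]] [D' [FD' _ <-]] DD'; apply: sep => // DE.
  by apply: DD'; rewrite DE.
have s0 : 0 < gS g r by apply: gS_gt0 => // /rpi; have := pi_gt0 R; lra.
have Ir : idom g (2 * r) by apply/idomP; split; [lra|move=> /rpi; lra].
have /countable_injP[f finj] : countable A.
  apply: (separated_countable s0) => a b Aa Ab /(Asep _ _ Aa Ab).
  rewrite double_le_dist//; apply: lt_le_trans.
  by rewrite ltr_pM2r ?exprn_gt0//; lra.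
pose J := f @` A.
have hc n : exists p, J n -> A p /\ f p = n.
  have [[p Ap pn]|nJ] := pselect (J n); first by exists p.
  by exists q => /nJ.
have [c hcE] := choice hc; exists J, c; split.
- move=> n /hcE[[D [FD DB <-]] _]; apply: sep => //; exact/nesym.
- move=> n m /hcE[An fn] /hcE[Am fm] nm; apply: Asep => // e.
  by apply: nm; rewrite -fn -fm e.
- move=> x; split=> [Vx n /hcE[[D [FD _ <-]] _]|h D FD]; first exact: Vx.
  have [->|DB] := pselect (D = B); first exact: lexx.
  have AD : A (disk_center D) by exists D.
  have Jn : J (f (disk_center D)) by exists (disk_center D).
  have [Ac fc] := hcE _ Jn.
  have <- : c (f (disk_center D)) = disk_center D by apply: finj => //; exact/mem_set.
  exact: h.
Qed.

(** * The Voronoi cell inside the circumscribed disk *)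

Lemma cos_abs (u : R) : cos `|u| = cos u.
Proof. by have [u0|u0] := leP 0 u; [rewrite ger0_norm|rewrite ltr0_norm// cosN]. Qed.

Lemma cos_lt_pi (a b : R) : 0 <= a <= pi -> 0 <= b <= pi -> (cos b < cos a) = (a < b).
Proof. by move=> ha hb; rewrite ltr_cos// in_itv. Qed.

Lemma mu_oo (a b : R) : a <= b -> mu `]a, b[ = (b - a)%:E.
Proof.
rewrite le_eqVlt => /predU1P[->|ab]; first by rewrite lebesgue_measure_itv/= ltxx subrr.
by rewrite lebesgue_measure_itv/= lte_fin ab EFinB.
Qed.

Lemma mu_cc (a b : R) : a <= b -> mu `[a, b] = (b - a)%:E.
Proof.
rewrite le_eqVlt => /predU1P[->|ab]; first by rewrite lebesgue_measure_itv/= ltxx subrr.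
by rewrite lebesgue_measure_itv/= lte_fin ab EFinB.
Qed.

(** The set is only sandwiched between its open and closed descriptions, as endpoints are null.
    After a rotation taking [psi] to 0, the window [[- pi, pi[] turns the cosine conditions into
    [eta < |u| < theta]. *)
Lemma circle_arc (eta theta psi : R) (P : set R) : measurable P ->
  0 <= eta -> eta <= theta -> theta <= pi -> 0 <= psi < 2 * pi ->
  (forall phi, P (phi + 2 * pi) <-> P phi) ->
  (forall phi, cos theta < cos (phi - psi) < cos eta -> P phi) ->
  (forall phi, P phi -> cos theta <= cos (phi - psi) <= cos eta) ->
  circle P = (2 * (theta - eta))%:E.
Proof.
move=> mP eta0 et tpi /andP[psi0 psi2] Pp lo hi; have pi0 := pi_gt0 R.
rewrite -(circle_shift (t := psi))//; last by apply/andP; split; lra.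
have mQ : measurable [set phi | P (phi + psi)].
  have mf : measurable_fun setT (fun x : R => x + psi : R) by exact: measurable_funD.
  by rewrite -[X in measurable X]setTI; apply: mf.
rewrite (circleE (t := - pi))//; last 2 first.
- by apply/andP; split; lra.
- by move=> x /=; rewrite addrAC.
set Q := _ `&` _.
have mQQ : measurable Q by exact: measurableI.
have heta : 0 <= eta <= pi by rewrite eta0 (le_trans et).
have htheta : 0 <= theta <= pi by rewrite tpi (le_trans eta0).
have absP (u : R) : `[- pi, - pi + 2 * pi[%classic u -> 0 <= `|u| <= pi.
  by rewrite /= in_itv/= normr_ge0/= ler_norml => ?; lra.
pose I1 : set R := `[- theta, - eta]%classic; pose I2 : set R := `[eta, theta]%classic.
apply/le_anti/andP; split.
  apply: (@le_trans _ _ (mu (I1 `|` I2))).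
    apply: le_measure; rewrite ?inE//; first by apply: measurableU; exact: measurable_itv.
    move=> u [/absP hu /hi]; rewrite addrK -(cos_abs u) => /andP[h1 h2].
    have : eta <= `|u| <= theta.
      apply/andP; split; rewrite leNgt; apply/negP.
        by rewrite -(cos_lt_pi hu heta) ltNge h2.
      by rewrite -(cos_lt_pi htheta hu) ltNge h1.
    have [u0|u0] := leP 0 u; [rewrite ger0_norm//|rewrite ltr0_norm//] => h.
      by right; rewrite /I2 /= in_itv.
    by left; rewrite /I1 /= in_itv/=; lra.
  apply: (@le_trans _ _ (mu I1 + mu I2)%E).
    by apply: (measureU2 mu); exact: measurable_itv.
  by rewrite /I1 /I2 !mu_cc//; [rewrite -EFinD lee_fin; lra|lra].
have -> : (2 * (theta - eta))%:E = mu (`]- theta, - eta[ `|` `]eta, theta[).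
  rewrite mu_setU//.
    transitivity ((- eta - - theta)%:E + (theta - eta)%:E)%E.
      by rewrite -EFinD; congr EFin; ring.
    by congr (_ + _)%E; rewrite mu_oo// lerN2.
  by rewrite -subset0 => u [] /=; rewrite !in_itv/=; lra.
apply: le_measure; rewrite ?inE//; first by apply: measurableU; exact: measurable_itv.
have key u : - pi <= u < - pi + 2 * pi -> eta < `|u| < theta -> Q u.
  move=> h1 /andP[h2 h3]; split; first by rewrite /= in_itv.
  have hu : 0 <= `|u| <= pi by rewrite normr_ge0 ltW// (lt_le_trans h3).
  by apply: lo; rewrite addrK -(cos_abs u) (cos_lt_pi hu htheta) (cos_lt_pi heta hu) h2 h3.
move=> u [] /=; rewrite in_itv/= => h; apply: key; try lra.
  by rewrite ltr0_norm; lra.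
by rewrite ger0_norm; lra.
Qed.

(** Equality holds for [a = A] and [b = B]. This is the case of two neighbours touching each other
    and the central disk, whose arcs just touch. *)
Lemma arc_key (a A b B : R) : 0 <= a -> a <= A -> 0 <= b -> b <= B ->
  4 * (A * b + B * a) ^+ 2 <= (a ^+ 2 + 3 * A ^+ 2) * (b ^+ 2 + 3 * B ^+ 2).
Proof.
move=> a0 aA b0 bB; rewrite -subr_ge0.
have -> : (a ^+ 2 + 3 * A ^+ 2) * (b ^+ 2 + 3 * B ^+ 2) - 4 * (A * b + B * a) ^+ 2 =
  (A ^+ 2 - a ^+ 2) * (B ^+ 2 - b ^+ 2) + 8 * (A * B) * (A * B - a * b) by ring.
apply: addr_ge0; last by rewrite mulr_ge0 ?mulr_ge0 ?subr_ge0 ?ler_pM//; lra.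
by rewrite mulr_ge0// subr_ge0 ler_pXn2r// nnegrE; lra.
Qed.

(** Two directions inside arcs of half-angles [acos p] and [acos q] differ by less than the sum of
    the half-angles, expressed through cosines. *)
Lemma arc_cross (p q ca cb sa sb : R) : 0 < p < 1 -> 0 < q < 1 ->
  ca ^+ 2 + sa ^+ 2 = 1 -> cb ^+ 2 + sb ^+ 2 = 1 -> p < ca -> q < cb ->
  p * q - Num.sqrt (1 - p ^+ 2) * Num.sqrt (1 - q ^+ 2) < ca * cb + sa * sb.
Proof.
have bound (x c s : R) : 0 < x -> c ^+ 2 + s ^+ 2 = 1 -> x < c -> `|s| <= Num.sqrt (1 - x ^+ 2).
  move=> x0 h xc; rewrite -sqrtr_sqr; apply: ler_wsqrtr.
  have : x ^+ 2 <= c ^+ 2 by rewrite ler_pXn2r// ?nnegrE ?ltW// (lt_trans x0).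
  lra.
move=> /andP[p0 p1] /andP[q0 q1] ha hb pa qb.
have h1 := bound _ _ _ p0 ha pa; have h2 := bound _ _ _ q0 hb qb.
have h3 : `|sa| * `|sb| <= Num.sqrt (1 - p ^+ 2) * Num.sqrt (1 - q ^+ 2) by rewrite ler_pM.
have h4 : p * q < ca * cb by rewrite ltr_pM// ltW.
have : - (`|sa| * `|sb|) <= sa * sb by rewrite -normrM -lerN2 opprK ler_normr; apply/orP; right.
lra.
Qed.

Section Arcs.
Variables (g : geometry) (Rc r : R).
Hypotheses (Rc0 : 0 < Rc) (Rc1 : g = Spherical -> Rc < pi / 2).
Hypotheses (r0 : 0 < r) (rR : r < Rc).
(** Says that [Rc] is the circumradius. It results from eliminating the half-angle [theta] between
    [cos theta = gT r / gT Rc], from the right triangle with hypotenuse [Rc] and leg [r], and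
    [2 * cos (2 * theta) = 1 - gk * gT r ^ 2], from half of the regular triangle. *)
Hypothesis circum : gT g Rc ^+ 2 * (3 - gk R g * gT g r ^+ 2) = 4 * gT g r ^+ 2.
Local Notation T := (gT g Rc).

Let T0 : 0 < T.
Proof. by apply: (gT_gt0 Rc1); rewrite Rc0 lexx. Qed.

Let tau_lt d : 0 < d -> d < Rc -> 0 < gT g d < T.
Proof.
move=> d0 dR; rewrite (gT_incr Rc1 (ltW d0) dR (lexx _)) (gT_gt0 Rc1)//.
by rewrite d0 ltW.
Qed.

Lemma gCV d : 0 < gC g d -> (gC g d ^- 2) = 1 + gk R g * gT g d ^+ 2.
Proof.
move=> c0; have c1 : gC g d != 0 by rewrite gt_eqF.
rewrite /gT expr_div_n -[1](divff (expf_neq0 2 c1)) mulrA -mulrDl gC2S2.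
by rewrite mul1r.
Qed.

(* With [m] the cosine for [r] and [m ^+ 2 + M ^+ 2 = 1], the relation between [Tc]
   and [tr] gives [m ^+ 2 * (1 + k * (p * Tc) ^+ 2) = (m * P) ^+ 2 + 3 * (p * M) ^+ 2],
   and the claim becomes [arc_key]. *)
Lemma circum_key (tr p q P Q Tc k sr2 : R) : 0 < tr -> tr < Tc -> tr <= p * Tc -> p <= 1 ->
  tr <= q * Tc -> q <= 1 -> 0 <= P -> P ^+ 2 = 1 - p ^+ 2 -> 0 <= Q -> Q ^+ 2 = 1 - q ^+ 2 ->
  Tc ^+ 2 * (3 - k * tr ^+ 2) = 4 * tr ^+ 2 -> sr2 * (1 + k * tr ^+ 2) = tr ^+ 2 ->
  Tc ^+ 2 * (p * Q + q * P) ^+ 2 <= sr2 * (1 + k * (p * Tc) ^+ 2) * (1 + k * (q * Tc) ^+ 2).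
Proof.
move=> tr0 trT trp p1 trq q1 P0 PP Q0 QQ hT hs.
have Tc0 : 0 < Tc by exact: lt_trans trT.
pose m := tr / Tc; pose M := Num.sqrt (1 - m ^+ 2).
have trE : tr = m * Tc by rewrite divfK ?gt_eqF.
have m0 : 0 < m by rewrite divr_gt0.
have m1 : m < 1 by rewrite ltr_pdivrMr// mul1r.
have mp : m <= p by rewrite trE ler_pM2r in trp.
have mq : m <= q by rewrite trE ler_pM2r in trq.
have MM : M ^+ 2 = 1 - m ^+ 2 by rewrite sqr_sqrtr//; nra.
have M0 : 0 < M by rewrite sqrtr_gt0; nra.
have sqM x X : 0 <= X -> X ^+ 2 = 1 - x ^+ 2 -> m <= x -> X <= M.
  move=> X0 XX mx; rewrite -(ler_pXn2r (n := 2))// ?nnegrE ?(ltW M0)// MM XX.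
  by rewrite lerD2l lerN2 ler_pXn2r// ?nnegrE ?(ltW m0)// (le_trans (ltW m0)).
have PM := sqM _ _ P0 PP mp; have QM := sqM _ _ Q0 QQ mq.
have kE : k * Tc ^+ 2 * m ^+ 2 = 3 - 4 * m ^+ 2.
  have : Tc ^+ 2 * (3 - k * tr ^+ 2) = Tc ^+ 2 * (4 * m ^+ 2) by rewrite hT trE; ring.
  by move/(mulfI (expf_neq0 2 (lt0r_neq0 Tc0))); rewrite trE; lra.
have sr : sr2 * (4 * M ^+ 2) = m ^+ 2 * Tc ^+ 2.
  have kt : k * tr ^+ 2 = 3 - 4 * m ^+ 2 by rewrite trE -kE; ring.
  by rewrite -exprMn -trE -hs kt MM; ring.
have key := @arc_key (m * P) (p * M) (m * Q) (q * M).
have {}key := key (mulr_ge0 (ltW m0) P0) (ler_pM (ltW m0) P0 mp PM)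
  (mulr_ge0 (ltW m0) Q0) (ler_pM (ltW m0) Q0 mq QM).
have fac u U : U ^+ 2 = 1 - u ^+ 2 ->
    (m * U) ^+ 2 + 3 * (u * M) ^+ 2 = m ^+ 2 * (1 + k * (u * Tc) ^+ 2).
  move=> hU; transitivity (m ^+ 2 * U ^+ 2 + 3 * u ^+ 2 * M ^+ 2); first by ring.
  rewrite hU MM.
  transitivity (m ^+ 2 + u ^+ 2 * (k * Tc ^+ 2 * m ^+ 2)); [rewrite kE|]; ring.
rewrite !fac// in key.
have e : 0 < 4 * (m * M) ^+ 2 by rewrite mulr_gt0// exprn_gt0// mulr_gt0.
rewrite -(ler_pM2l e).
have -> : 4 * (m * M) ^+ 2 * (Tc ^+ 2 * (p * Q + q * P) ^+ 2) =
  Tc ^+ 2 * (4 * (p * M * (m * Q) + q * M * (m * P)) ^+ 2) by ring.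
have -> : 4 * (m * M) ^+ 2 * (sr2 * (1 + k * (p * Tc) ^+ 2) * (1 + k * (q * Tc) ^+ 2)) =
  Tc ^+ 2 * (m ^+ 2 * (1 + k * (p * Tc) ^+ 2) * (m ^+ 2 * (1 + k * (q * Tc) ^+ 2))).
  transitivity (sr2 * (4 * M ^+ 2) * m ^+ 2 * (1 + k * (p * Tc) ^+ 2) * (1 + k * (q * Tc) ^+ 2)); first by ring.
  by rewrite sr; ring.
by rewrite ler_pM2l ?exprn_gt0.
Qed.

(** The separation hypothesis is the law of cosines for centres at distances [2 * d] and [2 * e].
    Dividing by [(gC d * gC e) ^ 2] turns it into the planar law of cosines for lengths [gT d] and
    [gT e]. A direction common to both arcs makes the angle too small by [arc_cross], and
    [circum_key] says that the centres are then too close. *)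
Lemma arcs_disjoint d e u v : r <= d -> d < Rc -> r <= e -> e < Rc ->
  gS g r ^+ 2 <= gS g (d - e) ^+ 2 +
    2 * (gS g d * gC g d) * (gS g e * gC g e) * (1 - cos (u - v)) ->
  cos (phi g (gT g d) Rc) < cos u -> cos (phi g (gT g e) Rc) < cos v -> False.
Proof.
move=> rd dR re eR.
have d0 := lt_le_trans r0 rd; have e0 := lt_le_trans r0 re.
have /andP[t0 tT] := tau_lt d0 dR; have /andP[s0 sT] := tau_lt e0 eR.
have /andP[tr0 trT] := tau_lt r0 rR.
rewrite (cos_phi t0 (ltW tT)) (cos_phi s0 (ltW sT)) => sep hu hv.
have cd : 0 < gC g d by apply: (gC_gt0_Rc Rc1); rewrite !ltW.
have ce : 0 < gC g e by apply: (gC_gt0_Rc Rc1); rewrite !ltW.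
have cr : 0 < gC g r by apply: (gC_gt0_Rc Rc1); rewrite !ltW.
have krE := gCV cr; have kr0 : 0 < 1 + gk R g * gT g r ^+ 2 by rewrite -krE invr_gt0 exprn_gt0.
have srE : gS g r ^+ 2 * (1 + gk R g * gT g r ^+ 2) = gT g r ^+ 2 by rewrite -krE -expr_div_n.
pose p := gT g d / T; pose q := gT g e / T.
have tE : gT g d = p * T by rewrite divfK ?gt_eqF.
have sE : gT g e = q * T by rewrite divfK ?gt_eqF.
have pB : 0 < p < 1 by rewrite divr_gt0//= ltr_pdivrMr// mul1r.
have qB : 0 < q < 1 by rewrite divr_gt0//= ltr_pdivrMr// mul1r.
have := arc_cross pB qB (cos2Dsin2 u) (cos2Dsin2 v) hu hv; rewrite -cosB.
have PP : Num.sqrt (1 - p ^+ 2) ^+ 2 = 1 - p ^+ 2 by rewrite sqr_sqrtr//; nra.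
have QQ : Num.sqrt (1 - q ^+ 2) ^+ 2 = 1 - q ^+ 2 by rewrite sqr_sqrtr//; nra.
have P0 := sqrtr_ge0 (1 - p ^+ 2); have Q0 := sqrtr_ge0 (1 - q ^+ 2).
move: (Num.sqrt (1 - q ^+ 2)) (Num.sqrt (1 - p ^+ 2)) PP QQ P0 Q0 => Q P PP QQ P0 Q0.
case/andP: pB => p0 p1; case/andP: qB => q0 q1.
have trp : gT g r <= p * T by rewrite -tE; exact: (gT_le Rc1 (ltW r0) rd (ltW dR)).
have trq : gT g r <= q * T by rewrite -sE; exact: (gT_le Rc1 (ltW r0) re (ltW eR)).
have := circum_key tr0 trT trp (ltW p1) trq (ltW q1) P0 PP Q0 QQ circum srE.
rewrite -tE -sE -(gCV cd) -(gCV ce).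
have sdE : gS g d = gT g d * gC g d by rewrite divfK ?gt_eqF.
have seE : gS g e = gT g e * gC g e by rewrite divfK ?gt_eqF.
have {}sep : gS g r ^+ 2 * gC g d ^- 2 * gC g e ^- 2 <=
    gT g d ^+ 2 + gT g e ^+ 2 - 2 * gT g d * gT g e * cos (u - v).
  rewrite ler_pdivrMr ?exprn_gt0// ler_pdivrMr ?exprn_gt0//; apply: (le_trans sep).
  rewrite gSB sdE seE le_eqVlt; apply/orP; left; apply/eqP; ring.
move=> key hc; have := le_trans key sep; rewrite tE sE; apply/negP; rewrite -ltNge.
have -> : (p * T) ^+ 2 + (q * T) ^+ 2 - 2 * (p * T) * (q * T) * cos (u - v) =
  T ^+ 2 * (p ^+ 2 + q ^+ 2 - 2 * (p * q) * cos (u - v)) by ring.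
have -> : (p * Q + q * P) ^+ 2 = p ^+ 2 + q ^+ 2 - 2 * (p * q) * (p * q - P * Q).
  transitivity (p ^+ 2 * Q ^+ 2 + q ^+ 2 * P ^+ 2 + 2 * (p * q) * (P * Q)); first by ring.
  by rewrite PP QQ; ring.
by rewrite ltr_pM2l ?exprn_gt0// ltrD2l ltrN2 ltr_pM2l// mulr_gt0// mulr_gt0.
Qed.

Lemma half_plane_near x d u : 0 <= x -> x <= Rc -> 0 < d -> d < Rc ->
  (gS g x * gC g d * cos u <= gC g x * gS g d) = (cos u <= cos (phi g (gT g d) x)).
Proof.
move=> x0 xR d0 dR; have hx : 0 <= x <= Rc by rewrite x0.
have cd : 0 < gC g d by apply: (gC_gt0_Rc Rc1); rewrite !ltW.
have cx : 0 < gC g x by exact: (gC_gt0_Rc Rc1).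
have /andP[t0 tT] := tau_lt d0 dR.
have -> : gS g x * gC g d * cos u = gC g x * gC g d * (gT g x * cos u).
  by rewrite /gT; field; rewrite gt_eqF.
have -> : gC g x * gS g d = gC g x * gC g d * gT g d by rewrite /gT; field; rewrite gt_eqF.
rewrite ler_pM2l ?mulr_gt0//.
have [h|h] := leP (gT g x) (gT g d).
  rewrite (phi0 Rc1 t0 hx h) cos0 cos_le1; apply: le_trans h.
  by rewrite ler_piMr ?cos_le1// (gT_ge0 Rc1 hx).
rewrite (cos_phi t0 (ltW h)) [gT g x * _]mulrC; apply/esym.
by move: h (lt_trans t0 h); move: (gT g x) (gT g d) => ? ? ? ?; exact: ler_pdivlMr.
Qed.

(** A bisector at distance at least [Rc] does not cut the disk of radius [Rc]: the claim is worst
    for [cos u = 1], where it reads [0 <= gS g (d - x)]. *)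
Lemma half_plane_far x d u : 0 <= x -> x <= Rc -> Rc <= d -> (g = Spherical -> d <= pi / 2) ->
  gS g x * gC g d * cos u <= gC g x * gS g d.
Proof.
move=> x0 xR Rd dpi; have pi0 := pi_gt0 R.
have cd : 0 <= gC g d.
  case: g dpi => //= [/(_ erefl) h|_]; last exact/ltW/cosh_gt0.
  by apply: cos_ge0_pihalf; apply/andP; split; lra.
have s0 : 0 <= gS g (d - x).
  by apply: gS_ge0; apply/idomP; split; [lra|move=> /dpi; lra].
apply: (@le_trans _ _ (gS g x * gC g d)); last first.
  by move: s0; rewrite gSB; lra.
by rewrite ler_piMr ?cos_le1// mulr_ge0// (gS_ge0_Rc Rc1 x0 xR).
Qed.

(** * Slices of the cell by circles around its centre *)

Section CellSlices.
Variables (J : set nat) (d psi : nat -> R).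
Hypothesis J_far : forall n, J n -> r <= d n /\ (g = Spherical -> d n <= pi / 2).
Hypothesis psi_turn : forall n, 0 <= psi n < 2 * pi.
Hypothesis J_sep : forall n m, J n -> J m -> n <> m ->
  gS g r ^+ 2 <= gS g (d n - d m) ^+ 2 +
    2 * (gS g (d n) * gC g (d n)) * (gS g (d m) * gC g (d m)) * (1 - cos (psi n - psi m)).

Definition near_index : set nat := [set n | J n /\ d n < Rc].

Definition cell x : set R := [set phi0 |
  forall n, J n -> gS g x * gC g (d n) * cos (phi0 - psi n) <= gC g x * gS g (d n)].

Definition arc n : set R :=
  [set phi0 | near_index n /\ cos (phi g (gT g (d n)) Rc) < cos (phi0 - psi n)].

Definition free : set R := ~` \bigcup_n arc n.

(** The value 0 outside [near_index] lets the series run over all naturals. *)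
Definition arc_measure n x : R :=
  if n \in near_index then 2 * width g Rc (gT g (d n)) x else 0.

Lemma near_gt0 n : near_index n -> [/\ r <= d n, 0 < d n, d n < Rc & 0 < gT g (d n)].
Proof.
move=> [/J_far[rd _] dR]; have d0 := lt_le_trans r0 rd.
by split=> //; case/andP: (tau_lt d0 dR).
Qed.

Lemma phi_range (t x : R) : 0 <= phi g t x <= pi.
Proof.
by rewrite phi_ge0/=; have := asec_lt (gT g x / t); rewrite /phi; have := pi_gt0 R; lra.
Qed.

Lemma arc_inj n m p : arc n p -> arc m p -> n = m.
Proof.
move=> [Kn hn] [Km hm]; apply: contrapT => nm.
have [rn n0 nR _] := near_gt0 Kn; have [rm m0 mR _] := near_gt0 Km.
apply: (arcs_disjoint rn nR rm mR _ hn hm).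
have := J_sep (proj1 Kn) (proj1 Km) nm.
by rewrite -[psi n - psi m]opprB cosN; have -> : p - psi n - (p - psi m) = psi m - psi n by ring.
Qed.

(** Inside one arc only its own bisector matters: far bisectors do not reach the disk, and another
    near one acts within its own arc, which is disjoint from this one and only shrinks as [x]
    decreases. *)
Lemma cell_arc n x p : 0 <= x -> x <= Rc -> arc n p ->
  cell x p <-> cos (p - psi n) <= cos (phi g (gT g (d n)) x).
Proof.
move=> x0 xR hp; have [Kn hn] := hp; have [rn n0 nR t0] := near_gt0 Kn.
rewrite -(half_plane_near _ x0 xR n0 nR); split=> [/(_ n (proj1 Kn))//|h m Jm].
have [<-//|/eqP nm] := eqVneq n m.
have [mR|Rm] := ltP (d m) Rc; last first.
  by apply: half_plane_far => //; case: (J_far Jm).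
have Km : near_index m by [].
have [rm m0 _ tm0] := near_gt0 Km.
rewrite (half_plane_near _ x0 xR m0 mR); apply: (@le_trans _ _ (cos (phi g (gT g (d m)) Rc))).
  rewrite leNgt; apply/negP => hm.
  by apply: nm; apply: (arc_inj hp); split.
by rewrite leNgt (cos_lt_pi (phi_range _ _) (phi_range _ _)) -leNgt; exact: (phi_homo Rc1 tm0 x0 xR).
Qed.

Lemma cell_free x : 0 <= x -> x <= Rc -> free `<=` cell x.
Proof.
move=> x0 xR p fp n Jn; have [nR|Rn] := ltP (d n) Rc; last first.
  by apply: half_plane_far => //; case: (J_far Jn).
have Kn : near_index n by [].
have [rn n0 _ tn0] := near_gt0 Kn.
rewrite (half_plane_near _ x0 xR n0 nR); apply: (@le_trans _ _ (cos (phi g (gT g (d n)) Rc))).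
  by rewrite leNgt; apply/negP => hn; apply: fp; exists n.
by rewrite leNgt (cos_lt_pi (phi_range _ _) (phi_range _ _)) -leNgt; exact: (phi_homo Rc1 tn0 x0 xR).
Qed.

Let mcos n : measurable_fun setT (fun p : R => cos (p - psi n)).
Proof. by apply: measurableT_comp (@measurable_cos R) _; exact: measurable_funB. Qed.

Lemma measurable_arc n : measurable (arc n).
Proof.
have [Kn|Kn] := pselect (near_index n).
  rewrite (_ : arc n = [set p | cos (phi g (gT g (d n)) Rc) < cos (p - psi n)]).
    exact: measurable_set_ltr.
  by apply/seteqP; split=> p //= [].
by rewrite (_ : arc n = set0)// -subset0 => p [].
Qed.

Lemma measurable_free : measurable free.
Proof. by apply: measurableC; apply: bigcup_measurable => n _; exact: measurable_arc. Qed.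

Lemma arc_cellE n x : 0 <= x -> x <= Rc -> arc n `&` cell x =
  arc n `&` [set p | cos (p - psi n) <= cos (phi g (gT g (d n)) x)].
Proof. by move=> x0 xR; apply/seteqP; split=> p [hp /(cell_arc x0 xR hp)]. Qed.

Lemma measurable_arc_cell n x : 0 <= x -> x <= Rc -> measurable (arc n `&` cell x).
Proof.
move=> x0 xR; rewrite arc_cellE//; apply: measurableI; first exact: measurable_arc.
exact: measurable_set_ler.
Qed.

Lemma circle_arc_cell n x : 0 <= x -> x <= Rc ->
  circle (arc n `&` cell x) = (arc_measure n x)%:E.
Proof.
move=> x0 xR; rewrite /arc_measure; case: ifPn => [/set_mem Kn|/negP Kn]; last first.
  have -> : arc n = set0 by rewrite -subset0 => p [Kn' _]; apply: Kn; exact/mem_set.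
  by rewrite set0I /circle setI0 measure0.
have [rn n0 nR tn0] := near_gt0 Kn.
have per (q : R) : cos (q + 2 * pi - psi n) = cos (q - psi n) by rewrite addrAC cos_period.
apply: (@circle_arc _ _ (psi n)).
- exact: measurable_arc_cell.
- exact: phi_ge0.
- exact: (phi_homo Rc1 tn0 x0 xR).
- by have /andP[] := phi_range (gT g (d n)) Rc.
- exact: psi_turn.
- by move=> q; rewrite arc_cellE// /arc /= per.
- by move=> q /andP[h1 h2]; rewrite arc_cellE//; split; [split|exact: ltW].
- by move=> q; rewrite arc_cellE// => -[[_ /ltW ->] ->].
Qed.

Lemma circle_cell x : 0 <= x -> x <= Rc ->
  circle (cell x) = (circle free + \sum_(n <oo) (arc_measure n x)%:E)%E.
Proof.
move=> x0 xR.
have mturn : measurable turn by exact: measurable_itv.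
have mG n : measurable (turn `&` (arc n `&` cell x)).
  by apply: measurableI => //; exact: measurable_arc_cell.
have tG : trivIset setT (fun n => turn `&` (arc n `&` cell x)).
  by move=> n m _ _ [p [[_ [hn _]] [_ [hm _]]]]; exact: arc_inj hn hm.
transitivity (mu ((turn `&` free) `|` \bigcup_n (turn `&` (arc n `&` cell x)))).
  congr (mu _); apply/seteqP; split=> p.
    move=> [tp cp]; have [fp|/contrapT[n _ np]] := pselect (free p); first by left.
    by right; exists n.
  by move=> [[tp fp]|[n _ [tp [_ cp]]]] //; split=> //; exact: (cell_free x0 xR).
rewrite mu_setU.
- congr (_ + _)%E; rewrite (measure_semi_bigcup mu mG tG).
    by apply: eq_eseriesr => n _; rewrite -circle_arc_cell.
  by apply: bigcup_measurable => n _; exact: mG.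
- by apply: measurableI => //; exact: measurable_free.
- by apply: bigcup_measurable => n _; exact: mG.
- by rewrite -subset0 => p [[_ fp] [n _ [_ [np _]]]]; apply: fp; exists n.
Qed.

Lemma arc_measure_ge0 n x : 0 <= x -> x <= Rc -> 0 <= arc_measure n x.
Proof.
move=> x0 xR; rewrite /arc_measure; case: ifPn => // /set_mem /near_gt0[_ _ _ t0].
by rewrite mulr_ge0// (width_ge0 Rc1 t0)// x0.
Qed.

(** At radius 0 nothing is cut, so this splits the full angle into the free directions and the
    arcs. *)
Lemma circle_total : ((2 * pi)%:E = circle free + \sum_(n <oo) (arc_measure n 0)%:E)%E.
Proof.
rewrite -(circle_cell (lexx _) (ltW Rc0)).
have -> : cell 0 = setT.
  apply/seteqP; split=> // p _ n Jn; rewrite gS0 !mul0r gC0 mul1r.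
  have [rd h] := J_far Jn; apply: gS_ge0; apply/idomP; split; first by rewrite (le_trans (ltW r0)).
  by move/h; have := pi_gt0 R; lra.
rewrite /circle setIT lebesgue_measure_itv/= lte_fin mulr_gt0 ?pi_gt0//.
by rewrite oppr0 adde0.
Qed.

Local Notation theta := (phi g (gT g r) Rc).

Let tr0 : 0 < gT g r.
Proof. by case/andP: (tau_lt r0 rR). Qed.

Lemma theta_gt0 : 0 < theta.
Proof.
by apply: asec_gt0; rewrite ltr_pdivlMr// mul1r; case/andP: (tau_lt r0 rR).
Qed.

Lemma circle_ge0 (P : set R) : (0 <= circle P)%E.
Proof. exact: measure_ge0. Qed.

Definition cell_area rho := (\int[mu]_(x in `[0%R, rho]) ((gS g x)%:E * circle (cell x)))%E.

Definition arc_sector n rho : R :=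
  if n \in near_index then 2 * sector g Rc (gT g (d n)) rho else 0.

Let mS (D : set R) : measurable_fun D (fun x => (gS g x)%:E).
Proof. by apply/measurable_EFinP; apply: measurable_funTS; exact: measurable_gS. Qed.

Let S0 rho x : rho <= Rc -> `[0, rho]%classic x -> [/\ 0 <= x, x <= Rc & 0 <= gS g x].
Proof.
move=> rR'; rewrite /= in_itv/= => /andP[x0 xr]; have xR := le_trans xr rR'.
by split=> //; exact: (gS_ge0_Rc Rc1).
Qed.

Let integrable_S rho : mu.-integrable `[0, rho] (EFin \o gS g).
Proof.
apply: continuous_compact_integrable; first exact: segment_compact.
by apply: continuous_subspaceT; exact: continuous_gS.
Qed.

Lemma Rintegral_EFin (D : set R) (f : R -> R) : measurable D -> mu.-integrable D (EFin \o f) ->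
  (\int[mu]_(x in D) (f x)%:E)%E = (\int[mu]_(x in D) f x)%:E.
Proof. by move=> mD intf; rewrite /Rintegral fineK//; exact: integrable_fin_num. Qed.

Lemma arc_measure_integral n rho : 0 <= rho -> rho <= Rc ->
  mu.-integrable `[0, rho] (EFin \o (fun x => gS g x * arc_measure n x)) /\
  (\int[mu]_(x in `[0%R, rho]) (gS g x * arc_measure n x)%:E)%E = (arc_sector n rho)%:E.
Proof.
move=> p0 pR; rewrite /arc_measure /arc_sector; case: ifPn => [/set_mem Kn|_]; last first.
  have e : (fun x => gS g x * 0) = (fun=> 0 : R) by apply/funext => x; rewrite mulr0.
  rewrite e; split; first exact: integrable0.
  by under eq_integral do rewrite mulr0; rewrite integral0.
have int1 := integrable_sector Rc1 (gT g (d n)) p0 pR.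
have e : (fun x => gS g x * (2 * width g Rc (gT g (d n)) x)) =
  (fun x => 2 * (gS g x * width g Rc (gT g (d n)) x)) by apply/funext => x; rewrite mulrCA.
have int2 : mu.-integrable `[0, rho] (EFin \o (fun x => gS g x * (2 * width g Rc (gT g (d n)) x))).
  by rewrite e; have := @integrableZl _ _ R mu `[0, rho] _ 2 _ int1; apply.
split=> //; rewrite Rintegral_EFin//; congr EFin.
rewrite e; exact: RintegralZl.
Qed.

Lemma cell_areaE rho : 0 <= rho -> rho <= Rc ->
  cell_area rho = (circle free * (\int[mu]_(x in `[0%R, rho]) gS g x)%:E +
    \sum_(n <oo) (arc_sector n rho)%:E)%E.
Proof.
move=> p0 pR.
have term0 n x : `[0, rho]%classic x -> (0 <= (gS g x * arc_measure n x)%:E)%E.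
  by move=> /(S0 pR)[x0 xR s0]; rewrite lee_fin mulr_ge0// arc_measure_ge0.
have mterm n : measurable_fun `[0, rho] (fun x => (gS g x * arc_measure n x)%:E).
  by have [/integrableP[]] := arc_measure_integral n p0 pR.
transitivity (\int[mu]_(x in `[0%R, rho]) (circle free * (gS g x)%:E +
    \sum_(n <oo) (gS g x * arc_measure n x)%:E))%E.
  apply: eq_integral => x /set_mem /(S0 pR)[x0 xR s0].
  rewrite (circle_cell x0 xR) ge0_muleDr.
  - rewrite muleC -nneseriesZl//; last by move=> n _; rewrite lee_fin arc_measure_ge0.
  - exact: circle_ge0.
  - by apply: nneseries_ge0 => n _ _; rewrite lee_fin arc_measure_ge0.
rewrite ge0_integralD//=.
- congr (_ + _)%E.
    rewrite ge0_integralZl//; last by move=> x /(S0 pR)[_ _]; rewrite lee_fin.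
    by rewrite Rintegral_EFin.
    exact: mS.
  rewrite integral_nneseries//; apply: eq_eseriesr => n _.
  by have [] := arc_measure_integral n p0 pR.
- by move=> x /(S0 pR)[_ _ s0]; rewrite mule_ge0.
- by apply: measurable_funeM; exact: mS.
- by move=> x hx; apply: nneseries_ge0 => n _ _; exact: term0.
- have := @ge0_emeasurable_sum _ _ R `[0, rho]%classic
    (fun n x => (gS g x * arc_measure n x)%:E) xpredT.
  by apply=> [n x hx _|n _]; [exact: term0|exact: mterm].
Qed.

Let sector_pos t rho : 0 < t -> 0 <= rho -> rho <= Rc -> 0 <= sector g Rc t rho.
Proof. by move=> t0 p0 pR; exact: (sector_ge0 Rc1 t0 p0 pR). Qed.

Lemma arc_sector_ge0 n rho : 0 <= rho -> rho <= Rc -> (0 <= (arc_sector n rho)%:E)%E.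
Proof.
move=> p0 pR; rewrite lee_fin /arc_sector; case: ifPn => // /set_mem /near_gt0[_ _ _ t0].
by rewrite mulr_ge0// sector_pos.
Qed.

(** [phi_ratio] integrated: per unit of angle at the centre, the truncated sector is least for
    [r]. *)
Lemma sector_width_ge d0 rho : r <= d0 -> d0 < Rc -> 0 <= rho -> rho <= Rc ->
  sector g Rc (gT g r) rho / theta * phi g (gT g d0) Rc <= sector g Rc (gT g d0) rho.
Proof.
move=> rd dR p0 pR; have d00 := lt_le_trans r0 rd; have /andP[t0 tT] := tau_lt d00 dR.
rewrite mulrC mulrA -mulrAC.
apply: (Rintegral_leZl _ (integrable_sector Rc1 (gT g r) p0 pR) (integrable_sector Rc1 (gT g d0) p0 pR)).
  exact: measurable_itv.
move=> x /(S0 pR)[x0 xR s0]; rewrite mulrCA; apply: (ler_wpM2l s0).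
have hx : 0 <= x <= Rc by rewrite x0.
have := phi_ratio Rc1 tr0 (gT_le Rc1 (ltW r0) rd (ltW dR)) (ltW tT) hx.
by have th0 := theta_gt0; rewrite mulrAC ler_pdivrMr// /width; nra.
Qed.

Lemma sector_disk_ge rho : 0 <= rho -> rho <= Rc ->
  sector g Rc (gT g r) rho / theta <= (\int[mu]_(x in `[0%R, rho]) gS g x)%R.
Proof.
move=> p0 pR; have th0 := theta_gt0; rewrite ler_pdivrMr// mulrC.
apply: (Rintegral_leZr _ (integrable_S rho) (integrable_sector Rc1 (gT g r) p0 pR)).
  exact: measurable_itv.
move=> x /(S0 pR)[x0 xR s0]; rewrite [leRHS]mulrC; apply: (ler_wpM2l s0).
by rewrite /width lerBlDr lerDl phi_ge0.
Qed.

(** Free directions and arcs both contribute at least [sector / theta], taken for [r], per unit of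
    angle; by [circle_total] the angles add up to [2 * pi]. *)
Lemma cell_area_ge rho : 0 <= rho -> rho <= Rc ->
  ((2 * pi * (sector g Rc (gT g r) rho / theta))%:E <= cell_area rho)%E.
Proof.
move=> p0 pR; rewrite (cell_areaE p0 pR) mulrC EFinM circle_total.
have th0 := theta_gt0.
set l := sector g Rc (gT g r) rho / theta.
have l0 : 0 <= l by rewrite divr_ge0 ?(ltW th0)// sector_pos.
have a0 n : (0 <= (arc_measure n 0)%:E)%E by rewrite lee_fin arc_measure_ge0// ltW.
rewrite ge0_muleDr; last 2 first.
- exact: circle_ge0.
- by apply: nneseries_ge0.
rewrite -nneseriesZl//; apply: leeD.
  by rewrite muleC lee_wpmul2l ?circle_ge0// lee_fin sector_disk_ge.
apply: lee_nneseries => [n _ _|n _]; first by rewrite mule_ge0.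
rewrite -EFinM lee_fin /arc_measure /arc_sector; case: ifPn => [/set_mem Kn|_]; last by rewrite mulr0.
have [rn n0 nR tn0] := near_gt0 Kn.
rewrite mulrCA ler_pM2l// /width [phi g _ 0](phi0 Rc1 tn0 _ _).
- by rewrite subr0; exact: sector_width_ge.
- by rewrite lexx ltW.
- by rewrite gT0 ltW.
Qed.

(** The two areas decompose over the same free directions and the same arcs, so the comparison is
    made term by term with [disk_ratio] and [sector_ratio]. *)
Lemma cell_area_ratio rho : 0 <= rho -> rho <= Rc ->
  (cell_area rho * (sector g Rc (gT g r) Rc)%:E <= (sector g Rc (gT g r) rho)%:E * cell_area Rc)%E.
Proof.
move=> p0 pR; rewrite (cell_areaE p0 pR) (cell_areaE (ltW Rc0) (lexx _)).
have s0 := sector_pos tr0 p0 pR; have sR0 := sector_pos tr0 (ltW Rc0) (lexx _).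
have disk0 p : 0 <= p -> p <= Rc -> (0 <= circle free * (\int[mu]_(x in `[0%R, p]) gS g x)%:E)%E.
  move=> p0' pR'; apply: mule_ge0; first exact: circle_ge0.
  by rewrite lee_fin; apply: Rintegral_ge0 => x /(S0 pR')[].
have ser0 p : 0 <= p -> p <= Rc -> (0 <= \sum_(n <oo) (arc_sector n p)%:E)%E.
  by move=> p0' pR'; apply: nneseries_ge0 => n _ _; exact: arc_sector_ge0.
rewrite muleC ge0_muleDr; [|exact: disk0|exact: ser0].
rewrite [leRHS]ge0_muleDr; [|exact: disk0 (ltW Rc0) (lexx _)|exact: ser0 (ltW Rc0) (lexx _)].
apply: leeD.
  rewrite muleCA [leRHS]muleCA -!EFinM; apply: lee_wpmul2l; first exact: circle_ge0.
  by rewrite lee_fin mulrC; exact: (disk_ratio Rc0 Rc1 r0 (ltW rR) p0 pR).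
rewrite -!nneseriesZl; try by move=> n _; apply: arc_sector_ge0 => //; exact: ltW.
apply: lee_nneseries => [n _ _|n _].
  by rewrite mule_ge0 ?lee_fin//; exact: arc_sector_ge0.
rewrite -!EFinM lee_fin /arc_sector; case: ifPn => [/set_mem Kn|_]; last by rewrite !mulr0.
have [rn n0 nR tn0] := near_gt0 Kn.
rewrite mulrCA [leRHS]mulrCA ler_pM2l// mulrC.
exact: (sector_ratio Rc0 Rc1 r0 rn (ltW nR) p0 pR).
Qed.

End CellSlices.
End Arcs.

(** * Regular triangles *)

Lemma chart_coords_inj g t s w w' : rot t (boost g s w) = rot t (boost g s w') -> w = w'.
Proof.
move=> h; have := congr1 (fun v => boost g (- s) (rot (- t) v)) h.
by rewrite !rotN !boostN.
Qed.

Lemma cos_eq1 (a b : R) : cos (a - b) = 1 -> cos a = cos b /\ sin a = sin b.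
Proof.
rewrite cosB => h; have ha := cos2Dsin2 a; have hb := cos2Dsin2 b.
have : (cos a - cos b) ^+ 2 + (sin a - sin b) ^+ 2 = 0.
  transitivity ((cos a ^+ 2 + sin a ^+ 2) + (cos b ^+ 2 + sin b ^+ 2) -
    2 * (cos a * cos b + sin a * sin b)); first by ring.
  by rewrite ha hb h; ring.
move/eqP; rewrite paddr_eq0 ?sqr_ge0// !sqrf_eq0 !subr_eq0 => /andP[/eqP -> /eqP ->].
by split.
Qed.

(** Seen from [p], a point lies on the segment exactly when it has the direction of [x] and is not
    farther away. Linear combinations replace the metric condition because isometries respect
    them. *)
Lemma segment_cone g (p x z : plane_of R g) : 0 < dist p x ->
  (g = Spherical -> dist p x < pi) ->
  segment p x z <-> exists a b, [/\ 0 <= a, 0 <= b &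
    coords z = comb3 a b 0 (coords p) (coords x) (coords x)].
Proof.
have [E chE] := chart_exists p; have [t0 [s0 [Is ht pE EE]]] := chE.
have [s [psi [Is' _ ->]]] := chart_surj chE x.
have [t [phi0 [It _ ->]]] := chart_surj chE z.
rewrite (chart_dist0 chE) // => sgt0 spi.
have Ss : 0 < gS g s by exact: gS_gt0.
have St : 0 <= gS g t by exact: gS_ge0.
have [tge0 tpi] := (idomP g t).1 It.
have cc := chart_chord chE t s phi0 psi.
have lin a b : coords (E t phi0) = comb3 a b 0 (coords p) (coords (E s psi)) (coords (E s psi)) <->
    polar g t phi0 = comb3 a b 0 (0, 0, 1) (polar g s psi) (polar g s psi).
  by rewrite pE !EE -rot_comb3 -boost_comb3; split=> [/chart_coords_inj//|->].
have mid : segment p (E s psi) (E t phi0) <-> t + dist (E t phi0) (E s psi) = s.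
  by rewrite /segment /= !(chart_dist0 chE).
have It' : t <= s -> idom g (s - t).
  by move=> ts; apply/idomP; split; [lra|move=> /spi; lra].
have cabs : gS g ((t - s) / 2) ^+ 2 = gS g ((s - t) / 2) ^+ 2.
  by rewrite -opprB mulNr gSN sqrrN.
split.
- move=> /mid h; have ts : t <= s by have := dist_ge0 (E t phi0) (E s psi); lra.
  have dE : dist (E t phi0) (E s psi) = s - t by lra.
  rewrite dE cabs in cc.
  have {}cc : gS g t * gS g s * (1 - cos (phi0 - psi)) = 0 by lra.
  have [c1 c2] : gS g t * cos phi0 = gS g t * cos psi /\ gS g t * sin phi0 = gS g t * sin psi.
    move/eqP: cc; rewrite mulf_eq0 mulf_eq0 (gt_eqF Ss) orbF subr_eq0 => /orP[/eqP ->|/eqP e].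
      by rewrite !mul0r.
    by have [-> ->] := cos_eq1 (esym e).
  (* The coefficients of geodesic interpolation, given by the addition formula for
     [s = t + (s - t)]. *)
  exists (gS g (s - t) / gS g s), (gS g t / gS g s); split.
  + by apply: divr_ge0; [exact/gS_ge0/It'|exact: ltW].
  + by rewrite divr_ge0// ltW.
  apply/lin; rewrite /polar /comb3 /= c1 c2 gSB.
  by congr (_, _, _); field; rewrite gt_eqF.
- move=> [a [b [a0 b0 /lin]]]; rewrite /polar /comb3 /= => -[e1 e2 e3].
  have {}e1 : gS g t * cos phi0 = b * gS g s * cos psi by rewrite e1; ring.
  have {}e2 : gS g t * sin phi0 = b * gS g s * sin psi by rewrite e2; ring.
  have {}e3 : gC g t = a + b * gC g s by rewrite e3; ring.
  have StE : gS g t = b * gS g s.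
    apply: (@pexpIrn _ 2); rewrite ?nnegrE ?mulr_ge0 ?(ltW Ss)//.
    transitivity ((gS g t * cos phi0) ^+ 2 + (gS g t * sin phi0) ^+ 2).
      by rewrite !exprMn -mulrDr cos2Dsin2 mulr1.
    by rewrite e1 e2 !exprMn -mulrDr cos2Dsin2 mulr1.
  have e4 : gS g t * (1 - cos (phi0 - psi)) = 0.
    rewrite cosB; have := cos2Dsin2 psi => h.
    transitivity (gS g t - (gS g t * cos phi0 * cos psi + gS g t * sin phi0 * sin psi)); first by ring.
    rewrite e1 e2 StE.
    transitivity (b * gS g s * (1 - (cos psi ^+ 2 + sin psi ^+ 2))); first by ring.
    by rewrite h subrr mulr0.
  have ts : t <= s.
    rewrite leNgt; apply/negP => st.
    have : 0 < gS g (t - s).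
      by apply: gS_gt0; [lra|move=> gE; have := tpi gE; lra].
    rewrite -opprB gSN gSB e3 StE.
    have := mulr_ge0 a0 (ltW Ss); lra.
  apply/mid; have -> : dist (E t phi0) (E s psi) = s - t.
    apply: (half_sqr_inj (dist_idom _ _) (It' ts)); apply: (@mulfI _ 4) => //.
    rewrite cc cabs.
    transitivity (4 * gS g ((s - t) / 2) ^+ 2 + 2 * gS g s * (gS g t * (1 - cos (phi0 - psi)))).
      by ring.
    by rewrite e4 mulr0 addr0.
  lra.
Qed.

Lemma cos_pi3 : cos (pi / 3 : R) = 1 / 2.
Proof.
have pi0 := pi_gt0 R; set c := cos _.
have c0 : 0 < c by apply: cos_gt0_pihalf; apply/andP; split; lra.
have h : 4 * c ^+ 3 - 3 * c = -1.
  rewrite -(@cospi R); have -> : (pi : R) = pi / 3 + (pi / 3 + pi / 3) by field.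
  rewrite cosD sinD cosD -/c; have := cos2Dsin2 (pi / 3 : R); rewrite -/c; set s := sin _ => cs.
  transitivity (c * (c * c) - 3 * c * s ^+ 2); last by ring.
  have -> : s ^+ 2 = 1 - c ^+ 2 by lra.
  by ring.
have : (c + 1) * (2 * c - 1) ^+ 2 = 0 by transitivity (4 * c ^+ 3 - 3 * c + 1); [ring|rewrite h; ring].
move/eqP; rewrite mulf_eq0 sqrf_eq0 gt_eqF ?addr_gt0//= subr_eq0 => /eqP; lra.
Qed.

Lemma cos_gt_half (r : R) : 0 < r -> r < pi / 3 -> 1 / 2 < cos r.
Proof.
move=> r0 r3; have pi0 := pi_gt0 R.
by rewrite -cos_pi3 ltr_cos ?in_itv/=; lra.
Qed.

(** The combination is rescaled by the root of its quadratic form, which equals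
    [(b + c) ^ 2 - 4 * gk * b * c * gS r ^ 2] and is positive under the bound on [r]. *)
Lemma cone_norm g (r : R) (p2 p3 : plane_of R g) b c : 0 < r -> (g = Spherical -> r < pi / 3) ->
  dist p2 p3 = 2 * r -> 0 <= b -> 0 <= c -> 0 < b + c ->
  exists2 n, 0 < n & on_surface g (comb3 (b / n) (c / n) 0 (coords p2) (coords p3) (coords p3)).
Proof.
move=> r0 rpi d23 b0 c0 bc0; have pi0 := pi_gt0 R.
have hc := dist_chord p2 p3; rewrite d23 in hc.
have h2 : 2 * r / 2 = r by field.
rewrite h2 in hc; have [h h'] := coords_surface p2; have [k k'] := coords_surface p3.
case: (coords p2) (coords p3) hc h h' k k' => [[x y] z] [[x' y'] z'] /= hc h h' k k'.
pose u := b * x + c * x'; pose v := b * y + c * y'; pose w := b * z + c * z'.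
have nE : gk R g * (u ^+ 2 + v ^+ 2) + w ^+ 2 =
    (b + c) ^+ 2 - 4 * (gk R g * (b * c)) * gS g r ^+ 2.
  rewrite /u /v /w; move: hc h h' k k'; rewrite /chord /=; case: (g) => /= hc h h' k k'.
  - have -> : z = 1 by case: h' => // h'; nra.
    have -> : z' = 1 by case: k' => // k'; nra.
    by ring.
  - rewrite !mul1r; move: hc h k; rewrite !mul1r => hc h k.
    have e : 4 * sin r ^+ 2 = 2 - 2 * (x * x' + y * y' + z * z') by rewrite hc; lra.
    transitivity (b ^+ 2 * (x ^+ 2 + y ^+ 2 + z ^+ 2) + c ^+ 2 * (x' ^+ 2 + y' ^+ 2 + z' ^+ 2) +
      2 * b * c * (x * x' + y * y' + z * z')); first by ring.
    rewrite h k.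
    transitivity ((b + c) ^+ 2 - b * c * (4 * sin r ^+ 2)); [rewrite e|]; ring.
  - have e : 4 * sinh r ^+ 2 = - 2 - 2 * (x * x' + y * y' - z * z') by rewrite hc; lra.
    transitivity (- (b ^+ 2 * (x ^+ 2 + y ^+ 2 - z ^+ 2) + c ^+ 2 * (x' ^+ 2 + y' ^+ 2 - z' ^+ 2) +
      2 * b * c * (x * x' + y * y' - z * z'))); first by ring.
    have -> : x ^+ 2 + y ^+ 2 - z ^+ 2 = -1 by lra.
    have -> : x' ^+ 2 + y' ^+ 2 - z' ^+ 2 = -1 by lra.
    transitivity ((b + c) ^+ 2 + b * c * (4 * sinh r ^+ 2)); [rewrite e|]; ring.
set N := _ + w ^+ 2 in nE.
have bc : 0 <= b * c by rewrite mulr_ge0.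
have N0 : 0 < N.
  have s2 : 0 <= gS g r ^+ 2 by exact: sqr_ge0.
  rewrite nE; case: (g) rpi s2 => /= rpi s2; [by rewrite !(mul0r, mulr0) subr0 exprn_gt0| |].
  - have s1 : sin r ^+ 2 <= 3 / 4.
      have := cos_gt_half r0 (rpi erefl); have := cos2Dsin2 r; nra.
    have h3 : 0 <= b * c * (3 / 4 - sin r ^+ 2) by rewrite mulr_ge0// subr_ge0.
    have h4 := exprn_gt0 2 bc0; have h5 := sqr_ge0 (b - c); lra.
  - have h3 : 0 <= b * c * sinh r ^+ 2 by rewrite mulr_ge0.
    have h4 := exprn_gt0 2 bc0; lra.
pose n := Num.sqrt N; have n0 : 0 < n by rewrite sqrtr_gt0.
have nn : n ^+ 2 = N by rewrite sqr_sqrtr// ltW.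
exists n => //; split; rewrite /=; last first.
  case: h' => [->|z0]; first by left.
  case: k' => [->|z0']; first by left.
  right; rewrite mul0r addr0.
  have [bE|bN] := eqVneq b 0.
    by rewrite bE add0r in bc0; rewrite bE !mul0r add0r mulr_gt0// divr_gt0.
  rewrite ltr_pwDl//.
    by rewrite mulr_gt0// divr_gt0// lt0r bN.
  by rewrite mulr_ge0 ?divr_ge0// ltW.
transitivity ((gk R g * (u ^+ 2 + v ^+ 2) + w ^+ 2) / n ^+ 2).
  by rewrite /u /v /w; field; rewrite gt_eqF.
by rewrite nn divff// gt_eqF.
Qed.

(** The triangle is defined by joining [p1] to the opposite side. The description as a cone is
    symmetric, so each vertex can later take the place of [p1]. *)
Lemma triangle_cone g r (p1 p2 p3 : plane_of R g) z : 0 < r -> (g = Spherical -> r < pi / 3) ->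
  dist p1 p2 = 2 * r -> dist p2 p3 = 2 * r -> dist p3 p1 = 2 * r ->
  triangle p1 p2 p3 z <-> exists a b c, [/\ 0 <= a, 0 <= b, 0 <= c &
    coords z = comb3 a b c (coords p1) (coords p2) (coords p3)].
Proof.
move=> r0 rpi d12 d23 d31; have pi0 := pi_gt0 R.
have d13 : dist p1 p3 = 2 * r by rewrite dist_sym.
have side (p q w : plane_of R g) : dist p q = 2 * r ->
    segment p q w <-> exists a b, [/\ 0 <= a, 0 <= b &
      coords w = comb3 a b 0 (coords p) (coords q) (coords q)].
  move=> d; apply: segment_cone; rewrite d; first lra.
  by move=> /rpi; lra.
(* Averaging the triangle inequalities through [p2] and [p3] gives [r <= dist p1 y <= 3 * r], and
   [3 * r < pi] on the sphere. *)
have inner y : segment p2 p3 y -> 0 < dist p1 y /\ (g = Spherical -> dist p1 y < pi).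
  rewrite /segment /= d23 => h.
  have h1 := dist_triangle p1 p2 y; have h2 := dist_triangle p1 p3 y.
  have h3 := dist_triangle p1 y p2; have h4 := dist_triangle p1 y p3.
  rewrite [dist y p2]dist_sym in h3; rewrite [dist p3 y]dist_sym in h2.
  split; first lra.
  by move=> /rpi; lra.
have c0E w w' w'' a b : comb3 a b 0 w w' w'' = comb3 a b 0 w w' w'.
  by rewrite /comb3 !mul0r.
split.
- move=> [y /[dup] /inner[y0 ypi] /(side _ _ _ d23)[b [c [b0 c0 yE]]]].
  move=> /(segment_cone _ y0 ypi)[a [e [a0 e0 ->]]].
  exists a, (e * b), (e * c); split=> //; try exact: mulr_ge0.
  by rewrite yE /comb3 /=; congr (_, _, _); ring.
- move=> [a [b [c [a0 b0 c0 zE]]]].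
  have [bc|bc] := ltP 0 (b + c); last first.
    have [bE cE] : b = 0 /\ c = 0 by split; lra.
    exists p2; first by apply/(side _ _ _ d23); exists 1, 0; rewrite /comb3 !mul1r !mul0r !addr0 ler01 lexx; split=> //; case: (coords p2) => [[]].
    apply/(side _ _ _ d12); exists a, 0; split=> //.
    by rewrite zE bE cE /comb3 !mul0r.
  have [n n0 hs] := cone_norm r0 rpi d23 b0 c0 bc.
  have [y yE] := coords_surj hs.
  have hy : segment p2 p3 y.
    by apply/(side _ _ _ d23); exists (b / n), (c / n); split=> //; rewrite divr_ge0// ltW.
  exists y => //; have [y0 ypi] := inner _ hy; apply/(segment_cone _ y0 ypi).
  exists a, n; split=> //; first exact: ltW.
  rewrite zE yE /comb3 /=; congr (_, _, _); field; exact: lt0r_neq0.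
Qed.

(** The two linear conditions say that [sin (theta - u)] and [sin (theta + u)] are nonnegative. *)
Lemma wedge (theta u : R) : 0 < theta < pi / 2 ->
  (sin u * cos theta <= cos u * sin theta /\ - (sin u * cos theta) <= cos u * sin theta) <->
  cos theta <= cos u.
Proof.
move=> /andP[t0 t1]; have pi0 := pi_gt0 R.
have c0 : 0 < cos theta by apply: cos_gt0_pihalf; apply/andP; split; lra.
have s0 : 0 < sin theta by apply: sin_gt0_pi; apply/andP; split; lra.
have ct := cos2Dsin2 theta; have cu := cos2Dsin2 u.
split=> [[h1 h2]|h].
  have cu0 : 0 <= cos u by rewrite -(pmulr_lge0 _ s0); lra.
  rewrite -(ler_pXn2r (n := 2))// ?nnegrE ?(ltW c0)//.
  have h : (sin u * cos theta) ^+ 2 <= (cos u * sin theta) ^+ 2.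
    rewrite -[leLHS]real_normK ?num_real// ler_pXn2r// ?nnegrE ?mulr_ge0 ?(ltW s0)//.
    by rewrite ler_norml; lra.
  move: h; rewrite !exprMn.
  have -> : sin u ^+ 2 = 1 - cos u ^+ 2 by lra.
  have -> : sin theta ^+ 2 = 1 - cos theta ^+ 2 by lra.
  lra.
have cu0 : 0 <= cos u by lra.
have sa : `|sin u| <= sin theta.
  rewrite -(ler_pXn2r (n := 2))// ?nnegrE ?(ltW s0)// real_normK ?num_real//.
  have : cos theta ^+ 2 <= cos u ^+ 2 by rewrite ler_pXn2r// ?nnegrE ?(ltW c0).
  lra.
have key : `|sin u| * cos theta <= cos u * sin theta.
  by rewrite mulrC; apply: ler_pM => //; exact: ltW.
split; apply: le_trans key; rewrite ?ler_pM2r// -?mulNr ?ler_pM2r// ?ler_norm//.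
by rewrite -normrN ler_norm.
Qed.

(** [u] is an unreduced difference of angles; [v = acos (cos u)] is its absolute value modulo
    [2 * pi]. The disjunction records the sign lost, that is, which of the two sides of the corner
    is nearer. *)
Lemma corner_angle (theta u : R) : 0 < theta < pi / 2 -> cos theta <= cos u ->
  exists v, [/\ 0 <= v <= theta, cos u = cos v &
    (cos (u - theta) = cos (theta - v) /\ cos (u + theta) = cos (theta + v)) \/
    (cos (u - theta) = cos (theta + v) /\ cos (u + theta) = cos (theta - v))].
Proof.
move=> /andP[t0 t1] h; have pi0 := pi_gt0 R.
have u1 : -1 <= cos u <= 1 by rewrite cos_geN1 cos_le1.
have [v0 vE] := acos_def u1.
have sE : sin (acos (cos u)) = `|sin u|.
  rewrite sin_acos// -sqrtr_sqr; congr Num.sqrt; have := cos2Dsin2 u; lra.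
exists (acos (cos u)); split=> //.
  case/andP: v0 => v0 v1; rewrite v0 leNgt; apply/negP => tv.
  have : cos (acos (cos u)) < cos theta by rewrite cos_lt_pi//; apply/andP; split; lra.
  by rewrite vE; lra.
rewrite !cosB !cosD vE sE; have [s0|s0] := leP 0 (sin u).
  by left; rewrite ger0_norm//; split; ring.
by right; rewrite ltr0_norm//; split; ring.
Qed.

(* Below, [eta] is the half-angle cut off by the perpendicular bisectors of the two
   sides, and [u] is measured from the bisector of the angle of the corner. *)
Lemma corner_hi (theta eta u : R) : 0 < theta < pi / 2 -> 0 <= eta -> eta <= theta ->
  cos theta <= cos u -> cos (u - theta) <= cos eta -> cos (u + theta) <= cos eta ->
  cos (theta - eta) <= cos u.
Proof.
move=> ht e0 et /(corner_angle ht)[v [/andP[v0 vt] -> hv]] h1 h2; have pi0 := pi_gt0 R.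
have /andP[t0 t1] := ht.
have : eta <= theta - v.
  rewrite leNgt; apply/negP => h.
  have : cos eta < cos (theta - v) by rewrite cos_lt_pi; lra.
  by case: hv => -[a b]; lra.
by move=> h; rewrite leNgt cos_lt_pi -?leNgt; lra.
Qed.

Lemma corner_lo (theta eta u : R) : 0 < theta < pi / 2 -> 0 <= eta -> eta <= theta ->
  cos (theta - eta) < cos u ->
  [/\ cos theta <= cos u, cos (u - theta) < cos eta & cos (u + theta) < cos eta].
Proof.
move=> ht e0 et h; have pi0 := pi_gt0 R; have /andP[t0 t1] := ht.
have hu : cos theta <= cos u.
  apply: le_trans (ltW h); rewrite leNgt cos_lt_pi -?leNgt; lra.
have [v [/andP[v0 vt] uE hv]] := corner_angle ht hu.
have vw : v < theta - eta by move: h; rewrite uE cos_lt_pi; lra.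
have h1 : cos (theta - v) < cos eta by rewrite cos_lt_pi; lra.
have h2 : cos (theta + v) < cos eta by rewrite cos_lt_pi; lra.
by case: hv => -[-> ->]; split.
Qed.

(** * One corner of the regular triangle *)

Section Corner.
Variables (g : geometry) (Rc r : R).
Hypotheses (Rc0 : 0 < Rc) (Rc1 : g = Spherical -> Rc < pi / 2).
Hypotheses (r0 : 0 < r) (rR : r < Rc).
Hypothesis circum : gT g Rc ^+ 2 * (3 - gk R g * gT g r ^+ 2) = 4 * gT g r ^+ 2.
Local Notation T := (gT g Rc).
Local Notation theta := (phi g (gT g r) Rc).

Let tr0 : 0 < gT g r.
Proof. by apply: (gT_gt0 Rc1); rewrite r0 ltW. Qed.

Let trT : gT g r < T.
Proof. exact: (gT_incr Rc1 (ltW r0) rR (lexx _)). Qed.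

Let cr : 0 < gC g r.
Proof. by apply: (gC_gt0_Rc Rc1); rewrite !ltW. Qed.

Let sr : 0 < gS g r.
Proof. by apply: (gS_gt0_Rc Rc1); rewrite r0 ltW. Qed.

Lemma theta_range : 0 < theta < pi / 2.
Proof.
rewrite (asec_gt0 _) ?asec_lt// ltr_pdivlMr// mul1r; exact: trT.
Qed.

Lemma cos_theta : cos theta = gT g r / T.
Proof. exact: (cos_phi tr0 (ltW trT)). Qed.

Lemma cos_theta_gt0 : 0 < cos theta.
Proof. by rewrite cos_theta divr_gt0// (lt_trans tr0). Qed.

Lemma sin_theta_gt0 : 0 < sin theta.
Proof.
have /andP[t0 t1] := theta_range; have pi0 := pi_gt0 R.
by apply: sin_gt0_pi; apply/andP; split; lra.
Qed.

Lemma sqr_cos_theta : 4 * cos theta ^+ 2 = 3 - gk R g * gT g r ^+ 2.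
Proof.
have T0 : 0 < T by exact: lt_trans trT.
rewrite cos_theta expr_div_n mulrA -circum.
by rewrite mulrC mulKf// expf_neq0// gt_eqF.
Qed.

Lemma kt_gtN1 : 0 < 1 + gk R g * gT g r ^+ 2.
Proof. by rewrite -(gCV cr) invr_gt0 exprn_gt0. Qed.

(** Says that the circumcentre lies on the side of [p1] with respect to the line through [p2] and
    [p3]. *)
Lemma gC_double_le : gC g (2 * r) <= 2 * gC g r ^+ 2 * cos theta ^+ 2.
Proof.
rewrite gC_double; have h1 := sqr_cos_theta; have h2 := kt_gtN1.
have -> : gC g r ^+ 2 - gk R g * gS g r ^+ 2 = gC g r ^+ 2 * (1 - gk R g * gT g r ^+ 2).
  by rewrite /gT; field; rewrite gt_eqF.
have -> : 2 * gC g r ^+ 2 * cos theta ^+ 2 = gC g r ^+ 2 * (2 * cos theta ^+ 2) by ring.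
by rewrite ler_pM2l ?exprn_gt0//; lra.
Qed.

Lemma half_plane_near_lt x u : 0 < x -> x <= Rc -> cos u < cos (phi g (gT g r) x) ->
  gS g x * gC g r * cos u < gC g x * gS g r.
Proof.
move=> x0 xR; have hx : 0 <= x <= Rc by rewrite ltW.
have cx : 0 < gC g x by exact: (gC_gt0_Rc Rc1).
have tx : 0 < gT g x by apply: (gT_gt0 Rc1); rewrite x0.
have -> : gS g x * gC g r * cos u = gC g x * gC g r * (gT g x * cos u).
  by rewrite /gT; field; rewrite gt_eqF.
have -> : gC g x * gS g r = gC g x * gC g r * gT g r by rewrite /gT; field; rewrite gt_eqF.
rewrite ltr_pM2l ?mulr_gt0//.
have [h|h] := leP (gT g x) (gT g r).
  by rewrite (phi0 Rc1 tr0 hx h) cos0 => h1; apply: lt_le_trans h; rewrite gtr_pMr.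
rewrite (cos_phi tr0 (ltW h)) => h1; rewrite mulrC.
by move: tx h1; move: (gT g x) (gT g r) => a b a0; rewrite ltr_pdivlMr.
Qed.

Section Chart.
Variables (Tri : set (plane_of R g)) (p1 p2 p3 : plane_of R g) (E : R -> R -> plane_of R g).
Variable psi0 : R.
Hypotheses (chE : is_chart p1 E) (psi0_turn : 0 <= psi0 < 2 * pi).
Hypotheses (p2E : p2 = E (2 * r) (psi0 - theta)) (p3E : p3 = E (2 * r) (psi0 + theta)).
Hypothesis r_pi : g = Spherical -> r < pi / 3.
Hypothesis TriE : forall z, Tri z <-> exists a b c, [/\ 0 <= a, 0 <= b, 0 <= c &
  coords z = comb3 a b c (coords p1) (coords p2) (coords p3)].

Let s2 : 0 < gS g (2 * r).
Proof. by apply: gS_gt0; [rewrite mulr_gt0|move=> /r_pi; have := pi_gt0 R; lra]. Qed.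

(** In coordinates turned so that the bisector of the angle at [p1] is the first axis, these are the
    signs of the coefficients of [p2], [p3] and [p1], in this order. *)
Definition in_cone w : Prop :=
  let X := w.1.1 * cos psi0 + w.1.2 * sin psi0 in
  let Y := w.1.2 * cos psi0 - w.1.1 * sin psi0 in
  [/\ Y * cos theta <= X * sin theta, - (Y * cos theta) <= X * sin theta &
     X * gC g (2 * r) <= w.2 * (gS g (2 * r) * cos theta)].

Lemma in_coneP w : in_cone w <-> exists a b c, [/\ 0 <= a, 0 <= b, 0 <= c &
  w = comb3 a b c (0, 0, 1) (polar g (2 * r) (psi0 - theta)) (polar g (2 * r) (psi0 + theta))].
Proof.
have ct := cos_theta_gt0; have st := sin_theta_gt0; have cs := cos2Dsin2 psi0.
case: w => [[x y] z]; rewrite /in_cone /=.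
set X := x * _ + _; set Y := y * _ - _.
have xE : x = X * cos psi0 - Y * sin psi0.
  transitivity (x * (cos psi0 ^+ 2 + sin psi0 ^+ 2)); first by rewrite cs mulr1.
  by rewrite /X /Y; ring.
have yE : y = X * sin psi0 + Y * cos psi0.
  transitivity (y * (cos psi0 ^+ 2 + sin psi0 ^+ 2)); first by rewrite cs mulr1.
  by rewrite /X /Y; ring.
have D0 : 0 < 2 * gS g (2 * r) * (sin theta * cos theta) by rewrite !mulr_gt0.
rewrite /comb3 /polar /= cosB sinB cosD sinD; split.
- move=> [h1 h2 h3].
  exists (z - X * gC g (2 * r) / (gS g (2 * r) * cos theta)),
    ((X * sin theta - Y * cos theta) / (2 * gS g (2 * r) * (sin theta * cos theta))),
    ((X * sin theta + Y * cos theta) / (2 * gS g (2 * r) * (sin theta * cos theta))); split.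
  + by rewrite subr_ge0 ler_pdivrMr// mulr_gt0.
  + by rewrite divr_ge0 ?(ltW D0)// subr_ge0.
  + by rewrite divr_ge0 ?(ltW D0)//; lra.
  + rewrite {1}xE {1}yE; congr (_, _, _); field; rewrite ?gt_eqF//=; apply/and3P; split; exact: lt0r_neq0.
- move=> [a [b [c [a0 b0 c0 [e1 e2 e3]]]]].
  have XE : X = gS g (2 * r) * cos theta * (b + c).
    transitivity (gS g (2 * r) * cos theta * (b + c) * (cos psi0 ^+ 2 + sin psi0 ^+ 2)).
      by rewrite /X e1 e2; ring.
    by rewrite cs mulr1.
  have YE : Y = gS g (2 * r) * sin theta * (c - b).
    transitivity (gS g (2 * r) * sin theta * (c - b) * (cos psi0 ^+ 2 + sin psi0 ^+ 2)).
      by rewrite /Y e1 e2; ring.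
    by rewrite cs mulr1.
  have D1 : 0 < gS g (2 * r) * sin theta * cos theta by rewrite !mulr_gt0.
  split.
  + have := mulr_ge0 (ltW D1) b0; rewrite XE YE; lra.
  + have := mulr_ge0 (ltW D1) c0; rewrite XE YE; lra.
  + have := mulr_ge0 a0 (ltW (mulr_gt0 s2 ct)); rewrite XE e3; lra.
Qed.

Lemma measurable_in_cone : measurable [set w | in_cone w].
Proof.
have m1 : measurable_fun setT (fun v : R * R * R => v.1.1).
  exact: measurableT_comp measurable_fst measurable_fst.
have m2 : measurable_fun setT (fun v : R * R * R => v.1.2).
  exact: measurableT_comp measurable_snd measurable_fst.
have m3 : measurable_fun setT (fun v : R * R * R => v.2) by exact: measurable_snd.
have mX : measurable_fun setT (fun v : R * R * R => v.1.1 * cos psi0 + v.1.2 * sin psi0).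
  by apply: measurable_funD; exact: measurable_funM.
have mY : measurable_fun setT (fun v : R * R * R => v.1.2 * cos psi0 - v.1.1 * sin psi0).
  by apply: measurable_funB; exact: measurable_funM.
set A := [set v : R * R * R | (v.1.2 * cos psi0 - v.1.1 * sin psi0) * cos theta <=
  (v.1.1 * cos psi0 + v.1.2 * sin psi0) * sin theta].
set B := [set v : R * R * R | - ((v.1.2 * cos psi0 - v.1.1 * sin psi0) * cos theta) <=
  (v.1.1 * cos psi0 + v.1.2 * sin psi0) * sin theta].
set C := [set v : R * R * R | (v.1.1 * cos psi0 + v.1.2 * sin psi0) * gC g (2 * r) <=
  v.2 * (gS g (2 * r) * cos theta)].
rewrite (_ : [set w | _] = A `&` B `&` C); last first.
  by apply/seteqP; split=> w [] //= [].
apply: measurableI; first apply: measurableI.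
- by apply: measurable_set_ler; exact: measurable_funM.
- by apply: measurable_set_ler; [apply: measurable_funN|]; exact: measurable_funM.
- by apply: measurable_set_ler; exact: measurable_funM.
Qed.

Lemma Tri_chart x p : Tri (E x p) <-> in_cone (polar g x p).
Proof.
have [t [s [Is ht pE EE]]] := chE; rewrite TriE in_coneP.
split=> -[a [b [c [a0 b0 c0 h]]]]; exists a, b, c; split=> //; move: h;
  rewrite p2E p3E pE !EE -rot_comb3 -boost_comb3; [exact: chart_coords_inj|by move->].
Qed.

Lemma borel_Tri : borel Tri.
Proof.
have [t [s [Is ht pE EE]]] := chE.
exists [set w | [set w | [set w | in_cone w] (boost g (- s) w)] (rot (- t) w)].
  exact: (measurable_rot (- t) (measurable_boost g (- s) measurable_in_cone)).
move=> z; have [x [p [Ix hp ->]]] := chart_surj chE z.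
by rewrite Tri_chart /= EE rotN boostN.
Qed.

Lemma in_cone_polar x p : 0 < gS g x -> in_cone (polar g x p) <->
  cos theta <= cos (p - psi0) /\
  gS g x * cos (p - psi0) * gC g (2 * r) <= gC g x * (gS g (2 * r) * cos theta).
Proof.
move=> Sx; rewrite /in_cone /polar /=.
have -> : gS g x * cos p * cos psi0 + gS g x * sin p * sin psi0 = gS g x * cos (p - psi0).
  by rewrite cosB; ring.
have -> : gS g x * sin p * cos psi0 - gS g x * cos p * sin psi0 = gS g x * sin (p - psi0).
  by rewrite sinB; ring.
rewrite -(wedge _ theta_range) -!mulrA -mulrN !ler_pM2l//.
by split=> [[]|[[]]].
Qed.

(** The sum of the two bisector inequalities amounts to [gT x * cos (p - psi0) <= gT Rc], so the
    point is not beyond the circumcentre along the bisector; [gC_double_le] then keeps it on the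
    inner side of the line through [p2] and [p3]. *)
Lemma corner_near x p : 0 <= x -> x <= Rc -> 0 < gS g x ->
  cos theta <= cos (p - psi0) ->
  gS g x * gC g r * cos (p - psi0 - theta) <= gC g x * gS g r ->
  gS g x * gC g r * cos (p - psi0 + theta) <= gC g x * gS g r -> in_cone (polar g x p).
Proof.
move=> x0 xR Sx hu h1 h2; apply/in_cone_polar => //; split=> //.
have ct := cos_theta_gt0; set c := cos (p - psi0) in hu *.
have cx : 0 < gC g x by apply: (gC_gt0_Rc Rc1); rewrite x0.
have sum : gS g x * gC g r * (c * cos theta) <= gC g x * gS g r.
  have -> : c * cos theta = (cos (p - psi0 - theta) + cos (p - psi0 + theta)) / 2.
    by rewrite [cos (_ - theta)]cosB [cos (_ + theta)]cosD -/c; field.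
  lra.
have [C2|C2] := leP (gC g (2 * r)) 0.
  apply: (@le_trans _ _ 0); last by rewrite ltW// mulr_gt0// mulr_gt0.
  by rewrite mulr_ge0_le0// mulr_ge0// ltW// (lt_le_trans ct).
rewrite -(@ler_pM2r _ (gC g r * cos theta)) ?mulr_gt0//.
apply: (@le_trans _ _ (gC g x * gS g r * gC g (2 * r))).
  have := ler_wpM2r (ltW C2) sum; apply: le_trans.
  by rewrite le_eqVlt; apply/orP; left; apply/eqP; ring.
rewrite gS_double; apply: (@le_trans _ _ (gC g x * gS g r * (2 * gC g r ^+ 2 * cos theta ^+ 2))).
  by rewrite ler_wpM2l ?gC_double_le// ltW// mulr_gt0.
by rewrite le_eqVlt; apply/orP; left; apply/eqP; ring.
Qed.

(** The circumcentre is the farthest point of the corner. One of the two sides is within angle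
    [theta] of the point, and its bisector inequality forces [gS g (x - Rc) <= 0]. *)
Lemma corner_far x p : Rc < x -> (g = Spherical -> x <= pi) -> 0 < gS g x ->
  cos theta <= cos (p - psi0) ->
  gS g x * gC g r * cos (p - psi0 - theta) <= gC g x * gS g r ->
  gS g x * gC g r * cos (p - psi0 + theta) <= gC g x * gS g r -> False.
Proof.
move=> xR xpi Sx hu h1 h2; have pi0 := pi_gt0 R.
have [v [/andP[v0 vt] _ hv]] := corner_angle theta_range hu.
have /andP[t0 t1] := theta_range.
have cv : cos theta <= cos (theta - v) by rewrite leNgt cos_lt_pi -?leNgt; lra.
have h : gS g x * gC g r * cos (theta - v) <= gC g x * gS g r by case: hv => -[e1 e2]; rewrite -?e1 -?e2.
have {}h : gS g x * gC g r * (gT g r / T) <= gC g x * gS g r.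
  by rewrite -cos_theta; apply: le_trans h; rewrite ler_pM2l// mulr_gt0.
have cR : 0 < gC g Rc by apply: (gC_gt0_Rc Rc1); rewrite lexx ltW.
have sR : 0 < gS g Rc by apply: (gS_gt0_Rc Rc1); rewrite lexx Rc0.
have e : gS g x * gC g r * (gT g r / T) = gS g x * gC g Rc / gS g Rc * gS g r.
  by rewrite /gT; field; rewrite !gt_eqF.
rewrite e ler_pM2r// ler_pdivrMr// in h.
have : 0 < gS g (x - Rc).
  apply: gS_gt0; first by rewrite subr_gt0.
  by move=> /xpi; apply: lt_le_trans; rewrite ltrBlDr ltrDl.
by rewrite gSB; lra.
Qed.

Variable W : set (plane_of R g).
Variable rho : R.
Hypotheses (rho0 : 0 <= rho) (rhoR : rho <= Rc).
Hypothesis borelW : borel W.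
(** [W] is only sandwiched between the open and the closed corner, since the corners cut from the
    triangle treat ties differently. The radial bound in [W_hi] is conditional, so that the whole
    triangle is covered by the case [rho = Rc]. *)
Hypothesis W_lo : forall z, Tri z -> dist z p1 < dist z p2 -> dist z p1 < dist z p3 ->
  dist p1 z <= rho -> W z.
Hypothesis W_hi : forall z, W z -> [/\ Tri z, dist z p1 <= dist z p2, dist z p1 <= dist z p3 &
  dist p1 z <= Rc -> dist p1 z <= rho].

Let rpi : g = Spherical -> r < pi.
Proof. by move=> /r_pi; have := pi_gt0 R; lra. Qed.

Let E_p2 x p : (dist (E x p) p1 <= dist (E x p) p2) =
  (gS g x * gC g r * cos (p - psi0 + theta) <= gC g x * gS g r).
Proof. by rewrite p2E (chart_half_plane _ _ _ chE r0 rpi) opprB addrA addrAC. Qed.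

Let E_p3 x p : (dist (E x p) p1 <= dist (E x p) p3) =
  (gS g x * gC g r * cos (p - psi0 - theta) <= gC g x * gS g r).
Proof. by rewrite p3E (chart_half_plane _ _ _ chE r0 rpi) opprD addrA. Qed.

Lemma corner_slice x : 0 < x -> x <= rho ->
  circle [set p | W (E x p)] = (2 * width g Rc (gT g r) x)%:E.
Proof.
move=> x0 xr; have xR := le_trans xr rhoR; have pi0 := pi_gt0 R.
have hx : 0 <= x <= Rc by rewrite ltW.
have Ix : idom g x by apply/idomP; split; [exact: ltW|move=> /Rc1; lra].
have Sx : 0 < gS g x by apply: (gS_gt0_Rc Rc1); rewrite x0.
have /andP[t0 t1] := theta_range.
have e0 : 0 <= phi g (gT g r) x by exact: phi_ge0.
have et : phi g (gT g r) x <= theta by exact: (phi_homo Rc1 tr0 (ltW x0) xR (lexx _)).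
have -> : 2 * width g Rc (gT g r) x = 2 * (width g Rc (gT g r) x - 0) by rewrite subr0.
have wE : width g Rc (gT g r) x = theta - phi g (gT g r) x by [].
apply: (@circle_arc _ _ psi0) => //.
- exact: (measurable_slice chE).
- by rewrite wE; lra.
- by rewrite wE; lra.
- by move=> p; rewrite /= (chart_period chE).
- move=> p /andP[h _]; rewrite wE in h.
  have [hu h1 h2] := corner_lo theta_range e0 et h.
  have h1' := half_plane_near_lt x0 xR h1; have h2' := half_plane_near_lt x0 xR h2.
  apply: W_lo.
  + by apply/Tri_chart; apply: corner_near => //; exact: ltW.
  + by rewrite p2E (chart_half_plane_lt _ _ _ chE r0 rpi) opprB addrA addrAC.
  + by rewrite p3E (chart_half_plane_lt _ _ _ chE r0 rpi) opprD addrA.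
  + by rewrite (chart_dist0 chE).
- move=> p /W_hi[/Tri_chart/in_cone_polar[]// hu _]; rewrite E_p2 E_p3.
  rewrite (half_plane_near Rc1 _ (ltW x0) xR r0 rR) (half_plane_near Rc1 _ (ltW x0) xR r0 rR).
  move=> h2 h1 _; rewrite wE cos0 cos_le1 andbT.
  exact: (corner_hi theta_range e0 et hu h1 h2).
Qed.

Lemma corner_area : area W = (2 * sector g Rc (gT g r) rho)%:E.
Proof.
rewrite (chart_area chE borelW).
have int1 := integrable_sector Rc1 (gT g r) rho0 rhoR.
transitivity (\int[mu]_(x in `[0%R, rho]) (gS g x * (2 * width g Rc (gT g r) x))%:E)%E; last first.
  have e : (fun x => gS g x * (2 * width g Rc (gT g r) x)) =
    (fun x => 2 * (gS g x * width g Rc (gT g r) x)) by apply/funext => x; rewrite mulrCA.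
  have int2 : mu.-integrable `[0, rho] (EFin \o (fun x => gS g x * (2 * width g Rc (gT g r) x))).
    by rewrite e; have := @integrableZl _ _ R mu `[0, rho] _ 2 _ int1; apply.
  rewrite Rintegral_EFin//; congr EFin; rewrite e; exact: RintegralZl.
rewrite integral_mkcond [RHS]integral_mkcond; apply: eq_integral => x _; rewrite !patchE.
have pi0 := pi_gt0 R.
case: ifPn => [/set_mem Ix|/negP Ix]; case: ifPn => [/set_mem|/negP] //=.
- rewrite in_itv/= => /andP[x0 xr]; move: x0; rewrite le_eqVlt => /predU1P[<-|x0].
    by rewrite gS0 !mul0r mul0e.
  by rewrite corner_slice.
- rewrite /= => hx; have [x0 xpi] := (idomP g x).1 Ix.
  have xr : rho < x.
    rewrite ltNge; apply/negP => xr; apply: hx; apply/mem_set; rewrite /= in_itv/= x0.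
    exact: xr.
  have [Sx|Sx] := ltP 0 (gS g x); last first.
    have -> : gS g x = 0 by apply/le_anti; rewrite Sx gS_ge0.
    by rewrite mul0e.
  rewrite (_ : [set p | _] = set0) ?/circle ?setI0 ?measure0 ?mule0// -subset0 => p.
  move=> /W_hi[/Tri_chart/in_cone_polar[]// hu _]; rewrite E_p2 E_p3 (chart_dist0 chE)//.
  move=> h2 h1 h3; have [xR|Rx] := leP x Rc; first by have := h3 xR; lra.
  exact: (corner_far Rx xpi Sx hu h1 h2).
- move=> h; exfalso; apply: Ix; apply/mem_set/idomP.
  move: h; rewrite /= in_itv/= => /andP[x0 xr]; split=> // /Rc1 Rpi.
  by apply: (le_trans (le_trans xr rhoR)); apply: (le_trans (ltW Rpi)); lra.
Qed.

End Chart.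
End Corner.

Lemma circumradius_tan g (T : R) : 0 < T -> (g = Hyperbolic -> T < 1) ->
  exists Rc, [/\ 0 < Rc, g = Spherical -> Rc < pi / 2 & gT g Rc = T].
Proof.
move=> T0 T1; rewrite /gT; case: g T1 => [_|_|/(_ erefl) T1] /=.
- by exists T; rewrite divr1.
- exists (atan T); split; last by rewrite -/(tan _) atanK.
    by rewrite -atan0 lt_atan.
  by move=> _; exact: atan_ltpi2.
(* [ln e / 2] is the inverse hyperbolic tangent of [T]. *)
- pose e := (1 + T) / (1 - T).
  have e1 : 1 < e by rewrite ltr_pdivlMr; lra.
  have e0 : 0 < e by exact: lt_trans e1.
  exists (ln e / 2); split=> //; first by rewrite divr_gt0// ln_gt0.
  have h : expR (ln e / 2) ^+ 2 = e by rewrite expr2 -expRD -splitr lnK.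
  rewrite /sinh /cosh expRN; have := expR_gt0 (ln e / 2); move: (expR _) h => s h s0.
  have -> : (s - s^-1) / 2 / ((s + s^-1) / 2) = (s ^+ 2 - 1) / (s ^+ 2 + 1).
    have sp : 0 < s ^+ 2 + 1 by rewrite addr_gt0// exprn_gt0.
    by field; rewrite !gt_eqF//= -?expr2 ?sp.
  rewrite h /e; field; rewrite !gt_eqF//; lra.
Qed.

Lemma circumradius g (r : R) : 0 < r -> (g = Spherical -> r < pi / 3) ->
  exists Rc, [/\ 0 < Rc, g = Spherical -> Rc < pi / 2, r < Rc &
    gT g Rc ^+ 2 * (3 - gk R g * gT g r ^+ 2) = 4 * gT g r ^+ 2].
Proof.
move=> r0 rpi; have pi0 := pi_gt0 R.
have rpi2 : g = Spherical -> r < pi / 2 by move=> /rpi; lra.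
have c0 : 0 < gC g r by apply: gC_gt0 => //; exact: ltW.
have s0 : 0 < gS g r by apply: gS_gt0 => // /rpi2; lra.
have t0 : 0 < gT g r by exact: divr_gt0.
have kt := gCV c0; have kt0 : 0 < 1 + gk R g * gT g r ^+ 2 by rewrite -kt invr_gt0 exprn_gt0.
(* On the sphere this is [tan r ^ 2 < 3], that is, [r < pi / 3]. *)
have d0 : 0 < 3 - gk R g * gT g r ^+ 2.
  case: g rpi {rpi2} c0 s0 t0 kt kt0 => /= rpi c0 s0 t0 kt kt0; [lra| |have := sqr_ge0 (gT Hyperbolic r); lra].
  have ch := cos_gt_half r0 (rpi erefl).
  have c2 : 1 / 4 < cos r ^+ 2 by have := cos_gt_half r0 (rpi erefl); nra.
  have : cos r ^- 2 < 4.
    by rewrite -[X in _ < X]invrK ltf_pV2 ?posrE ?exprn_gt0//; lra.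
  by rewrite kt; lra.
pose T2 := 4 * gT g r ^+ 2 / (3 - gk R g * gT g r ^+ 2).
have T20 : 0 < T2 by rewrite divr_gt0// mulr_gt0// exprn_gt0.
have tT2 : gT g r ^+ 2 < T2.
  rewrite ltr_pdivlMr// mulrC ltr_pM2r ?exprn_gt0//; lra.
pose T := Num.sqrt T2.
have T0 : 0 < T by rewrite sqrtr_gt0.
have TT : T ^+ 2 = T2 by rewrite sqr_sqrtr// ltW.
have tT : gT g r < T by rewrite -(ltr_pXn2r (n := 2))// ?nnegrE ?ltW// TT.
have T1 : g = Hyperbolic -> T < 1.
  move=> gE; rewrite -(ltr_pXn2r (n := 2))// ?nnegrE ?ltW// TT expr1n /T2 ltr_pdivrMr// mul1r.
  by move: kt0; rewrite gE /=; lra.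
have [Rc [Rc0 Rc1 RT]] := circumradius_tan T0 T1.
exists Rc; split=> //; last by rewrite RT TT /T2 divfK// gt_eqF.
rewrite ltNge; apply/negP => Rr.
have := gT_le rpi2 (ltW Rc0) Rr (lexx _); rewrite RT; lra.
Qed.

Lemma chart_ext g (q : plane_of R g) E x a b : is_chart q E -> cos (a - b) = 1 -> E x a = E x b.
Proof.
move=> [t [s [_ _ _ EE]]] /cos_eq1[ca sa]; apply: coords_inj.
by rewrite !EE /polar ca sa.
Qed.

Let integrand_ge0 g (P : R -> set R) x : idom g x -> (0 <= (gS g x)%:E * circle (P x))%E.
Proof. by move=> Ix; apply: mule_ge0; [rewrite lee_fin gS_ge0|exact: circle_ge0]. Qed.

Let measurable_integrand g (q : plane_of R g) E A : is_chart q E -> borel A ->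
  measurable_fun (idom g) (fun x => (gS g x)%:E * circle [set p | A (E x p)])%E.
Proof.
move=> chE nA; apply: emeasurable_funM.
  by apply/measurable_EFinP; apply: measurable_funTS; exact: measurable_gS.
by apply: measurable_funTS; exact: (measurable_circle chE).
Qed.

Lemma circle_le (P Q : set R) : measurable P -> measurable Q -> P `<=` Q ->
  (circle P <= circle Q)%E.
Proof.
move=> mP mQ PQ; apply: le_measure; rewrite ?inE; try by apply: measurableI => //; exact: measurable_itv.
by move=> x [? /PQ ?].
Qed.

Lemma area_le g (A B : set (plane_of R g)) : borel A -> borel B -> A `<=` B ->
  (area A <= area B)%E.
Proof.
move=> nA nB AB.
have [q _] := coords_surj (polar_surface g 0 0); have [E chE] := chart_exists q.
rewrite !(chart_area chE)//; apply: ge0_le_integral => //=.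
- exact: measurable_idom.
- by move=> x Ix; exact: (integrand_ge0 (fun x => [set p | A (E x p)])).
- exact: measurable_integrand chE nA.
- exact: measurable_integrand chE nB.
move=> x Ix; apply: lee_wpmul2l; first by rewrite lee_fin gS_ge0.
by apply: circle_le; [exact: (measurable_slice chE)|exact: (measurable_slice chE)|move=> p; exact: AB].
Qed.

Lemma areaU g (A B : set (plane_of R g)) : borel A -> borel B -> A `&` B = set0 ->
  area (A `|` B) = (area A + area B)%E.
Proof.
move=> nA nB AB.
have [q _] := coords_surj (polar_surface g 0 0); have [E chE] := chart_exists q.
rewrite (chart_area chE nA) (chart_area chE nB) (chart_area chE (borelU nA nB)).
have mturn : measurable turn by exact: measurable_itv.
transitivity (\int[mu]_(x in idom g) ((gS g x)%:E * circle [set p | A (E x p)] +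
    (gS g x)%:E * circle [set p | B (E x p)]))%E.
  apply: eq_integral => x _; rewrite -ge0_muleDr ?circle_ge0//; congr (_ * _)%E.
  rewrite /circle -mu_setU.
  - by congr (mu _); apply/seteqP; split=> p /=; [move=> [? []]; [left|right]|move=> [[? ?]|[? ?]]; split=> //; [left|right]].
  - by apply: measurableI => //; exact: (measurable_slice chE).
  - by apply: measurableI => //; exact: (measurable_slice chE).
  - rewrite -subset0 => p [[_ /= Ap] [_ /= Bp]].
    by have : (A `&` B) (E x p) by []; rewrite AB.
apply: ge0_integralD => //=.
- exact: measurable_idom.
- by move=> x Ix; exact: (integrand_ge0 (fun x => [set p | A (E x p)])).
- exact: measurable_integrand chE nA.
- by move=> x Ix; exact: (integrand_ge0 (fun x => [set p | B (E x p)])).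
- exact: measurable_integrand chE nB.
Qed.

Lemma area_within g (q : plane_of R g) E (A : set (plane_of R g)) rho : is_chart q E ->
  borel A -> (g = Spherical -> rho <= pi) ->
  area (body (Disk q rho) `&` A) =
  (\int[mu]_(x in `[0%R, rho]) ((gS g x)%:E * circle [set p | A (E x p)]))%E.
Proof.
move=> chE nA rpi; rewrite (chart_area chE (borelI (borel_ball q rho) nA)).
rewrite integral_mkcond [RHS]integral_mkcond; apply: eq_integral => x _; rewrite !patchE.
case: ifPn => [/set_mem Ix|/negP Ix]; case: ifPn => [/set_mem|/negP] //=.
- rewrite in_itv/= => /andP[x0 xr]; congr (_ * circle _)%E; apply/seteqP; split=> p /= .
    by move=> [].
  by move=> ?; split=> //; rewrite /body /= (chart_dist0 chE).
- move=> hx; have [x0 xpi] := (idomP g x).1 Ix.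
  rewrite (_ : [set p | _] = set0) ?/circle ?setI0 ?measure0 ?mule0// -subset0 => p [].
  rewrite /body /= (chart_dist0 chE)// => xr; exfalso; apply: hx; apply/mem_set.
  by rewrite /= in_itv/= x0.
- move=> h; exfalso; apply: Ix; apply/mem_set/idomP.
  by move: h; rewrite /= in_itv/= => /andP[x0 xr]; split=> // /rpi; apply: le_trans.
Qed.

Lemma disk_integral g rho : 0 < rho -> (\int[mu]_(x in `[0%R, rho]) gS g x)%R = gf g rho.
Proof.
move=> p0; rewrite /Rintegral (@continuous_FTC2 _ _ (gf g))//=.
- by rewrite gf0 subr0.
- by apply: continuous_subspaceT; exact: continuous_gS.
- have cf z : {for z, continuous (gf g)} by apply: is_derive_continuous (is_derive_gf g z).
  split; [|exact/cvg_at_right_filter/cf|exact/cvg_at_left_filter/cf].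
  by move=> z _; have [] := is_derive_gf g z.
- by move=> z _; rewrite derive1E; have /@derive_val -> := is_derive_gf g z.
Qed.

Lemma gf_gt0 g x : 0 < x -> (g = Spherical -> x < pi) -> 0 < gf g x :> R.
Proof.
move=> x0 h; have S0 := gS_gt0 x0 h; rewrite /gf; have := gC2S2 g x.
case: g h S0 => /= h S0 CS; first by rewrite divr_gt0// exprn_gt0.
- by rewrite mul1r subr_gt0; nra.
- have := cosh_gt0 x; nra.
Qed.

(** * The regular triangle as the union of its three corners *)

Section RegularTriangle.
Variables (g : geometry) (Rc r : R).
Hypotheses (Rc0 : 0 < Rc) (Rc1 : g = Spherical -> Rc < pi / 2).
Hypotheses (r0 : 0 < r) (rR : r < Rc) (r_pi : g = Spherical -> r < pi / 3).
Hypothesis circum : gT g Rc ^+ 2 * (3 - gk R g * gT g r ^+ 2) = 4 * gT g r ^+ 2.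
Local Notation theta := (phi g (gT g r) Rc).

Definition is_cone (Tri : set (plane_of R g)) (p1 p2 p3 : plane_of R g) := forall z, Tri z <->
  exists a b c, [/\ 0 <= a, 0 <= b, 0 <= c &
    coords z = comb3 a b c (coords p1) (coords p2) (coords p3)].

Lemma is_cone_swap Tri p1 p2 p3 : is_cone Tri p1 p2 p3 -> is_cone Tri p1 p3 p2.
Proof.
move=> h z; rewrite h; split=> -[a [b [c [? ? ? ->]]]]; exists a, c, b; split=> //;
  by rewrite /comb3; congr (_, _, _); ring.
Qed.

Lemma is_cone_rot Tri p1 p2 p3 : is_cone Tri p1 p2 p3 -> is_cone Tri p2 p3 p1.
Proof.
move=> h z; rewrite h; split=> -[a [b [c [? ? ? ->]]]]; [exists b, c, a|exists c, a, b]; split=> //;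
  by rewrite /comb3; congr (_, _, _); ring.
Qed.

(** So far [theta] is only an angle computed from [Rc] and [r]; the law of cosines at [p1]
    identifies it as half the angle of the triangle. *)
Lemma corner_angle_cos (p1 p2 p3 : plane_of R g) E a b : is_chart p1 E ->
  p2 = E (2 * r) a -> p3 = E (2 * r) b -> dist p2 p3 = 2 * r -> cos (b - a) = cos (2 * theta).
Proof.
move=> chE -> -> d23; have := chart_chord chE (2 * r) (2 * r) a b.
rewrite d23 subrr mul0r gS0 expr0n/= mulr0 add0r gS_double.
have -> : 2 * r / 2 = r by field.
have cr : 0 < gC g r by apply: (gC_gt0_Rc Rc1); rewrite !ltW.
have sr : 0 < gS g r by apply: (gS_gt0_Rc Rc1); rewrite r0 ltW.
have h := sqr_cos_theta Rc1 r0 rR circum.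
rewrite -cosN opprB => e.
have e1 : gC g r ^- 2 = 2 * (1 - cos (b - a)).
  apply: (@mulfI _ (4 * gS g r ^+ 2 * gC g r ^+ 2)); first by rewrite !mulf_neq0 ?expf_neq0 ?gt_eqF.
  by rewrite mulfK ?expf_neq0 ?gt_eqF//; apply: (etrans e); ring.
have -> : 2 * theta = theta + theta by ring.
rewrite (cosD theta theta) -!expr2; move: (cos2Dsin2 theta) e1 h; rewrite (gCV cr).
move: (cos theta ^+ 2) (sin theta ^+ 2) (gk R g * _) (cos (b - a)) => ct st kt c e2 e1 h; lra.
Qed.

Lemma oriented_chart (p1 p2 p3 : plane_of R g) E a b :
  p2 = E (2 * r) a -> p3 = E (2 * r) b -> is_chart p1 E -> 0 <= a < 2 * pi ->
  cos (b - a - 2 * theta) = 1 -> exists psi0, [/\ 0 <= psi0 < 2 * pi,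
    p2 = E (2 * r) (psi0 - theta) & p3 = E (2 * r) (psi0 + theta)].
Proof.
move=> p2E p3E chE /andP[a0 a2] cE; have pi0 := pi_gt0 R.
have /andP[t0 t1] := theta_range Rc1 r0 rR.
have [h|h] := ltP (a + theta) (2 * pi).
  exists (a + theta); split; first by apply/andP; split; lra.
    by rewrite addrK.
  by rewrite p3E; apply: (chart_ext _ chE); rewrite -cE; congr cos; ring.
exists (a + theta - 2 * pi); split; first by apply/andP; split; lra.
  rewrite p2E; apply: (chart_ext _ chE).
  have -> : a - (a + theta - 2 * pi - theta) = 0 + 2 * pi by ring.
  by rewrite cos_period cos0.
rewrite p3E; apply: (chart_ext _ chE).
transitivity (cos (b - a - 2 * theta + 2 * pi)); last by rewrite cos_period.
by congr cos; ring.
Qed.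

(** The side lengths determine only the cosine of the angle at [p1]; the sign of its sine, the
    orientation, decides which of [p2] and [p3] comes first. *)
Lemma corner_chart (p1 p2 p3 : plane_of R g) :
  dist p1 p2 = 2 * r -> dist p2 p3 = 2 * r -> dist p3 p1 = 2 * r ->
  exists E psi0, is_chart p1 E /\ 0 <= psi0 < 2 * pi /\
    (p2 = E (2 * r) (psi0 - theta) /\ p3 = E (2 * r) (psi0 + theta) \/
     p3 = E (2 * r) (psi0 - theta) /\ p2 = E (2 * r) (psi0 + theta)).
Proof.
move=> d12 d23 d31.
have d13 : dist p1 p3 = 2 * r by rewrite dist_sym.
have [E chE] := chart_exists p1.
have [x2 [a [I2 ha p2E]]] := chart_surj chE p2.
have [x3 [b [I3 hb p3E]]] := chart_surj chE p3.
have e2 : x2 = 2 * r by rewrite -d12 p2E (chart_dist0 chE).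
have e3 : x3 = 2 * r by rewrite -d13 p3E (chart_dist0 chE).
rewrite e2 in p2E; rewrite e3 in p3E => {x2 x3 e2 e3 I2 I3}.
have cE := corner_angle_cos chE p2E p3E d23.
have cs := cos2Dsin2 (2 * theta).
have : sin (b - a) ^+ 2 = sin (2 * theta) ^+ 2.
  by have := cos2Dsin2 (b - a); rewrite cE; lra.
move/eqP; rewrite eqf_sqr => h; exists E; case/orP: h => [/eqP sE|/eqP sE].
  have [|psi0 [h1 h2 h3]] := oriented_chart p2E p3E chE ha; last by exists psi0; split=> //; split=> //; left.
  by rewrite cosB cE sE -!expr2.
have [|psi0 [h1 h2 h3]] := oriented_chart p3E p2E chE hb; last by exists psi0; split=> //; split=> //; right.
by rewrite cosB -[a - b]opprB cosN sinN cE sE opprK -!expr2.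
Qed.

Lemma borel_cone Tri (p1 p2 p3 : plane_of R g) : is_cone Tri p1 p2 p3 ->
  dist p1 p2 = 2 * r -> dist p2 p3 = 2 * r -> dist p3 p1 = 2 * r -> borel Tri.
Proof.
move=> coneT d12 d23 d31.
have [E [psi0 [chE [_ [[h2 h3]|[h2 h3]]]]]] := corner_chart d12 d23 d31.
  exact: (borel_Tri Rc1 r0 rR chE h2 h3 r_pi coneT).
exact: (borel_Tri Rc1 r0 rR chE h2 h3 r_pi (is_cone_swap coneT)).
Qed.

Lemma regular_corner Tri (p1 p2 p3 : plane_of R g) W rho : is_cone Tri p1 p2 p3 ->
  dist p1 p2 = 2 * r -> dist p2 p3 = 2 * r -> dist p3 p1 = 2 * r ->
  0 <= rho -> rho <= Rc -> borel W ->
  (forall z, Tri z -> dist z p1 < dist z p2 -> dist z p1 < dist z p3 ->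
    dist p1 z <= rho -> W z) ->
  (forall z, W z -> [/\ Tri z, dist z p1 <= dist z p2, dist z p1 <= dist z p3 &
    dist p1 z <= Rc -> dist p1 z <= rho]) ->
  area W = (2 * sector g Rc (gT g r) rho)%:E.
Proof.
move=> coneT d12 d23 d31 p0 pR nW lo hi.
have [E [psi0 [chE [hpsi [[h2 h3]|[h2 h3]]]]]] := corner_chart d12 d23 d31.
  exact: (corner_area Rc0 Rc1 r0 rR circum chE hpsi h2 h3 r_pi coneT p0 pR nW lo hi).
apply: (corner_area Rc0 Rc1 r0 rR circum chE hpsi h2 h3 r_pi (is_cone_swap coneT) p0 pR nW).
- by move=> z Tz h h'; exact: lo.
- by move=> z /hi[? ? ? ?]; split.
Qed.

(** The triangle is divided according to the nearest vertex, and the monotonicity of [b] ensures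
    that a covered point is covered from that vertex. Keeping [b] abstract serves disks of any
    radius as well as the whole plane. *)
Lemma triangle_union_area Tri (p1 p2 p3 : plane_of R g) (b : plane_of R g -> set (plane_of R g)) rho :
  is_cone Tri p1 p2 p3 ->
  dist p1 p2 = 2 * r -> dist p2 p3 = 2 * r -> dist p3 p1 = 2 * r ->
  0 <= rho -> rho <= Rc -> (forall p, borel (b p)) ->
  (forall p z, dist p z <= rho -> b p z) ->
  (forall p z, b p z -> dist p z <= Rc -> dist p z <= rho) ->
  (forall p q z, dist p z <= dist q z -> b q z -> b p z) ->
  area ((b p1 `|` b p2 `|` b p3) `&` Tri) = (6 * sector g Rc (gT g r) rho)%:E.
Proof.
move=> coneT d12 d23 d31 p0 pR nb blo bhi bmono.
have nT := borel_cone coneT d12 d23 d31.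
(* Ties between vertices go to the one of smaller index, which makes the three corners disjoint. *)
pose W1 := b p1 `&` Tri `&` [set z | dist z p1 <= dist z p2] `&` [set z | dist z p1 <= dist z p3].
pose W2 := b p2 `&` Tri `&` [set z | dist z p2 <= dist z p3] `&` [set z | dist z p2 < dist z p1].
pose W3 := b p3 `&` Tri `&` [set z | dist z p3 < dist z p1] `&` [set z | dist z p3 < dist z p2].
have n1 : borel W1 by do 2![apply: borelI; last exact: borel_le]; apply: borelI.
have n2 : borel W2 by apply: borelI; [apply: borelI; [exact: borelI|exact: borel_le]|exact: borel_lt].
have n3 : borel W3 by do 2![apply: borelI; last exact: borel_lt]; apply: borelI.
have a1 : area W1 = (2 * sector g Rc (gT g r) rho)%:E.
  apply: (regular_corner coneT d12 d23 d31 p0 pR n1).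
  - by move=> z Tz h2 h3 hz; split; [split; [split; [exact: blo|]|exact: ltW]|exact: ltW].
  - by move=> z [[[bz Tz] h2] h3]; split=> //; exact: bhi.
have a2 : area W2 = (2 * sector g Rc (gT g r) rho)%:E.
  apply: (regular_corner (is_cone_rot coneT) d23 d31 d12 p0 pR n2).
  - by move=> z Tz h2 h3 hz; split; [split; [split; [exact: blo|]|exact: ltW]|].
  - by move=> z [[[bz Tz] h2] h3]; split=> //; [exact: ltW|exact: bhi].
have a3 : area W3 = (2 * sector g Rc (gT g r) rho)%:E.
  apply: (regular_corner (is_cone_rot (is_cone_rot coneT)) d31 d12 d23 p0 pR n3).
  - by move=> z Tz h2 h3 hz; split; [split; [split; [exact: blo|]|]|].
  - by move=> z [[[bz Tz] h2] h3]; split=> //; [exact: ltW|exact: ltW|exact: bhi].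
have -> : (b p1 `|` b p2 `|` b p3) `&` Tri = (W1 `|` W2) `|` W3.
  apply/seteqP; split=> z; last first.
    by move=> [[[[[bz Tz] _] _]|[[[bz Tz] _] _]]|[[[bz Tz] _] _]]; split=> //;
      [left; left|left; right|right].
  move=> [bz Tz]; pose m := Num.min (dist z p1) (Num.min (dist z p2) (dist z p3)).
  have move_to p : dist z p <= dist z p1 -> dist z p <= dist z p2 -> dist z p <= dist z p3 -> b p z.
    rewrite ![dist z _]dist_sym => h1 h2 h3.
    by move: bz => [[|]|]; apply: bmono.
  have [h12|h21] := leP (dist z p1) (dist z p2).
    have [h13|h31] := leP (dist z p1) (dist z p3).
      by left; left; split=> //; split=> //; split=> //; exact: move_to.
    right; split; last exact: lt_le_trans h31 h12.
    by split=> //; split=> //; apply: move_to => //; [exact: ltW|exact: le_trans (ltW h31) h12].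
  have [h23|h32] := leP (dist z p2) (dist z p3).
    by left; right; split=> //; split=> //; split=> //; apply: move_to => //; exact: ltW.
  right; split=> //; split; last exact: lt_trans h32 h21.
  by split=> //; apply: move_to => //; [apply: ltW; exact: lt_trans h32 h21|exact: ltW].
rewrite areaU//; last 2 first.
- exact: borelU.
- rewrite -subset0 => z [[[[_ h] h']|[[_ h] h']] [[_ k] k']] /=; move: h h' k k' => /=; lra.
rewrite areaU//; last first.
  rewrite -subset0 => z [[[_ h] _] [_ k]]; move: h k => /=; lra.
by rewrite a1 a2 a3 -!EFinD; congr EFin; ring.
Qed.

End RegularTriangle.

(** * Comparison of areas *)

(** Centres are written at distance [2 * d n], so that [d n] is the distance of the bisector;
    halving also brings it below [pi / 2] on the sphere. *)
Lemma cell_coordinates g r (F : set (disk (plane_of R g))) B :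
  0 < r -> (g = Spherical -> r < pi / 2) -> (forall D, F D -> disk_radius D = r) ->
  packing F -> F B ->
  exists E J (d psi : nat -> R), [/\ is_chart (disk_center B) E,
    forall n, J n -> r <= d n /\ (g = Spherical -> d n <= pi / 2),
    forall n, 0 <= psi n < 2 * pi,
    forall n m, J n -> J m -> n <> m ->
      gS g r ^+ 2 <= gS g (d n - d m) ^+ 2 +
        2 * (gS g (d n) * gC g (d n)) * (gS g (d m) * gC g (d m)) * (1 - cos (psi n - psi m)) &
    borel (voronoi_cell F B) /\
    forall x p, voronoi_cell F B (E x p) <-> cell g J d psi x p].
Proof.
move=> r0 rpi Fr packF FB; have pi0 := pi_gt0 R.
have [J [c [c1 c2 c3]]] := packing_centers r0 rpi Fr packF FB.
have [E chE] := chart_exists (disk_center B).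
have polar_c n : exists z : R * R, [/\ idom g (2 * z.1), 0 <= z.2 < 2 * pi & c n = E (2 * z.1) z.2].
  have [x [p [Ix hp cE]]] := chart_surj chE (c n).
  have xE : 2 * (x / 2) = x by field.
  by exists (x / 2, p) => /=; rewrite xE.
have [z zE] := choice polar_c.
have far n : J n -> r <= (z n).1 /\ (g = Spherical -> (z n).1 <= pi / 2).
  have [Iz _ cE] := zE n; move=> /c1; rewrite cE (chart_dist0 chE)// => h.
  by split=> [|gE]; [lra|have := ((idomP g _).1 Iz).2 gE; lra].
exists E, J, (fun n => (z n).1), (fun n => (z n).2); split=> //.
- by move=> n; have [] := zE n.
- move=> n m Jn Jm nm; have := c2 n m Jn Jm nm.
  rewrite double_le_dist; last by apply/idomP; split; [lra|move=> /rpi; lra].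
  have [In hn cn] := zE n; have [Im hm cm] := zE m.
  rewrite cn cm -dist_chord (chart_chord chE).
  have -> : (2 * (z n).1 - 2 * (z m).1) / 2 = (z n).1 - (z m).1 by field.
  rewrite !gS_double; lra.
have cellE x p : voronoi_cell F B (E x p) <-> cell g J (fun n => (z n).1) (fun n => (z n).2) x p.
  have key n : J n -> (dist (E x p) (disk_center B) <= dist (E x p) (c n)) =
      (gS g x * gC g (z n).1 * cos (p - (z n).2) <= gC g x * gS g (z n).1).
    move=> /far[rz zpi]; have [_ _ ->] := zE n; apply: (chart_half_plane _ _ _ chE).
      exact: lt_le_trans rz.
    by move=> /zpi; lra.
  by rewrite c3; split=> h n Jn; [rewrite -key//; exact: h|rewrite key//; exact: h].
split=> //.
pose A n : set (plane_of R g) := [set x | J n -> dist x (disk_center B) <= dist x (c n)].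
have -> : voronoi_cell F B = \bigcap_n A n.
  apply/seteqP; split=> x; first by move=> /c3 h n _ Jn; exact: h.
  by move=> h; apply/c3 => n Jn; exact: (h n I Jn).
apply: borel_bigcap => n; have [Jn|Jn] := pselect (J n).
  by have [M mM ME] := borel_le (disk_center B) (c n); exists M => // x; rewrite -ME; split=> [h|h _]; [exact: h|].
by exists setT => // x; split=> // _ /Jn.
Qed.

(** The denominator [y] may be the infinite area of an unbounded cell; the quotient is then 0. *)
Lemma lee_div_fin (x y : \bar R) (b c : R) : (0 <= x)%E -> (0 < y)%E -> 0 <= b -> 0 < c ->
  (x * c%:E <= b%:E * y)%E -> (x / y <= b%:E / c%:E)%E.
Proof.
move=> x0 y0 b0 c0; rewrite inver gt_eqF// -EFinM.
case: y y0 => [y| |//]; last by rewrite invey mule0 lee_fin divr_ge0// ltW.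
rewrite lte_fin => y0; rewrite inver gt_eqF// -EFinM.
case: x x0 => [x| |//]; last by rewrite gt0_mulye ?lte_fin// leye_eq.
by move=> x0; rewrite -!EFinM !lee_fin ler_pdivrMr// mulrAC ler_pdivlMr.
Qed.

Lemma circleT : circle (@setT R) = (2 * pi)%:E.
Proof.
rewrite /circle setIT lebesgue_measure_itv/= lte_fin mulr_gt0 ?pi_gt0//.
by rewrite oppr0 adde0.
Qed.

Lemma area_ball g (q : plane_of R g) rho : 0 < rho -> (g = Spherical -> rho < pi) ->
  area (body (Disk q rho)) = (2 * pi * gf g rho)%:E.
Proof.
move=> p0 ppi; have [E chE] := chart_exists q.
rewrite -[body _]setIT (area_within chE (borelT g)); last by move=> /ppi/ltW.
have intS : mu.-integrable `[0, rho] (EFin \o gS g).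
  apply: continuous_compact_integrable; first exact: segment_compact.
  by apply: continuous_subspaceT; exact: continuous_gS.
transitivity ((2 * pi)%:E * \int[mu]_(x in `[0%R, rho]) (gS g x)%:E)%E; last first.
  by rewrite Rintegral_EFin// disk_integral.
rewrite -ge0_integralZl_EFin//.
- apply: eq_integral => x _; rewrite muleC; congr (_ * _)%E.
  by rewrite -circleT.
- move=> x /=; rewrite in_itv/= => /andP[x0 xr]; rewrite lee_fin; apply: gS_ge0.
  by apply/idomP; split=> // /ppi h; exact: le_trans xr (ltW h).
- by apply/measurable_EFinP; apply: measurable_funTS; exact: measurable_gS.
- by rewrite mulr_ge0// pi_ge0.
Qed.

(** No bisector enters the disk of radius [r], so the width is constant there. *)
Lemma sector_small g (Rc r : R) : 0 < r -> r < Rc -> (g = Spherical -> Rc < pi / 2) ->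
  sector g Rc (gT g r) r = phi g (gT g r) Rc * gf g r.
Proof.
move=> r0 rR Rc1; have r1 : 0 < gT g r by apply: (gT_gt0 Rc1); rewrite r0 ltW.
transitivity (\int[mu]_(x in `[0, r]) (phi g (gT g r) Rc * gS g x)).
  apply: eq_Rintegral => x; rewrite inE/= in_itv/= => /andP[x0 xr].
  have xR := le_trans xr (ltW rR).
  by rewrite /width [phi g _ x](phi0 Rc1 r1) ?subr0 1?mulrC ?x0// (gT_le Rc1 x0 xr (ltW rR)).
rewrite RintegralZl// ?disk_integral//.
apply: continuous_compact_integrable; first exact: segment_compact.
by apply: continuous_subspaceT; exact: continuous_gS.
Qed.

Lemma sector_homo g (Rc t a b : R) : (g = Spherical -> Rc < pi / 2) -> 0 < t -> 0 <= a ->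
  a <= b -> b <= Rc -> sector g Rc t a <= sector g Rc t b.
Proof.
move=> Rc1 t0 a0 ab bR.
have := @Rintegral_itvB R _ (BLeft 0) (BRight b) a (integrable_sector Rc1 t (le_trans a0 ab) bR).
rewrite !bnd_simp => /(_ a0 ab) h; rewrite -subr_ge0 /sector h.
apply: Rintegral_ge0 => x /=; rewrite in_itv/= => /andP[ax xb].
have x0 := le_trans a0 (ltW ax); have xR := le_trans xb bR.
by rewrite mulr_ge0 ?(gS_ge0_Rc Rc1)// (width_ge0 Rc1 t0)// x0.
Qed.

End Coordinates.

Theorem theorem1p10 (R : realType) (g : geometry) (lambda r : R)
    (F : set (disk (plane_of R g))) (B : disk (plane_of R g))
    (p1 p2 p3 : plane_of R g) :
  0 <= lambda -> 0 < r ->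
  (g = Spherical -> r < pi / 3) ->
  (forall D, F D -> disk_radius D = r) ->
  packing F ->
  F B ->
  let q := disk_center B in
  let V := voronoi_cell F B in
  (g = Spherical -> forall v, vertex V v -> dist q v < pi / 2) ->
  let Blambda := body (Disk q ((1 + lambda) * r)) in
  regular_triangle (2 * r) p1 p2 p3 ->
  let T := triangle p1 p2 p3 in
  let U := (body (Disk p1 r) `|` body (Disk p2 r) `|` body (Disk p3 r)) `&` T in
  let U' := (body (Disk p1 ((1 + lambda) * r)) `|`
             body (Disk p2 ((1 + lambda) * r)) `|`
             body (Disk p3 ((1 + lambda) * r))) `&` T in
  (area (body B) / area (Blambda `&` V) <= area U / area U')%E /\
  (area (Blambda `&` V) / area V <= area U' / area T)%E.
Proof.
move=> lambda0 r0 rpi3 Fr packF FB q V _ Bl [[d12 d23 d31] _] T U U'.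
have pi0 := pi_gt0 R.
have rpi2 : g = Spherical -> r < pi / 2 by move=> /rpi3; lra.
have rpi : g = Spherical -> r < pi by move=> /rpi3; lra.
have [Rc [Rc0 Rc1 rR circ]] := circumradius r0 rpi3.
have coneT : is_cone T p1 p2 p3 := fun z => triangle_cone z r0 rpi3 d12 d23 d31.
have [E [J [d [psi [chE far hpsi sep [nV VE]]]]]] := cell_coordinates r0 rpi2 Fr packF FB.
(* The cell is controlled inside the disk of radius [Rc], and the triangle has no point farther than
   [Rc] from its nearest vertex, so that [m] takes the place of [rho]. *)
pose rho := (1 + lambda) * r; pose m := Num.min rho Rc.
have r_rho : r <= rho by rewrite ler_peMl ?(ltW r0)// lerDl.
have mR : m <= Rc by rewrite ge_min lexx orbT.
have m_rho : m <= rho by rewrite ge_min lexx.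
have rm : r <= m by rewrite le_min r_rho ltW.
have m0 : 0 < m by exact: lt_le_trans rm.
have t0 : 0 < phi g (gT g r) Rc := theta_gt0 Rc1 r0 rR.
have tau0 : 0 < gT g r by apply: (gT_gt0 Rc1); rewrite r0 ltW.
have gf0 : 0 < gf g r by exact: gf_gt0.
have sr := sector_small r0 rR Rc1.
have sr0 : 0 < sector g Rc (gT g r) r by rewrite sr mulr_gt0.
have sm0 : 0 < sector g Rc (gT g r) m.
  by apply: lt_le_trans sr0 _; exact: (sector_homo Rc1 tau0 (ltW r0) rm mR).
have sR0 : 0 < sector g Rc (gT g r) Rc.
  by apply: lt_le_trans sm0 _; exact: (sector_homo Rc1 tau0 (ltW m0) mR (lexx _)).
have union := triangle_union_area Rc0 Rc1 r0 rR rpi3 circ coneT d12 d23 d31.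
have areaU : area U = (6 * sector g Rc (gT g r) r)%:E.
  apply: (union (fun p => body (Disk p r))) => //; try exact: ltW.
    by move=> p; exact: borel_ball.
  by move=> p p' z h; exact: le_trans.
have areaU' : area U' = (6 * sector g Rc (gT g r) m)%:E.
  apply: (union (fun p => body (Disk p rho))) => //; try exact: ltW.
  - by move=> p; exact: borel_ball.
  - by move=> p z h; exact: le_trans m_rho.
  - by move=> p z h h'; rewrite le_min h h'.
  - by move=> p p' z h; exact: le_trans.
(* The triangle itself is the case in which every disk is the whole plane. *)
have areaT : area T = (6 * sector g Rc (gT g r) Rc)%:E.
  have -> : T = (setT `|` setT `|` setT) `&` T by rewrite !setTU setTI.
  by apply: (union (fun p => setT)) => //; [exact: ltW|move=> p; exact: borelT].
have areaB : area (body B) = (2 * pi * gf g r)%:E.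
  have := Fr B FB; rewrite /q; case: (B) => c s /= ->; exact: area_ball.
have cellE x : 0 <= x -> x <= Rc -> area (body (Disk q x) `&` V) = cell_area g J d psi x.
  move=> x0 xR; rewrite (area_within chE nV); last by move=> /Rc1; lra.
  apply: eq_integral => y _; congr (_ * circle _)%E.
  by apply/seteqP; split=> p /VE.
have nBl x : borel (body (Disk q x) `&` V) by apply: borelI => //; exact: borel_ball.
have cell_m : (cell_area g J d psi m <= area (Bl `&` V))%E.
  rewrite -(cellE m (ltW m0) mR); apply: (area_le (nBl _) (nBl _)).
  by move=> z [h Vz]; split=> //; exact: le_trans h m_rho.
have cell_R : (cell_area g J d psi Rc <= area V)%E.
  by rewrite -(cellE Rc (ltW Rc0) (lexx _)); apply: (area_le (nBl _) nV) => z [].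
have lower := le_trans (cell_area_ge Rc0 Rc1 r0 rR circ far hpsi sep (ltW m0) mR) cell_m.
have v0 : (0 < area (Bl `&` V))%E.
  by apply: lt_le_trans lower; rewrite lte_fin !mulr_gt0// invr_gt0.
have vV : (area (Bl `&` V) <= area V)%E by apply: (area_le (nBl _) nV) => z [].
rewrite areaU areaU' areaT areaB; split.
- apply: lee_div_fin => //.
  + by rewrite lee_fin !mulr_ge0// ltW.
  + by rewrite mulr_ge0// ltW.
  + by rewrite mulr_gt0.
  have b0 : (0 <= (6 * sector g Rc (gT g r) r)%:E)%E by rewrite lee_fin mulr_ge0// ltW.
  apply: le_trans (lee_wpmul2l b0 lower).
  (* Against the lower bound for the cell, the first inequality becomes an equality, since uncut
     disks are proportional to their angle. *)
  rewrite -!EFinM lee_fin sr le_eqVlt; apply/orP; left; apply/eqP.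
  field; exact: lt0r_neq0.
apply: lee_div_fin.
- exact: ltW.
- exact: lt_le_trans vV.
- by rewrite mulr_ge0// ltW.
- by rewrite mulr_gt0.
(* For [Rc <= rho] the right side is 1, because the enlarged disks cover the triangle. *)
have [Rrho|rhoR] := leP Rc rho.
  have -> : m = Rc by rewrite /m; apply/min_idPr.
  rewrite muleC; apply: lee_wpmul2l vV; by rewrite lee_fin mulr_ge0// ltW.
have mE : m = rho by rewrite /m; apply/min_idPl; exact: ltW.
have ratio := cell_area_ratio Rc0 Rc1 r0 rR circ far hpsi sep (ltW m0) mR.
rewrite -(cellE m (ltW m0) mR) {1}mE in ratio.
rewrite !EFinM muleCA -[leRHS]muleA; apply: lee_wpmul2l => //.
apply: (le_trans ratio); apply: lee_wpmul2l => //.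
by rewrite lee_fin ltW.
Qed.
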